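(* Consider a sequence (indexed by the number of states $n$) of Block Markov Chains with fixed parameters $(\alpha,p)$, as defined in the context. Assume $\min_{k\in[K]}\alpha_k>0$, that $p$ is irreducible (with stationary distribution $\pi$), and that $\ell_n=\omega(n)$. Let $\gamma_n>0$ be a deterministic sequence with $\gamma_n=\omega(\sqrt{\ell_n/n})$ and $\gamma_n=o(\ell_n/n)$. Then the singular value thresholding estimator $$\hat K^{\mathrm{spec}}:=|\{i\in[n]:\sigma_i(\hat N_\Gamma)\ge\gamma_n\}|$$ satisfies $\mathbb P[\hat K^{\mathrm{spec}}=\mathrm{rank}(p)]\to1$ as $n\to\infty$.
   Context: Notation: $[m]=\{1,\dots,m\}$; for deterministic positive sequences, $a_n=\omega(b_n)$ means $a_n/b_n\to\infty$ and $a_n=o(b_n)$ means $a_n/b_n\to0$. $\sigma_1(A)\ge\sigma_2(A)\ge\dots$ denote the singular values of a matrix $A$. Block Markov Chain (BMC): fix $K\in\mathbb N_{\ge1}$, a stochastic matrix $p=(p_{i,j})_{i,j\in[K]}$ and $\alpha=(\alpha_k)_{k\in[K]}$ with $\sum_k\alpha_k=1$. For each (sufficiently large) $n$ there is a surjective map $\sigma:[n]\to[K]$ (depending on $n$) with clusters $\mathcal V_k=\sigma^{-1}(k)$ satisfying $|\mathcal V_k|/n\to\alpha_k$ as $n\to\infty$. The BMC is the Markov chain $(X_t)_{t\ge0}$ on $[n]$ with transition matrix $P_{x,y}=p_{\sigma(x),\sigma(y)}/|\mathcal V_{\sigma(y)}|$. If $p$ is irreducible with stationary distribution $\pi$, then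 $\Pi_x=\pi_{\sigma(x)}/|\mathcal V_{\sigma(x)}|$ is the unique stationary distribution of $P$. One observes a trajectory $X_0,\dots,X_{\ell_n}$ with $X_0\sim\Pi$, where $(\ell_n)$ is a deterministic sequence of positive integers. Trimmed count matrix: $\hat N_{x,y}=\sum_{t=0}^{\ell_n-1}\mathbf 1\{X_t=x,X_{t+1}=y\}$ for $x,y\in[n]$. $\Gamma\subseteq[n]$ is the set of the $\lfloor n\exp(-\ell_n/n)\rfloor$ most visited states, i.e. those $y$ with the largest column sums $\sum_x\hat N_{x,y}$ (ties broken arbitrarily), and $(\hat N_\Gamma)_{x,y}=\hat N_{x,y}\mathbf 1\{x\notin\Gamma,\,y\notin\Gamma\}$. *)

(* Defs.v *)
From HB Require Import structures.
From mathcomp Require Import all_boot all_order all_algebra.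
From mathcomp Require Import all_classical all_reals all_analysis.
From mathcomp Require Import sesquilinear spectral complex.

Set Implicit Arguments.
Unset Strict Implicit.
Unset Printing Implicit Defensive.

Import Order.TTheory GRing.Theory Num.Theory.
Import numFieldNormedType.Exports.

Local Open Scope classical_set_scope.
Local Open Scope ring_scope.

(** ** Singular values *)

(* The singular values of a real square matrix [A] are the square roots of the
   eigenvalues of the symmetric matrix [A^T *m A], listed with multiplicity in
   decreasing order.  The library diagonalises over a closed field, hence the
   detour through [R[i]]; [singular_valuesP] below characterises the list
   without it. *)
Definition singular_values (R : realType) (n : nat) (A : 'M[R]_n) : seq R :=
  let D : 'rV[R[i]]_n := spectral_diag (map_mx (real_complex R) (A^T *m A)) in
  sort (fun x y => y <= x)
    [seq Num.sqrt (complex.Re (D ord0 i)) | i <- enum 'I_n].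

(* Indices start at 0: [singular_value A i] is $\sigma_{i+1}(A)$. *)
Definition singular_value (R : realType) (n : nat) (A : 'M[R]_n) (i : nat) : R :=
  nth 0 (singular_values A) i.

Lemma size_singular_values (R : realType) (n : nat) (A : 'M[R]_n) :
  size (singular_values A) = n.
Proof. by rewrite size_sort size_map size_enum_ord. Qed.

Lemma char_poly_similar (F : fieldType) (n : nat) (P A : 'M[F]_n) :
  P \in unitmx -> char_poly (invmx P *m A *m P) = char_poly A.
Proof.
move=> Pu; rewrite /char_poly.
have VP : map_mx polyC (invmx P) *m map_mx polyC P = 1%:M.
  by rewrite -map_mxM mulVmx // map_mx1.
have -> : char_poly_mx (invmx P *m A *m P) =
    map_mx polyC (invmx P) *m char_poly_mx A *m map_mx polyC P.
  by rewrite /char_poly_mx mulmxBr mulmxBl !map_mxM scalar_mxC -['X%:M *m _ *m _]mulmxA VP mulmx1.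
by rewrite !det_mulmx mulrAC -det_mulmx VP det1 mul1r.
Qed.

Lemma spectral_diag_gram (R : realType) (n : nat) (A : 'M[R]_n)
    (M := map_mx (real_complex R) (A^T *m A)) :
  [/\ M = invmx (spectralmx M) *m diag_mx (spectral_diag M) *m spectralmx M
    & forall i, 0 <= spectral_diag M ord0 i].
Proof.
have Ac : (map_mx (real_complex R) A)^T = ((map_mx (real_complex R) A)^T ^ Num.conj)%sesqui.
  by apply/matrixP => i j; rewrite !mxE; apply/esym/conjc_real.
set B := map_mx (real_complex R) A in Ac.
have ME : M = B^T *m B by rewrite /M map_mxM map_trmx.
have Mn : M \is normalmx.
  apply/normalmxP.
  suff -> : map_mx Num.conj M^T = M by [].
  have AT : (A^T *m A)^T = A^T *m A by rewrite trmx_mul trmxK.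
  apply/matrixP => i j; rewrite /M -[in RHS]AT [LHS]mxE [X in Num.conj X]mxE.
  by rewrite [X in Num.conj X]mxE [RHS]mxE [in RHS]mxE; exact: conjc_real.
have /orthomx_spectralP H := Mn; split => // i.
have Pu := spectral_unitarymx M.
set P := spectralmx M in H Pu *.
have : P *m M *m invmx P = diag_mx (spectral_diag M).
  by rewrite [in LHS]H !mulmxA mulmxV ?unitarymx_unit // mul1mx mulmxK ?unitarymx_unit.
move=> /matrixP/(_ i i); rewrite [in RHS]mxE eqxx mulr1n => <-.
rewrite invmx_unitary // ME.
have -> : P *m (B^T *m B) *m map_mx Num.conj P^T =
   (P *m B^T) *m map_mx Num.conj (P *m B^T)^T.
  rewrite trmx_mul trmxK map_mxM !mulmxA; congr (_ *m _ *m _).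
  by apply/matrixP => a b; rewrite !mxE; apply/esym/conjc_real.
rewrite mxE; apply: sumr_ge0 => j _.
by rewrite ![map_mx _ _ _ _]mxE [_^T _ _]mxE mul_conjC_ge0.
Qed.

Lemma singular_valuesP (R : realType) (n : nat) (A : 'M[R]_n) :
  [/\ sorted (fun x y => y <= x) (singular_values A),
      all (fun x => 0 <= x) (singular_values A) &
      char_poly (A^T *m A) =
        \prod_(x <- singular_values A) ('X - (x ^+ 2)%:P)].
Proof.
split.
- by apply: sort_sorted => x y; exact: le_total.
- by rewrite all_sort; apply/allP => x /mapP[i _ ->]; rewrite sqrtr_ge0.
have [H D0] := spectral_diag_gram A; rewrite /singular_values.
set D := spectral_diag _ in H D0 *.
apply: (map_poly_inj (real_complex R)).
rewrite map_char_poly [in LHS]H char_poly_similar; last first.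
  exact: spectral_unit.
rewrite char_poly_trig ?diag_mx_is_trig //.
rewrite (perm_big _ (permEl (perm_sort _ _))) big_map big_enum rmorph_prod /=.
apply: eq_bigr => i _.
rewrite mxE eqxx mulr1n rmorphB /= map_polyX map_polyC /=.
move: (D0 i); rewrite lecE /=; case: (D ord0 i) => a b /= /andP[/eqP -> a0].
by rewrite sqr_sqrtr.
Qed.

(** ** Asymptotic comparison of sequences *)

Definition little_omega (R : realType) (a b : nat -> R) : Prop :=
  a n / b n @[n --> \oo] --> +oo.

Definition little_o (R : realType) (a b : nat -> R) : Prop :=
  a n / b n @[n --> \oo] --> (0 : R).

(** ** Finite Markov chains *)

Definition is_stochastic (R : realType) (K : nat) (p : 'M[R]_K) : Prop :=
  (forall i j, 0 <= p i j) /\ (forall i, \sum_j p i j = 1).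

Definition is_irreducible (R : realType) (K : nat) (p : 'M[R]_K) : Prop :=
  forall i j, exists t : nat, 0 < (p ^+ t) i j.

Definition is_stationary (R : realType) (K : nat) (p : 'M[R]_K)
    (pi : 'rV[R]_K) : Prop :=
  [/\ forall i, 0 <= pi ord0 i, \sum_i pi ord0 i = 1 & pi *m p = pi].

(* The Markov property is stated in product form,
   P(X_0 = x_0, ..., X_{t+1} = x_{t+1})
     = P(X_0 = x_0, ..., X_t = x_t) * Q(x_t, x_{t+1}),
   which is void for histories of probability zero. *)
Definition is_markov_chain (R : realType) (d : measure_display)
    (T : measurableType d) (P : probability T R) (n : nat)
    (mu : 'rV[R]_n) (Q : 'M[R]_n) (X : nat -> T -> 'I_n) : Prop :=
  [/\ forall t x, measurable [set w | X t w = x],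
      forall x, P [set w | X 0 w = x] = (mu ord0 x)%:E
    & forall t (x : nat -> 'I_n),
        P [set w | forall s, (s <= t.+1)%N -> X s w = x s] =
        (P [set w | forall s, (s <= t)%N -> X s w = x s]
           * (Q (x t) (x t.+1))%:E)%E].

(** ** Block Markov chains *)

Definition block (n K : nat) (sigma : 'I_n -> 'I_K) (k : 'I_K) : {set 'I_n} :=
  [set x | sigma x == k]%SET.

Definition bmc_matrix (R : realType) (n K : nat) (p : 'M[R]_K)
    (sigma : 'I_n -> 'I_K) : 'M[R]_n :=
  \matrix_(x, y) (p (sigma x) (sigma y) / #|block sigma (sigma y)|%:R).

Definition bmc_stationary (R : realType) (n K : nat) (pi : 'rV[R]_K)
    (sigma : 'I_n -> 'I_K) : 'rV[R]_n :=
  \row_x (pi ord0 (sigma x) / #|block sigma (sigma x)|%:R).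

(** ** The trimmed count matrix and the estimator *)

(* A trajectory is a function [x : nat -> 'I_n], of which only the values at
   the times [0], ..., [ell] are used. *)
Definition count_matrix (R : realType) (n ell : nat) (x : nat -> 'I_n) :
    'M[R]_n :=
  \matrix_(i, j) (\sum_(t < ell) ((x t == i) && (x t.+1 == j)))%N%:R.

Definition trim_size (R : realType) (n ell : nat) : nat :=
  Num.truncn (n%:R * expR (- (ell%:R / n%:R)) : R).

(* [G] consists of [m] states with the largest column sums of [N]; all ways of
   breaking ties are allowed. *)
Definition is_most_visited (R : realType) (n m : nat) (N : 'M[R]_n)
    (G : {set 'I_n}) : Prop :=
  #|G| = m /\
  forall y z, y \in G -> z \notin G -> \sum_x N x z <= \sum_x N x y.

Definition trim (R : realType) (n : nat) (G : {set 'I_n}) (N : 'M[R]_n) :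
    'M[R]_n :=
  \matrix_(x, y) (N x y *+ ((x \notin G) && (y \notin G))).

Definition K_spec (R : realType) (n : nat) (gamma : R) (A : 'M[R]_n) : nat :=
  #|[set i : 'I_n | gamma <= singular_value A i]%SET|.

(* Main.v *)
(* Write d = ell / n.  The count matrix is compared with the block-constant
   matrix D with entries n_k p_kl / (|V_k| |V_l|), where n_k is the number of
   visits to block k: rank D <= rank p, irreducibility gives n_k >= c ell, and
   trimming removes few states of each block, so that D still stretches a
   subspace of dimension rank p by a factor of order d.  The claim follows once
   the trimmed noise has operator norm O(sqrt d).

   Given the block sequence the states are independent and uniform in their
   blocks, so the transitions at even times are independent, and so are those
   at odd times; AM-GM combines the two exponential moments, and everything
   reduces to Chernoff bounds for independent variables.

   The norm is bounded as by Feige and Ofek.  A rounding argument reduces to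
   integer vectors z, w with |z|^2, |w|^2 <= 16 n.  The light pairs
   |z_u w_v| <= sqrt d are controlled by Bernstein's inequality and a union
   bound over all z, w.  For the heavy pairs let A_i, C_j be the dyadic level
   sets of |z|, |w|.  For each (i, j) a Poisson tail at the single exponent m
   with 2^m ~ 2^(i+j) / sqrt d is used, with a union bound over all pairs of
   sets in which a set A of level i costs
   3 (i+1) |A| + n 8^-(i+1) + M (i+1); these costs are summable against the
   weights that occur, which removes the usual case analysis.  Pairs of levels
   with ratio beyond sqrt d are handled by the degree bound that trimming
   provides.  The parameter M makes the failure probability O(exp(-M)) +
   exp(-d), at the price of a factor M in the norm. *)
Require Import Defs.
From mathcomp Require Import all_boot all_order all_algebra.
From mathcomp Require Import all_classical all_reals all_analysis.
From mathcomp Require Import spectral complex ring lra zify.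

Set Implicit Arguments.
Unset Strict Implicit.
Unset Printing Implicit Defensive.

Import Order.TTheory GRing.Theory Num.Theory.
Import numFieldNormedType.Exports.

Local Open Scope ring_scope.

(** * Singular values and low-rank approximation *)

Section SingularValueCount.
Variable R : realType.
Implicit Types n r : nat.

(** Consecutive transitions share a state, so the entries of the count matrix are dependent even
    given the block sequence; splitting by the parity of time costs only the factor 1/2 in the
    exponents of [chain_exp_half_sum_le1]. The comparison matrix keeps the random visit counts n_k,
    so their convergence to stationarity is never at issue: its rank is at most that of p for any
    n_k, and the n_k are bounded below because they form an almost invariant vector of p. Since
    gamma_n exceeds every fixed multiple of sqrt (ell / n), M can be fixed by the tolerated failure
    probability before n grows; no rate in n is sought. *)

Definition sqn n (x : 'cV[R]_n) : R := \sum_i x i ord0 ^+ 2.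

Lemma sqn_ge0 n (x : 'cV[R]_n) : 0 <= sqn x.
Proof. by apply: sumr_ge0 => i _; exact: sqr_ge0. Qed.

Lemma sqn_eq0 n (x : 'cV[R]_n) : (sqn x == 0) = (x == 0).
Proof.
rewrite /sqn psumr_eq0 => [|i _]; last exact: sqr_ge0.
apply/allP/eqP => [h|-> i _]; last by rewrite mxE expr0n eqxx implybT.
apply/matrixP => i j; rewrite ord1 mxE; apply/eqP.
by have := h i (mem_index_enum _); rewrite sqrf_eq0.
Qed.

Lemma sqn0 n : sqn (0 : 'cV[R]_n) = 0.
Proof. by apply/eqP; rewrite sqn_eq0. Qed.

(** [spectralmx] is complex even for a real symmetric matrix; splitting into real and imaginary
    parts brings vectors of its eigenspaces back to the real vectors on which the hypotheses
    bear. *)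
Definition re_mx n (z : 'cV[R[i]]_n) : 'cV[R]_n := map_mx (@complex.Re R) z.
Definition im_mx n (z : 'cV[R[i]]_n) : 'cV[R]_n := map_mx (@complex.Im R) z.
Definition sqnC n (z : 'cV[R[i]]_n) : R := sqn (re_mx z) + sqn (im_mx z).

Lemma sqnC_gt0 n (z : 'cV[R[i]]_n) : z != 0 -> 0 < sqnC z.
Proof.
move=> z0; rewrite lt0r addr_ge0 ?sqn_ge0// andbT.
rewrite paddr_eq0 ?sqn_ge0// !sqn_eq0; apply: contra z0 => /andP[/eqP r0 /eqP i0].
apply/eqP/matrixP => i j; apply/eqP; rewrite mxE eq_complex.
move/matrixP: r0 => /(_ i j); move/matrixP: i0 => /(_ i j).
by rewrite !mxE => -> ->; rewrite eqxx.
Qed.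

Lemma sqnCE n (z : 'cV[R[i]]_n) :
  (map_mx Num.conj z^T *m z) ord0 ord0 = ((sqnC z)%:C)%C.
Proof.
rewrite mxE /sqnC /sqn -big_split /= rmorph_sum /=; apply: eq_bigr => i _.
rewrite !mxE; case: (z i ord0) => a b; apply/eqP; rewrite eq_complex.
by apply/andP; split; apply/eqP => /=; ring.
Qed.

Lemma re_mx_mul m n (A : 'M[R]_(m, n)) (z : 'cV[R[i]]_n) :
  re_mx (map_mx (real_complex R) A *m z) = A *m re_mx z.
Proof.
apply/matrixP => i j; rewrite !mxE.
rewrite (raddf_sum (@complex.Re R : Rcomplex R -> R)); apply: eq_bigr => k _.
by rewrite !mxE; case: (z k j) => a b /=; rewrite mul0r subr0.
Qed.

Lemma im_mx_mul m n (A : 'M[R]_(m, n)) (z : 'cV[R[i]]_n) :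
  im_mx (map_mx (real_complex R) A *m z) = A *m im_mx z.
Proof.
apply/matrixP => i j; rewrite !mxE.
rewrite (raddf_sum (@complex.Im R : Rcomplex R -> R)); apply: eq_bigr => k _.
by rewrite !mxE; case: (z k j) => a b /=; rewrite mul0r addr0.
Qed.

Lemma sqnC_real_mul m n (A : 'M[R]_(m, n)) (z : 'cV[R[i]]_n) :
  sqnC (map_mx (real_complex R) A *m z) = sqn (A *m re_mx z) + sqn (A *m im_mx z).
Proof. by rewrite /sqnC re_mx_mul im_mx_mul. Qed.

Lemma conj_real_mx m n (A : 'M[R]_(m, n)) :
  map_mx Num.conj (map_mx (real_complex R) A) = map_mx (real_complex R) A.
Proof. by apply/matrixP => i j; rewrite !mxE; exact: conjc_real. Qed.

Section Count.
Variables (n : nat) (A : 'M[R]_n).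
Let M := map_mx (real_complex R) (A^T *m A).
Let S := spectralmx M.
Let lam i := complex.Re (spectral_diag M ord0 i).

Let Sinv : map_mx Num.conj S^T = invmx S.
Proof. by rewrite invmx_unitary // spectral_unitarymx. Qed.

Let Sunit : S \in unitmx.
Proof. exact: spectral_unit. Qed.

Lemma sqnC_spectral (z : 'cV_n) : sqnC (S *m z) = sqnC z.
Proof.
apply: (@complexI R); rewrite -!sqnCE trmx_mul map_mxM Sinv /=.
by rewrite !mulmxA mulmxKV // -Sinv unitarymx_unit // trmxC_unitary spectral_unitarymx.
Qed.

Lemma sqnC_mul_spectral (z : 'cV_n) :
  sqnC (map_mx (real_complex R) A *m z) =
  \sum_i lam i * (complex.Re ((S *m z) i ord0) ^+ 2 + complex.Im ((S *m z) i ord0) ^+ 2).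
Proof.
have [ME D0] := spectral_diag_gram A; rewrite -/M -/S in ME D0.
apply: (@complexI R); rewrite -sqnCE trmx_mul map_mxM /=.
have -> : map_mx Num.conj (map_mx (real_complex R) A)^T = (map_mx (real_complex R) A)^T.
  by rewrite -map_trmx conj_real_mx.
rewrite mulmxA -(mulmxA (map_mx Num.conj z^T)).
have -> : (map_mx (real_complex R) A)^T *m map_mx (real_complex R) A = M.
  by rewrite /M map_mxM map_trmx.
rewrite ME -Sinv !mulmxA -map_mxM -trmx_mul -mulmxA.
rewrite mul_mx_diag mxE rmorph_sum /=; apply: eq_bigr => i _.
rewrite !mxE /lam; set y := \sum_j _.
have := D0 i; rewrite lecE /=; case: (spectral_diag M ord0 i) => a b /= /andP[/eqP -> _].
case: y => u v; apply/eqP; rewrite eq_complex /=.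
by apply/andP; split; apply/eqP; ring.
Qed.

Lemma lam_ge0 i : 0 <= lam i.
Proof.
have [_ /(_ i)] := spectral_diag_gram A; rewrite -/M lecE /lam /=.
by case/andP.
Qed.

Lemma K_specE (g : R) : 0 < g ->
  K_spec g A = #|[pred i : 'I_n | g ^+ 2 <= lam i]|.
Proof.
move=> g0; rewrite /K_spec cardsE.
have -> : #|[pred i : 'I_n | g <= singular_value A i]| =
    count (fun x => g <= x) (singular_values A).
  rewrite -sum1_count (big_nth 0) big_mkord size_singular_values sum1_card.
  by apply: eq_card => i; rewrite !inE.
rewrite /singular_values (permP (permEl (perm_sort _ _))) count_map -sum1_count.
rewrite -sum1_card big_enum_cond /=; apply: eq_bigl => i; rewrite !inE /=.
rewrite -/(lam i) -[X in X <= Num.sqrt _](ger0_norm (ltW g0)) -sqrtr_sqr.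
by rewrite ler_sqrt ?lam_ge0.
Qed.

End Count.

Lemma exists_ker_mx (F : fieldType) (m k : nat) (B : 'M[F]_(m, k)) :
  (\rank B < k)%N -> exists2 y : 'cV[F]_k, y != 0 & B *m y = 0.
Proof.
move=> rB; have : kermx B^T != 0.
  by rewrite -mxrank_eq0 mxrank_ker mxrank_tr subn_eq0 -ltnNge.
move=> /rowV0Pn[v /sub_kermxP vB v0]; exists v^T.
  by rewrite -trmx_eq0 trmxK.
by apply: trmx_inj; rewrite trmx_mul trmxK vB trmx0.
Qed.

Lemma re_mx_eq0 n (z : 'cV[R[i]]_n) : z = 0 -> re_mx z = 0 /\ im_mx z = 0.
Proof. by move=> ->; split; apply/matrixP => i j; rewrite !mxE. Qed.

(** Half of the Courant-Fischer principle, by a dimension count: if more than [\rank D] eigenvalues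
    of A^T A were at least g^2, the span of their eigenvectors would contain a nonzero vector killed
    by D, yet A stretches that span by at least g. *)
Lemma K_spec_le n (A D : 'M[R]_n) (g : R) : 0 < g ->
  (forall x : 'cV[R]_n, D *m x = 0 -> x != 0 -> sqn (A *m x) < g ^+ 2 * sqn x) ->
  (K_spec g A <= \rank D)%N.
Proof.
move=> g0 AD; rewrite (K_specE _ g0).
set I := [pred i | _]; rewrite leqNgt; apply/negP => rI.
set S := spectralmx (map_mx (real_complex R) (A^T *m A)).
have Su : S \in unitmx by exact: spectral_unit.
pose Dc := map_mx (real_complex R) D.
pose G : 'M[R[i]]_(n, #|I|) := colsub (fun i => enum_val i) 1%:M.
have rG : (\rank (Dc *m (invmx S *m G)) < #|I|)%N.
  by apply: leq_ltn_trans (mxrankM_maxl _ _) _; rewrite mxrank_map.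
have [y y0 DGy] := exists_ker_mx rG.
pose z := invmx S *m (G *m y).
have Sz : S *m z = G *m y by rewrite /z mulKVmx.
have z0 : z != 0.
  apply: contra y0 => /eqP z0; rewrite z0 mulmx0 in Sz.
  apply/eqP/matrixP => k l; rewrite ord1.
  move/matrixP: Sz => /(_ (enum_val k) ord0); rewrite !mxE.
  rewrite (bigD1 k) //= big1 => [|j jk]; last first.
    by rewrite !mxE (inj_eq enum_val_inj) eq_sym (negbTE jk) mul0r.
  by rewrite !mxE eqxx mul1r addr0 => <-.
have {}AD : sqnC (map_mx (real_complex R) A *m z) < g ^+ 2 * sqnC z.
  have Dz : Dc *m z = 0 by rewrite /z -DGy !mulmxA.
  have [Dr Di] := re_mx_eq0 Dz; rewrite re_mx_mul in Dr; rewrite im_mx_mul in Di.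
  have le x : D *m x = 0 -> sqn (A *m x) <= g ^+ 2 * sqn x.
    move=> Dx; have [->|x0] := eqVneq x 0; last exact/ltW/AD.
    by rewrite mulmx0 sqn0 mulr0.
  rewrite sqnC_real_mul /sqnC mulrDr.
  (* Strictness survives the splitting, since the real or the imaginary part of z is nonzero. *)
  have [r0|r0] := eqVneq (re_mx z) 0; last by rewrite ltr_leD ?AD ?le.
  have i0 : im_mx z != 0.
    apply: contraTneq (sqnC_gt0 z0) => i0.
    by rewrite /sqnC r0 i0 sqn0 addr0 ltxx.
  by rewrite ler_ltD ?AD ?le.
move: AD; rewrite ltNge => /negP; apply.
rewrite sqnC_mul_spectral -(sqnC_spectral A) -/S Sz /sqnC /sqn -big_split mulr_sumr /=.
apply: ler_sum => i _; rewrite ![(map_mx _ _) i _]mxE.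
have [iI|iI] := boolP (i \in I).
  by rewrite ler_wpM2r ?addr_ge0 ?sqr_ge0//; move: iI; rewrite inE.
suff -> : (G *m y) i ord0 = 0 by rewrite /= expr0n addr0 !mulr0.
rewrite mxE big1 // => k _; rewrite !mxE; case: eqP => [ik|]; last by rewrite mul0r.
by rewrite ik enum_valP in iI.
Qed.

(** The other half: with fewer than r eigenvalues at least g^2, the r-dimensional image of F
    contains a nonzero vector orthogonal to their eigenvectors, which A stretches by strictly less
    than g. A subspace given by a real matrix F is complexified by mapping F. *)
Lemma K_spec_ge n r (A : 'M[R]_n) (F : 'M[R]_(n, r)) (g : R) : 0 < g ->
  (forall s : 'cV[R]_r, s != 0 -> F *m s != 0) ->
  (forall s : 'cV[R]_r, g ^+ 2 * sqn (F *m s) <= sqn (A *m (F *m s))) ->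
  (r <= K_spec g A)%N.
Proof.
move=> g0 Finj AF; rewrite (K_specE _ g0).
set I := [pred i | _]; rewrite leqNgt; apply/negP => rI.
set S := spectralmx (map_mx (real_complex R) (A^T *m A)).
have Su : S \in unitmx by exact: spectral_unit.
pose Fc := map_mx (real_complex R) F.
pose G : 'M[R[i]]_(#|I|, r) := rowsub (fun i => enum_val i) (S *m Fc).
have rG : (\rank G < r)%N by apply: leq_ltn_trans rI; exact: rank_leq_row.
have [s s0 Gs] := exists_ker_mx rG.
pose z := Fc *m s.
have Sz i : i \in I -> (S *m z) i ord0 = 0.
  move=> iI; move/matrixP: Gs => /(_ (enum_rank_in iI i) ord0).
  rewrite /z mulmxA /G [in RHS]mxE => <-.
  by rewrite ![in RHS]mxE; rewrite [LHS]mxE; apply: eq_bigr => k _; rewrite [in RHS]mxE enum_rankK_in.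
have z0 : z != 0.
  apply: contra s0 => /eqP z0; have [] := re_mx_eq0 z0.
  rewrite /z re_mx_mul im_mx_mul => Fr Fi.
  have [/eqP|r0] := eqVneq (re_mx s) 0; last by have := Finj _ r0; rewrite Fr eqxx.
  have [/eqP|i0] := eqVneq (im_mx s) 0; last by have := Finj _ i0; rewrite Fi eqxx.
  move=> i0 r0; apply: contraTT isT => /sqnC_gt0.
  by rewrite /sqnC; move: i0 r0; rewrite -!sqn_eq0 => /eqP -> /eqP ->; rewrite addr0 ltxx.
have : g ^+ 2 * sqnC z <= sqnC (map_mx (real_complex R) A *m z).
  by rewrite sqnC_real_mul /sqnC mulrDr /z re_mx_mul im_mx_mul lerD.
apply/negP; rewrite -ltNge; set w := S *m z.
have w0 : w != 0.
  by apply: contra z0 => /eqP w0; rewrite -(mulKmx Su z) -/w w0 mulmx0.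
have [i wi0] : exists i, w i ord0 != 0.
  apply/existsP; apply: contraNT w0; rewrite negb_exists => /forallP w0.
  by apply/eqP/matrixP => i j; rewrite ord1 [RHS]mxE; apply/eqP; have := w0 i; rewrite negbK.
have sq_gt0 (c : R[i]) : c != 0 -> 0 < complex.Re c ^+ 2 + complex.Im c ^+ 2.
  case: c => a b; rewrite eq_complex /= => ab0.
  rewrite lt0r addr_ge0 ?sqr_ge0// andbT paddr_eq0 ?sqr_ge0// !sqrf_eq0.
  by move: ab0.
rewrite sqnC_mul_spectral -(sqnC_spectral A) -/S -/w /sqnC /sqn -big_split mulr_sumr /=.
rewrite (bigD1 i) //= [X in _ < X](bigD1 i) //= ltr_leD //.
  rewrite ![(map_mx _ _) _ _]mxE ltr_pM2r; last exact: sq_gt0.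
  rewrite ltNge; apply/negP => iI.
  by move: wi0; rewrite Sz ?eqxx.
apply: ler_sum => k _; rewrite ![(map_mx _ _) _ _]mxE; have [kI|kI] := boolP (k \in I).
  by rewrite Sz //= expr0n addr0 !mulr0.
by rewrite ler_wpM2r ?addr_ge0 ?sqr_ge0// ltW // ltNge.
Qed.

End SingularValueCount.

(** * From integer grid vectors to all vectors *)

Section Grid.
Variable R : realType.

(* Integers are coded by a sign and a magnitude, so that the union bounds can
   range over the finite type [{ffun _ -> bool * 'I_m}]. *)
Definition sgnat (a : bool * nat) : R := (-1) ^+ a.1 * a.2%:R.

Lemma normr_sgnat a : `|sgnat a| = a.2%:R.
Proof. by rewrite /sgnat normrM normrX normrN1 expr1n mul1r normr_nat. Qed.

(** Truncation toward zero rather than to the nearest integer: moduli never grow, so a rounded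
    vector stays in the ball of the original one. *)
Definition toward0 (x : R) : bool * nat := (x < 0, Num.truncn `|x|).

Lemma toward0_le x : (toward0 x).2%:R <= `|x|.
Proof. by have /andP[] := truncn_itv (normr_ge0 x). Qed.

Lemma sub_toward0 x : `|x - sgnat (toward0 x)| <= 1.
Proof.
have /andP[] := truncn_itv (normr_ge0 x); rewrite /sgnat /=.
set k := Num.truncn _; rewrite -natr1 => k1 k2.
case: (ltP x 0) k1 k2 => x0; rewrite ?expr1 ?expr0.
  by rewrite ltr0_norm // => k1 k2; rewrite ler_norml; lra.
by rewrite ger0_norm // => k1 k2; rewrite ler_norml; lra.
Qed.

Variable n : nat.
Implicit Types x y : 'I_n -> R.
Variable E : 'I_n -> 'I_n -> R.

Let beta x y := \sum_u \sum_v x u * y v * E u v.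

Let betaDl x x' y : beta (fun u => x u + x' u) y = beta x y + beta x' y.
Proof.
rewrite /beta -big_split; apply: eq_bigr => u _; rewrite -big_split.
by apply: eq_bigr => v _; rewrite !mulrDl.
Qed.

Let betaDr x y y' : beta x (fun u => y u + y' u) = beta x y + beta x y'.
Proof.
rewrite /beta -big_split; apply: eq_bigr => u _; rewrite -big_split.
by apply: eq_bigr => v _; rewrite mulrDr mulrDl.
Qed.

Let betaZl a x y : beta (fun u => a * x u) y = a * beta x y.
Proof.
rewrite /beta mulr_sumr; apply: eq_bigr => u _; rewrite mulr_sumr.
by apply: eq_bigr => v _; rewrite !mulrA.
Qed.

Let betaZr a x y : beta x (fun u => a * y u) = a * beta x y.
Proof.
rewrite /beta mulr_sumr; apply: eq_bigr => u _; rewrite mulr_sumr.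
by apply: eq_bigr => v _; rewrite !mulrA; congr (_ * _); rewrite (mulrC a) .
Qed.

Variable B : R.
Hypothesis gridB : forall a c : 'I_n -> bool * nat,
  \sum_u (a u).2%:R ^+ 2 <= 16 * n%:R :> R -> \sum_u (c u).2%:R ^+ 2 <= 16 * n%:R :> R ->
  \sum_u \sum_v sgnat (a u) * sgnat (c v) * E u v <= n%:R * B.

Lemma gridB_ge0 : (0 < n)%N -> 0 <= B.
Proof.
move=> n0; have := @gridB (fun=> (false, 0%N)) (fun=> (false, 0%N)).
have -> : \sum_(u < n) (0%:R : R) ^+ 2 = 0 by rewrite big1// => i _; rewrite expr0n.
have h : (0 : R) <= 16 * n%:R by rewrite mulr_ge0.
move=> /(_ h h); rewrite big1 => [|u _]; last first.
  by rewrite big1// => v _; rewrite /sgnat mulr0 !mul0r.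
by rewrite pmulr_rge0 // ltr0n.
Qed.

(** The mesh is 1/q: n coordinates with error at most 1/q give a rounding error of norm at most sqrt
    n / q = 1/4. The radius 16 n is q^2. *)
Let q : R := 4 * Num.sqrt n%:R.
Let app x u := q^-1 * sgnat (toward0 (q * x u)).

Lemma grid_approx x : (0 < n)%N -> \sum_u x u ^+ 2 <= 1 ->
  [/\ \sum_u (toward0 (q * x u)).2%:R ^+ 2 <= 16 * n%:R :> R,
      \sum_u app x u ^+ 2 <= 1 &
      \sum_u (4 * (x u - app x u)) ^+ 2 <= 1].
Proof.
move=> n0 x1; have nR : 0 < n%:R :> R by rewrite ltr0n.
have q0 : 0 < q by rewrite mulr_gt0 ?sqrtr_gt0.
have q2 : q ^+ 2 = 16 * n%:R by rewrite exprMn sqr_sqrtr ?ltW//; ring.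
have H : \sum_u (toward0 (q * x u)).2%:R ^+ 2 <= 16 * n%:R :> R.
  apply: (@le_trans _ _ (\sum_u (q ^+ 2 * x u ^+ 2))).
    apply: ler_sum => u _; rewrite -exprMn -(real_normK (num_real (q * x u))).
    by rewrite lerXn2r ?nnegrE ?toward0_le.
  by rewrite -mulr_sumr q2 ler_piMr// mulr_ge0.
split => //.
  apply: (@le_trans _ _ (\sum_u (q^-1 ^+ 2 * (toward0 (q * x u)).2%:R ^+ 2))).
    by apply: ler_sum => u _; rewrite /app exprMn -(real_normK (num_real (sgnat _))) normr_sgnat.
  by rewrite -mulr_sumr exprVn q2 mulrC ler_pdivrMr ?mulr_gt0// mul1r.
apply: (@le_trans _ _ (\sum_(u < n) (n%:R)^-1)); last first.
  by rewrite sumr_const card_ord -[leLHS]mulr_natl divff // gt_eqF.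
apply: ler_sum => u _.
have -> : 4 * (x u - app x u) = (4 / q) * (q * x u - sgnat (toward0 (q * x u))).
  by rewrite /app; field; rewrite gt_eqF.
rewrite exprMn -[leRHS]mulr1 ler_pM ?sqr_ge0//.
  by rewrite expr_div_n q2 le_eqVlt; apply/orP; left; apply/eqP; field; rewrite gt_eqF.
by rewrite -(real_normK (num_real _)) expr_le1// sub_toward0.
Qed.

(** If m is the supremum of the form over unit vectors, rounding both arguments gives m <= B/16 +
    m/4 + m/4, hence m <= B/8. Iterating from the trivial bound by the sum of all moduli avoids the
    supremum: each round halves the excess, and 1/(k+1) is a weaker rate that is easy to carry. *)
Lemma grid_bilinear_iter (k : nat) x y : (0 < n)%N ->
  \sum_u x u ^+ 2 <= 1 -> \sum_u y u ^+ 2 <= 1 ->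
  beta x y <= B / 8 + (\sum_u \sum_v `|E u v|) / k.+1%:R.
Proof.
move=> n0; have nR : 0 < n%:R :> R by rewrite ltr0n.
have q0 : 0 < q by rewrite mulr_gt0 ?sqrtr_gt0.
have q2 : q ^+ 2 = 16 * n%:R by rewrite exprMn sqr_sqrtr ?ltW//; ring.
have B0 := gridB_ge0 n0; set L := \sum_u _.
have L0 : 0 <= L by apply: sumr_ge0 => u _; apply: sumr_ge0.
elim: k x y => [|k IH] x y x1 y1.
  rewrite divr1; apply: (@le_trans _ _ L); last by rewrite lerDr divr_ge0.
  have le1 (z : 'I_n -> R) : \sum_u z u ^+ 2 <= 1 -> forall u, `|z u| <= 1.
    move=> z1 u; rewrite -(@expr_le1 _ 2)// real_normK ?num_real//.
    apply: le_trans z1; rewrite [leRHS](bigD1 u)//= lerDl.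
    by apply: sumr_ge0 => i _; exact: sqr_ge0.
  apply: ler_sum => u _; apply: ler_sum => v _; apply: le_trans (ler_norm _) _.
  by rewrite 2!normrM ler_piMl// mulr_ile1 ?le1.
have [xz xa xe] := grid_approx n0 x1; have [yz ya ye] := grid_approx n0 y1.
have -> : beta x y = beta (app x) (app y) + 4^-1 * beta (fun u => 4 * (x u - app x u)) y
    + 4^-1 * beta (app x) (fun u => 4 * (y u - app y u)).
  rewrite betaZl betaZr !mulrA mulVf ?pnatr_eq0// !mul1r.
  have -> : beta x y = beta (app x) y + beta (fun u => x u - app x u) y.
    by rewrite -betaDl; apply: eq_bigr => u _; apply: eq_bigr => v _; congr (_ * _ * _); lra.
  have -> : beta (app x) y = beta (app x) (app y) + beta (app x) (fun u => y u - app y u).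
    by rewrite -betaDr; apply: eq_bigr => u _; apply: eq_bigr => v _; congr (_ * _ * _); lra.
  by rewrite [LHS]addrAC.
have h1 := IH _ _ xe y1; have h2 := IH _ _ xa ye.
have h0 : beta (app x) (app y) <= B / 16.
  rewrite /app betaZl betaZr mulrA -invfM -expr2 q2 mulrC ler_pdivrMr ?mulr_gt0//.
  have -> : B / 16 * (16 * n%:R) = n%:R * B by field.
  exact: gridB.
have h3 : L / k.+1%:R / 2 <= L / k.+2%:R.
  rewrite -mulrA ler_wpM2l // -invfM lef_pV2 ?posrE ?mulr_gt0 ?ltr0n//.
  by rewrite -natrM ler_nat muln2 doubleS !ltnS -addnn leq_addr.
move: h0 h1 h2 h3; clear; set L1 := L / _; set L2 := L / _.
move: (beta _ _) (beta _ _) (beta _ _) => b1 b2 b3.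
lra.
Qed.

Lemma grid_bilinear x y : (0 < n)%N ->
  \sum_u x u ^+ 2 <= 1 -> \sum_u y u ^+ 2 <= 1 -> beta x y <= B / 8.
Proof.
move=> n0 x1 y1; rewrite leNgt; apply/negP => lt.
have L0 : 0 <= \sum_u \sum_v `|E u v| by apply: sumr_ge0 => u _; apply: sumr_ge0.
pose k := Num.truncn ((\sum_u \sum_v `|E u v|) / (beta x y - B / 8)).
have := grid_bilinear_iter k n0 x1 y1.
have e0 : 0 < beta x y - B / 8 by rewrite subr_gt0.
have /andP[_] := truncn_itv (divr_ge0 L0 (ltW e0)); rewrite -/k.
rewrite ltr_pdivrMr// => h; apply/negP; rewrite -ltNge -ltrBrDl.
by rewrite ltr_pdivrMr ?ltr0n// mulrC.
Qed.

End Grid.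

Lemma grid_sqn_mul (R : realType) n (E : 'M[R]_n) (B : R) : (0 < n)%N ->
  (forall a c : 'I_n -> bool * nat,
    \sum_u (a u).2%:R ^+ 2 <= 16 * n%:R :> R -> \sum_u (c u).2%:R ^+ 2 <= 16 * n%:R :> R ->
    \sum_u \sum_v sgnat R (a u) * sgnat R (c v) * E u v <= n%:R * B) ->
  forall x : 'cV[R]_n, sqn (E *m x) <= (B / 8) ^+ 2 * sqn x.
Proof.
move=> n0 gB x; set y := E *m x.
have B0 := gridB_ge0 gB n0.
have [x0|x0] := eqVneq x 0; first by rewrite /y x0 mulmx0 sqn0 mulr0.
have [y0|y0] := eqVneq y 0; first by rewrite y0 sqn0 mulr_ge0 ?sqr_ge0 ?sqn_ge0.
have sx : 0 < sqn x by rewrite lt0r sqn_eq0 x0 sqn_ge0.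
have sy : 0 < sqn y by rewrite lt0r sqn_eq0 y0 sqn_ge0.
pose nx := Num.sqrt (sqn x); pose ny := Num.sqrt (sqn y).
have nx0 : 0 < nx by rewrite sqrtr_gt0.
have ny0 : 0 < ny by rewrite sqrtr_gt0.
have nx2 : nx ^+ 2 = sqn x by rewrite sqr_sqrtr ?ltW.
have ny2 : ny ^+ 2 = sqn y by rewrite sqr_sqrtr ?ltW.
have := @grid_bilinear R n E B gB (fun u => ny^-1 * y u ord0) (fun u => nx^-1 * x u ord0) n0.
have -> : \sum_u (ny^-1 * y u ord0) ^+ 2 = 1.
  under eq_bigr do rewrite exprMn; rewrite -mulr_sumr exprVn ny2 mulVf// gt_eqF//.
have -> : \sum_u (nx^-1 * x u ord0) ^+ 2 = 1.
  under eq_bigr do rewrite exprMn; rewrite -mulr_sumr exprVn nx2 mulVf// gt_eqF//.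
move=> /(_ (lexx _) (lexx _)).
have -> : \sum_u \sum_v ny^-1 * y u ord0 * (nx^-1 * x v ord0) * E u v = ny / nx.
  transitivity (ny^-1 * nx^-1 * sqn y); last first.
    by rewrite -ny2; field; rewrite !gt_eqF.
  rewrite /sqn mulr_sumr; apply: eq_bigr => u _.
  have yE : y u ord0 = \sum_v E u v * x v ord0 by rewrite /y mxE.
  rewrite expr2 [X in _ * (_ * X)]yE !mulr_sumr; apply: eq_bigr => v _.
  by ring.
rewrite ler_pdivrMr// => h; rewrite -nx2 -ny2 -exprMn.
rewrite lerXn2r ?nnegrE //; first exact: ltW.
by apply: mulr_ge0; [exact: divr_ge0|exact: ltW].
Qed.

(** * Exponential moments along a block Markov chain *)

Section PathExpectation.
Variables (R : realType) (S : finType).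

Definition scons (x : S) (s : nat -> S) (t : nat) : S := if t is t'.+1 then s t' else x.

(* A path of l steps is a total function [nat -> S], constant after time l. *)
Fixpoint pathE (Q : S -> S -> R) (l : nat) (x : S) (F : (nat -> S) -> R) : R :=
  if l is l'.+1 then \sum_y Q x y * pathE Q l' y (fun s => F (scons x s))
  else F (fun=> x).

Definition chainE (mu : S -> R) Q l F := \sum_x mu x * pathE Q l x F.

Definition chainP mu Q l (B : (nat -> S) -> Prop) : R :=
  chainE mu Q l (fun s => (`[< B s >])%:R).

Definition path_sum (F : S -> S -> R) (l : nat) (s : nat -> S) : R :=
  \sum_(t < l) F (s t) (s t.+1).

Lemma path_sumS F l x s : path_sum F l.+1 (scons x s) = F x (s 0%N) + path_sum F l s.
Proof. by rewrite /path_sum big_ord_recl. Qed.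

Variables (mu : S -> R) (Q : S -> S -> R).
Hypothesis Q0 : forall x y, 0 <= Q x y.

Lemma le_pathE l x F G :
  (forall s, s 0%N = x -> F s <= G s) -> pathE Q l x F <= pathE Q l x G.
Proof.
elim: l x F G => [|l IH] x F G FG /=; first exact: FG.
by apply: ler_sum => y _; rewrite ler_wpM2l //; apply: IH => s _; exact: FG.
Qed.

Lemma pathED l x F G :
  pathE Q l x (fun s => F s + G s) = pathE Q l x F + pathE Q l x G.
Proof.
elim: l x F G => [|l IH] x F G //=.
by rewrite -big_split /=; apply: eq_bigr => y _; rewrite -mulrDr -IH.
Qed.

Lemma pathEZ l x a F : pathE Q l x (fun s => a * F s) = a * pathE Q l x F.
Proof.
elim: l x F => [|l IH] x F //=.
by rewrite mulr_sumr; apply: eq_bigr => y _; rewrite (IH y (fun s => F (scons x s))) mulrCA.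
Qed.

(** The exponential of the partial sums is a supermartingale; the induction peels off the first
    step. *)
Lemma path_exp_sum_le1 F :
  (forall x, \sum_y Q x y * expR (F x y) <= 1) ->
  forall l x, pathE Q l x (fun s => expR (path_sum F l s)) <= 1.
Proof.
move=> QF; elim=> [|l IH] x /=; first by rewrite /path_sum big_ord0 expR0.
apply: le_trans (QF x); apply: ler_sum => y _; rewrite ler_wpM2l //.
apply: (@le_trans _ _ (expR (F x y) * pathE Q l y (fun s => expR (path_sum F l s)))).
  rewrite -pathEZ; apply: le_pathE => s sy.
  by rewrite path_sumS sy expRD.
by rewrite ler_piMr ?expR_ge0.
Qed.

Hypothesis mu0 : forall x, 0 <= mu x.

Lemma le_chainE l F G : (forall s, F s <= G s) -> chainE mu Q l F <= chainE mu Q l G.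
Proof.
by move=> FG; apply: ler_sum => x _; rewrite ler_wpM2l //; apply: le_pathE => s _.
Qed.

Lemma chainED l F G :
  chainE mu Q l (fun s => F s + G s) = chainE mu Q l F + chainE mu Q l G.
Proof. by rewrite -big_split; apply: eq_bigr => x _; rewrite pathED mulrDr. Qed.

Lemma chainEZ l a F : chainE mu Q l (fun s => a * F s) = a * chainE mu Q l F.
Proof. by rewrite mulr_sumr; apply: eq_bigr => x _; rewrite pathEZ mulrCA. Qed.

Lemma chainE0 l : chainE mu Q l (fun=> 0) = 0.
Proof.
transitivity (chainE mu Q l (fun=> 0 * 0)); last by rewrite chainEZ mul0r.
by congr chainE; apply/funext => s; rewrite mul0r.
Qed.

Lemma chainE_sum l (I : Type) (r : seq I) F :
  chainE mu Q l (fun s => \sum_(i <- r) F i s) = \sum_(i <- r) chainE mu Q l (F i).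
Proof.
elim: r => [|i r IH].
  by rewrite big_nil -[RHS](chainE0 l); congr chainE; apply/funext => s; rewrite big_nil.
rewrite big_cons -IH -chainED; congr chainE; apply/funext => s.
by rewrite big_cons.
Qed.

Lemma le_chainP l (B C : (nat -> S) -> Prop) :
  (forall s, B s -> C s) -> chainP mu Q l B <= chainP mu Q l C.
Proof.
move=> BC; apply: le_chainE => s; rewrite ler_nat.
by case: asboolP => // Bs; case: asboolP => // /(_ (BC _ Bs)).
Qed.

Lemma chainP_or l (B C : (nat -> S) -> Prop) :
  chainP mu Q l (fun s => B s \/ C s) <= chainP mu Q l B + chainP mu Q l C.
Proof.
rewrite -chainED; apply: le_chainE => s; rewrite -natrD ler_nat.
by case: asboolP => // -[] h; rewrite (asboolT h) ?addn1 ?add1n.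
Qed.

Lemma chainP_exists l (I : finType) (B : I -> (nat -> S) -> Prop) :
  chainP mu Q l (fun s => exists i, B i s) <= \sum_i chainP mu Q l (B i).
Proof.
rewrite -chainE_sum; apply: le_chainE => s; case: asboolP => [[i Bi]|_]; last first.
  by apply: sumr_ge0.
by rewrite (bigD1 i) //= (asboolT Bi) lerDl sumr_ge0.
Qed.

Lemma chainP_chernoff l F a :
  chainE mu Q l (fun s => expR (F s)) <= 1 ->
  chainP mu Q l (fun s => a <= F s) <= expR (- a).
Proof.
move=> F1; apply: (@le_trans _ _ (expR (- a) * chainE mu Q l (fun s => expR (F s)))).
  rewrite -chainEZ; apply: le_chainE => s; rewrite -expRD.
  by case: asboolP => [h|_]; [rewrite -expR0 ler_expR; lra|exact: expR_ge0].
by rewrite ler_piMr ?expR_ge0.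
Qed.

Lemma chain_exp_sum_le1 F l :
  \sum_x mu x = 1 ->
  (forall x, \sum_y Q x y * expR (F x y) <= 1) ->
  chainE mu Q l (fun s => expR (path_sum F l s)) <= 1.
Proof.
move=> mu1 QF; rewrite -mu1; apply: ler_sum => x _.
by rewrite ler_piMr // path_exp_sum_le1.
Qed.

End PathExpectation.

Section BlockPaths.
Variables (R : realType) (S K : finType) (sigma : S -> K).
Variables (p : K -> K -> R) (pi0 : K -> R).
Hypothesis p0 : forall k l, 0 <= p k l.
Hypothesis p1 : forall k, \sum_l p k l = 1.
Hypothesis pi0_ge0 : forall k, 0 <= pi0 k.
Hypothesis pi0_sum : \sum_k pi0 k = 1.

Let bw k : R := #|[pred x | sigma x == k]|%:R.
Let Q x y : R := p (sigma x) (sigma y) / bw (sigma y).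
Let mu x : R := pi0 (sigma x) / bw (sigma x).

Lemma block_Q_ge0 x y : 0 <= Q x y.
Proof. by rewrite divr_ge0. Qed.

Lemma block_mu_ge0 x : 0 <= mu x.
Proof. by rewrite divr_ge0. Qed.

(** The next block is drawn from w, then a state uniformly inside it; w will be a row of p or the
    initial law. An empty block contributes 0 on the left, because 0^-1 = 0, and the sign of b
    covers it. *)
Lemma block_mix_le (w : K -> R) (G : S -> R) (b : K -> R) : (forall k, 0 <= w k) ->
  (forall k, \sum_(y | sigma y == k) G y <= bw k * b k) -> (forall k, 0 <= b k) ->
  \sum_y w (sigma y) / bw (sigma y) * G y <= \sum_k w k * b k.
Proof.
move=> w0 Gb b0; rewrite (partition_big sigma predT) //=.
apply: ler_sum => k _.
rewrite (eq_bigr (fun y => w k / bw k * G y)) => [|y /eqP -> //].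
rewrite -mulr_sumr -mulrA ler_wpM2l //.
apply: (@le_trans _ _ ((bw k)^-1 * (bw k * b k))); first by rewrite ler_wpM2l ?invr_ge0.
have [->|k0] := eqVneq (bw k) 0; first by rewrite mul0r mulr0.
by rewrite mulKf.
Qed.

Lemma block_sum_const (a : R) k : \sum_(y | sigma y == k) a = bw k * a.
Proof. by rewrite sumr_const mulr_natl; congr (_ *+ _); apply: eq_card. Qed.

Let alt (h : S -> S -> R) (b : bool) l (s : nat -> S) :=
  \prod_(t < l) (if odd t == b then h (s t) (s t.+1) else 1).

Let altS h b l x s :
  alt h b l.+1 (scons x s) = (if b then 1 else h x (s 0%N)) * alt h (~~ b) l s.
Proof.
rewrite /alt big_ord_recl /=; congr (_ * _); first by case: b.
by apply: eq_bigr => t _; rewrite /bump /= add1n /=; case: (odd t); case: b.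
Qed.

Section Alternating.
Variable h : S -> S -> R.
Hypothesis h0 : forall x y, 0 <= h x y.
Hypothesis h1 : forall k l,
  \sum_(x | sigma x == k) \sum_(y | sigma y == l) h x y <= bw k * bw l.

(* Given the block sequence, the pairs (X_t, X_{t+1}) over the t of one parity
   are independent and uniform in the product of their two blocks. *)
Lemma alternating_le1 l :
  (forall x, pathE Q l x (alt h true l) <= 1) /\
  (forall k, \sum_(x | sigma x == k) pathE Q l x (alt h false l) <= bw k).
Proof.
elim: l => [|l [IH1 IH2]]; split => [x|k] /=; rewrite /=.
- by rewrite /alt big_ord0.
- rewrite (eq_bigr (fun=> 1)) => [|x _]; last by rewrite /alt big_ord0.
  by rewrite block_sum_const mulr1.
- rewrite -[leRHS](p1 (sigma x)) (eq_bigr (fun y => Q x y * pathE Q l y (alt h false l))).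
    apply: le_trans (@block_mix_le _ _ (fun=> 1) _ _ _) _ => //.
      by move=> k; rewrite mulr1; exact: IH2.
    by apply: ler_sum => k _; rewrite mulr1.
  move=> y _; congr (_ * _); congr pathE; apply/funext => s.
  by rewrite altS mul1r.
apply: (@le_trans _ _ (\sum_(x | sigma x == k) \sum_y Q x y * h x y)).
  apply: ler_sum => x _; apply: ler_sum => y _; rewrite ler_wpM2l ?block_Q_ge0//.
  apply: (@le_trans _ _ (h x y * pathE Q l y (alt h true l))); last by rewrite ler_piMr.
  rewrite -pathEZ; apply: le_pathE => [|s sy]; first exact: block_Q_ge0.
  by rewrite altS sy.
(* Here h weights the very first step, and h is controlled only on average over both end blocks.
   This is why the second half of the induction sums over the start: the kernel depends on x only
   through its block, so the sum over x reaches h. *)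
rewrite exchange_big /=.
have -> : bw k = \sum_l' p k l' * bw k by rewrite -mulr_suml p1 mul1r.
rewrite (eq_bigr (fun y => p k (sigma y) / bw (sigma y) * \sum_(x | sigma x == k) h x y)).
  apply: block_mix_le => // l'; rewrite exchange_big /= mulrC.
  exact: h1.
by move=> y _; rewrite mulr_sumr; apply: eq_bigr => x /eqP <-.
Qed.

Lemma chain_alternating_le1 b l : chainE mu Q l (alt h b l) <= 1.
Proof.
have [H1 H2] := alternating_le1 l.
rewrite -pi0_sum (eq_bigr (fun k => pi0 k * 1)) => [|k _]; last by rewrite mulr1.
apply: block_mix_le => // k; rewrite mulr1; case: b; last exact: H2.
rewrite -[leRHS]mulr1 -block_sum_const; apply: ler_sum => x _; exact: H1.
Qed.

End Alternating.

Lemma chain_exp_half_sum_le1 (F : S -> S -> R) l :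
  (forall k m, \sum_(x | sigma x == k) \sum_(y | sigma y == m) expR (F x y) <= bw k * bw m) ->
  chainE mu Q l (fun s => expR (2^-1 * path_sum F l s)) <= 1.
Proof.
move=> F1; pose h x y := expR (F x y).
have hE b : chainE mu Q l (alt h b l) <= 1.
  by apply: chain_alternating_le1 => // x y; exact: expR_ge0.
apply: (@le_trans _ _ (chainE mu Q l (fun s => 2^-1 * (alt h true l s + alt h false l s)))).
  apply: le_chainE; [exact: block_Q_ge0|exact: block_mu_ge0|move=> s].
  have altE b : alt h b l s = expR (\sum_(t < l | odd t == b) F (s t) (s t.+1)).
    by rewrite expR_sum big_mkcond.
  have -> : path_sum F l s = \sum_(t < l | odd t == true) F (s t) (s t.+1) +
     \sum_(t < l | odd t == false) F (s t) (s t.+1).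
    rewrite /path_sum (bigID (fun t : 'I_l => odd t)) /=; congr (_ + _); apply: eq_bigl => t.
      by rewrite eqb_id.
    by rewrite eqbF_neg.
  rewrite !altE; set a := \sum_(t < l | _) _; set c := \sum_(t < l | _) _.
  have -> : expR a = expR (2^-1 * a) ^+ 2 by rewrite -expRM_natl; congr expR; lra.
  have -> : expR c = expR (2^-1 * c) ^+ 2 by rewrite -expRM_natl; congr expR; lra.
  rewrite mulrDr expRD; set u := expR _; set v := expR _.
  by have := sqr_ge0 (u - v); rewrite sqrrB; lra.
rewrite chainEZ chainED; have := hE true; have := hE false; lra.
Qed.

End BlockPaths.

(** * Elementary exponential bounds and weighted union bounds *)

Section ExpBounds.
Variable R : realType.

(** From exp (-u) >= 1 - u: the product (1 + u + 2 u^2) (1 - u) = 1 + u^2 (1 - 2 u) is at least 1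
    when u <= 1/2. *)
Lemma expR_le_quad (u : R) : u <= 2^-1 -> expR u <= 1 + u + 2 * u ^+ 2.
Proof.
move=> u2; have h := expR_ge1Dx (- u); have u1 : 0 < 1 - u by lra.
apply: (@le_trans _ _ (1 - u)^-1).
  by rewrite -[u in expR u]opprK expRN lef_pV2 ?posrE ?expR_gt0.
rewrite -div1r ler_pdivrMr //.
have := sqr_ge0 u; set v := u ^+ 2 => v0.
have -> : (1 + u + 2 * v) * (1 - u) = 1 + v * (1 - 2 * u) by rewrite /v; ring.
by rewrite lerDl mulr_ge0 //; lra.
Qed.

Lemma expR_half_nat (m : nat) : expR (m%:R / 2) <= 2 ^+ m :> R.
Proof.
rewrite expRM_natl lerXn2r ?nnegrE ?expR_ge0//.
by have := @expR_le_quad (2^-1) (lexx _); lra.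
Qed.

Lemma expR1_le4 : expR 1 <= 4 :> R.
Proof. by have := expR_half_nat 2; rewrite divff ?pnatr_eq0// -natrX. Qed.

Lemma expRN1_le : expR (- 1) <= 2^-1 :> R.
Proof.
rewrite expRN lef_pV2 ?posrE ?expR_gt0//.
by have := expR_ge1Dx (1 : R); lra.
Qed.

Lemma expRN_nat_le (m : nat) : expR (- m%:R) <= 2^-1 ^+ m :> R.
Proof.
have -> : - m%:R = m%:R * -1 :> R by rewrite mulrN1.
by rewrite expRM_natl lerXn2r ?nnegrE ?expR_ge0// expRN1_le.
Qed.

Lemma sum_half_pow (m : nat) : \sum_(k < m) (2^-1 : R) ^+ k <= 2.
Proof.
suff : \sum_(k < m) (2^-1 : R) ^+ k = 2 - 2 * 2^-1 ^+ m.
  by move=> ->; rewrite lerBlDr lerDl mulr_ge0// exprn_ge0.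
elim: m => [|m IH]; first by rewrite big_ord0 expr0; lra.
by rewrite big_ord_recr /= IH exprS; lra.
Qed.

Lemma sum_expRN_ffun (I J : finType) (w : J -> R) :
  \sum_(a : {ffun I -> J}) expR (- \sum_u w (a u)) = (\sum_j expR (- w j)) ^+ #|I|.
Proof.
rewrite -prodr_const bigA_distr_bigA /=; apply: eq_bigr => a _.
by rewrite -sumrN expR_sum.
Qed.

(** A Kraft inequality: charging each code its own cost replaces counting grid points in the union
    bound. In each coordinate the 2 gives a factor exp (-2) <= 1/4, which absorbs the two signs and
    a geometric series of sum at most 2. *)
Lemma sum_expRN_code (I : finType) (m : nat) :
  \sum_(a : {ffun I -> bool * 'I_m}) expR (- \sum_u ((a u).2%:R + 2)) <= 1 :> R.
Proof.
rewrite (sum_expRN_ffun I (fun j : bool * 'I_m => j.2%:R + 2)).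
apply: exprn_ile1; first by apply: sumr_ge0 => j _; exact: expR_ge0.
rewrite -(pair_bigA _ (fun (b : bool) (k : 'I_m) => expR (- (k%:R + 2)))) /=.
rewrite big_bool /=; set s := \sum_k _.
suff : s <= 2^-1 by lra.
apply: (@le_trans _ _ (\sum_(k < m) 4^-1 * 2^-1 ^+ k)); last first.
  by rewrite -mulr_sumr; have := sum_half_pow m; lra.
apply: ler_sum => k _; rewrite opprD expRD mulrC ler_pM ?expR_ge0 ?expRN_nat_le//.
by have := expRN_nat_le 2; rewrite expr2; lra.
Qed.

(** Without the term in e, the sum over all subsets is (1 + exp (-kap))^|I| <= exp (|I| exp (-kap)),
    which that term cancels. So an element costs kap instead of a logarithm of |I|, at a fixed price
    |I| e that may decay like 2^-kap. *)
Lemma sum_expRN_set (I : finType) (kap : nat) (e : R) : (2^-1) ^+ kap <= e ->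
  \sum_(a : {ffun I -> bool}) expR (- (kap%:R * (\sum_u (a u)%:R) + #|I|%:R * e)) <= 1 :> R.
Proof.
move=> he.
have -> : \sum_(a : {ffun I -> bool}) expR (- (kap%:R * (\sum_u (a u)%:R) + #|I|%:R * e)) =
  expR (- (#|I|%:R * e)) * (\sum_(b : bool) expR (- (kap%:R * b%:R) : R)) ^+ #|I|.
  rewrite -(sum_expRN_ffun I (fun b : bool => kap%:R * b%:R : R)) mulr_sumr.
  by apply: eq_bigr => a _; rewrite opprD expRD mulrC mulr_sumr.
rewrite big_bool /= mulr1 mulr0 oppr0 expR0.
rewrite expRN mulrC ler_pdivrMr ?expR_gt0// mul1r expRM_natl.
rewrite lerXn2r ?nnegrE ?addr_ge0 ?expR_ge0//.
apply: le_trans (expR_ge1Dx _); rewrite addrC lerD2l.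
exact: le_trans (expRN_nat_le _) he.
Qed.

End ExpBounds.

(** * Concentration inequalities *)

Section BlockConcentration.
Variables (R : realType) (S K : finType) (sigma : S -> K).
Variables (p : K -> K -> R) (pi0 : K -> R).
Hypothesis p0 : forall k l, 0 <= p k l.
Hypothesis p1 : forall k, \sum_l p k l = 1.
Hypothesis pi0_ge0 : forall k, 0 <= pi0 k.
Hypothesis pi0_sum : \sum_k pi0 k = 1.

Definition block_size k : R := #|[pred x | sigma x == k]|%:R.

Definition block_avg (f : S -> S -> R) k m : R :=
  (\sum_(x | sigma x == k) \sum_(y | sigma y == m) f x y) / (block_size k * block_size m).

Variable c : R.
Hypothesis c0 : 0 < c.
Hypothesis S0 : (0 < #|S|)%N.
Hypothesis block_size_ge : forall k, c * #|S|%:R <= block_size k.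

Let n : R := #|S|%:R.
Let n0 : 0 < n. Proof. by rewrite ltr0n. Qed.

Lemma block_size_gt0 k : 0 < block_size k.
Proof. by apply: lt_le_trans (block_size_ge k); rewrite mulr_gt0. Qed.

Lemma block_size2_ge k m : (c * n) ^+ 2 <= block_size k * block_size m.
Proof. by rewrite expr2 ler_pM ?mulr_ge0 ?block_size_ge// ltW. Qed.

Definition block_kernel x y : R := p (sigma x) (sigma y) / block_size (sigma y).
Definition block_law x : R := pi0 (sigma x) / block_size (sigma x).

Lemma block_kernel_ge0 x y : 0 <= block_kernel x y.
Proof. exact: block_Q_ge0. Qed.

Lemma block_law_ge0 x : 0 <= block_law x.
Proof. exact: block_mu_ge0. Qed.

Lemma p_le1 k m : p k m <= 1.
Proof. by rewrite -(p1 k) (bigD1 m) //= lerDl sumr_ge0. Qed.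

Lemma block_law_sum : \sum_x block_law x = 1.
Proof.
rewrite -pi0_sum (partition_big sigma predT) //=; apply: eq_bigr => k _.
rewrite (eq_bigr (fun=> pi0 k / block_size k)) => [|x /eqP <- //].
by rewrite sumr_const -mulr_natr divfK // gt_eqF ?block_size_gt0.
Qed.

Lemma block_kernel_mix (x : S) (G : K -> R) : \sum_y block_kernel x y * G (sigma y) = \sum_m p (sigma x) m * G m.
Proof.
rewrite (partition_big sigma predT) //=; apply: eq_bigr => m _.
rewrite (eq_bigr (fun=> p (sigma x) m / block_size m * G m)); last first.
  by move=> y /eqP <-.
rewrite sumr_const -mulr_natr mulrAC; congr (_ * _).
by rewrite divfK // gt_eqF ?block_size_gt0.
Qed.

Lemma block_kernel_sum x : \sum_y block_kernel x y = 1.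
Proof.
have := block_kernel_mix x (fun=> 1); under eq_bigr do rewrite mulr1.
by move=> ->; under eq_bigr do rewrite mulr1.
Qed.

Lemma block_kernel_le x y : block_kernel x y <= (c * n)^-1.
Proof.
rewrite ler_pdivrMr ?block_size_gt0// mulrC ler_pdivlMr ?mulr_gt0//.
apply: le_trans (block_size_ge _); rewrite ler_piMl ?p_le1//.
by rewrite mulr_ge0 // ltW.
Qed.

Lemma sum_block_const (a : R) k m :
  \sum_(x | sigma x == k) \sum_(y | sigma y == m) a = block_size k * block_size m * a.
Proof.
rewrite !sumr_const -mulrnA -mulr_natl natrM /block_size; congr (_ * _).
by rewrite mulrC; congr (_%:R * _%:R); apply: eq_card.
Qed.

Lemma sum_block_le (h : S -> S -> R) k m : (forall x y, 0 <= h x y) ->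
  \sum_(x | sigma x == k) \sum_(y | sigma y == m) h x y <= \sum_x \sum_y h x y.
Proof.
move=> h0; rewrite [leRHS](bigID (fun x => sigma x == k)) /=.
apply: (@le_trans _ _ (\sum_(x | sigma x == k) \sum_y h x y)).
  apply: ler_sum => x _; rewrite [leRHS](bigID (fun y => sigma y == m)) /= lerDl.
  exact: sumr_ge0.
by rewrite lerDl; apply: sumr_ge0 => x _; exact: sumr_ge0.
Qed.

(** On a pair of blocks, exp g <= 1 + g + 2 g^2 averages to at most 1 + G + 2 q <= exp (G + 2 q),
    where G is the block average of g and q = v / (c n)^2: the second moment over all pairs of
    states is divided by the size of the pair of blocks, at least (c n)^2. *)
Lemma chain_bernstein (g : S -> S -> R) (v : R) l a :
  (forall x y, g x y <= 2^-1) -> \sum_x \sum_y g x y ^+ 2 <= v ->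
  chainP block_law block_kernel l (fun s => a <= 2^-1 *
     path_sum (fun x y => g x y - block_avg g (sigma x) (sigma y) - 2 * (v / (c * n) ^+ 2)) l s)
  <= expR (- a).
Proof.
move=> g2 gv; apply: chainP_chernoff; [exact: block_kernel_ge0|exact: block_law_ge0|].
apply: chain_exp_half_sum_le1 => // k m.
set q := v / _; set G := block_avg g k m.
have cn0 : 0 < (c * n) ^+ 2 by rewrite exprn_gt0 // mulr_gt0.
have bb := block_size2_ge k m; have bb0 : 0 < block_size k * block_size m by rewrite mulr_gt0 ?block_size_gt0.
have v0 : 0 <= v.
  apply: le_trans gv; apply: sumr_ge0 => x _.
  by apply: sumr_ge0 => y _; exact: sqr_ge0.
have q0 : 0 <= q by apply: divr_ge0 => //; exact: ltW.
rewrite (eq_bigr (fun x => \sum_(y | sigma y == m) expR (g x y) * expR (- G - 2 * q))).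
  under eq_bigr do rewrite -mulr_suml.
  rewrite -mulr_suml.
  apply: (@le_trans _ _ ((block_size k * block_size m) * (1 + G + 2 * q) * expR (- G - 2 * q))).
    rewrite ler_wpM2r ?expR_ge0//.
    apply: (@le_trans _ _ (\sum_(x | sigma x == k) \sum_(y | sigma y == m)
        (1 + g x y + 2 * g x y ^+ 2))).
      by apply: ler_sum => x _; apply: ler_sum => y _; exact: expR_le_quad.
    under eq_bigr do rewrite !big_split /= -mulr_sumr.
    rewrite !big_split /= -mulr_sumr sum_block_const !mulrDr lerD//.
      by rewrite lerD // /G /block_avg mulrC divfK // gt_eqF.
    rewrite mulrCA ler_pM2l //.
    apply: le_trans (sum_block_le _ _ _) _ => [x y|]; first exact: sqr_ge0.
    by apply: le_trans gv _; rewrite /q mulrA ler_pdivlMr // mulrC ler_wpM2r.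
  rewrite -mulrA ler_piMr //; first exact: ltW.
  rewrite -opprD expRN ler_pdivrMr ?expR_gt0// mul1r -addrA.
  exact: expR_ge1Dx.
move=> x /eqP xk; apply: eq_bigr => y /eqP ym; rewrite -expRD xk ym; congr expR.
by rewrite addrA.
Qed.

(* A Poisson upper tail with exponent m / 2, where exp (m / 2) <= 2 ^ m. *)
Lemma chain_poisson (A C : S -> bool) (m : nat) l a :
  chainP block_law block_kernel l (fun s => a <= 2^-1 * path_sum (fun x y =>
     m%:R / 2 * (A x && C y)%:R
     - 2 ^+ m * (\sum_x (A x)%:R) * (\sum_y (C y)%:R) / (c * n) ^+ 2) l s)
  <= expR (- a).
Proof.
apply: chainP_chernoff; [exact: block_kernel_ge0|exact: block_law_ge0|].
apply: chain_exp_half_sum_le1 => // k k'.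
set q := _ / (c * n) ^+ 2.
have cn0 : 0 < (c * n) ^+ 2 by rewrite exprn_gt0 // mulr_gt0.
have bb := block_size2_ge k k'.
rewrite (eq_bigr (fun x => \sum_(y | sigma y == k') expR (m%:R / 2 * (A x && C y)%:R) * expR (- q)));
  last by move=> x _; apply: eq_bigr => y _; rewrite -expRD.
under eq_bigr do rewrite -mulr_suml.
rewrite -mulr_suml expRN ler_pdivrMr ?expR_gt0//.
apply: (@le_trans _ _ (block_size k * block_size k' * (1 + q))); last first.
  by rewrite ler_wpM2l ?expR_ge1Dx// (le_trans _ bb)// ltW.
apply: (@le_trans _ _ (\sum_(x | sigma x == k) \sum_(y | sigma y == k')
    (1 + 2 ^+ m * ((A x)%:R * (C y)%:R)))).
  apply: ler_sum => x _; apply: ler_sum => y _; rewrite -natrM mulnb.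
  case: (A x && C y); last by rewrite !mulr0 expR0 addr0.
  by rewrite !mulr1 (le_trans (expR_half_nat _ _))// lerDr.
under eq_bigr do rewrite big_split /= -mulr_sumr.
rewrite big_split /= sum_block_const mulrDr lerD // -mulr_sumr.
apply: (@le_trans _ _ (2 ^+ m * \sum_x \sum_y ((A x)%:R * (C y)%:R))).
  by rewrite ler_wpM2l ?exprn_ge0// sum_block_le // => x y; rewrite mulr_ge0.
have -> : \sum_x \sum_y ((A x)%:R * (C y)%:R : R) = (\sum_x (A x)%:R) * (\sum_y (C y)%:R).
  by rewrite mulr_suml; apply: eq_bigr => x _; rewrite mulr_sumr.
rewrite /q -(mulrA (2 ^+ m)); set t := 2 ^+ m * _.
rewrite mulrCA ler_peMr //.
  by apply: mulr_ge0; rewrite ?exprn_ge0 // mulr_ge0 // sumr_ge0.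
by rewrite ler_pdivlMr // mul1r.
Qed.

(** A single step of the kernel already averages over the state entered, whose probability is at
    most 1 / (c n); so the supermartingale suffices, without a parity split. The 4 bounds e. *)
Lemma chain_visits (v : S) l a :
  chainP block_law block_kernel l (fun s => a <= path_sum (fun x y => (y == v)%:R - 4 / (c * n)) l s)
  <= expR (- a).
Proof.
apply: chainP_chernoff; [exact: block_kernel_ge0|exact: block_law_ge0|].
apply: chain_exp_sum_le1; [exact: block_kernel_ge0|exact: block_law_ge0|exact: block_law_sum|move=> x].
under eq_bigr do rewrite expRD mulrA.
rewrite -mulr_suml expRN ler_pdivrMr ?expR_gt0// mul1r.
apply: (@le_trans _ _ (\sum_y (block_kernel x y + block_kernel x y * (4 * (y == v)%:R)))).
  apply: ler_sum => y _; rewrite -[X in _ <= X + _]mulr1 -mulrDr ler_wpM2l ?block_kernel_ge0//.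
  case: (y == v); last by rewrite expR0 mulr0 addr0.
  by rewrite mulr1 (le_trans (expR1_le4 R))// lerDr.
rewrite big_split /= block_kernel_sum (bigD1 v) //= big1 => [|y /negPf ->]; last by rewrite !mulr0.
apply: le_trans (expR_ge1Dx _); rewrite lerD2l addr0 eqxx mulr1 mulrC ler_wpM2l //.
exact: block_kernel_le.
Qed.

(** Given x, the centred indicator has mean zero under the kernel, so these are martingale
    increments. The sign of th selects the tail. *)
Lemma chain_transitions (k m : K) (th : R) l a : `|th| <= 2^-1 ->
  chainP block_law block_kernel l (fun s => a <= path_sum (fun x y =>
     th * ((sigma x == k)%:R * ((sigma y == m)%:R - p k m)) - 2 * th ^+ 2) l s)
  <= expR (- a).
Proof.
move=> th2; apply: chainP_chernoff; [exact: block_kernel_ge0|exact: block_law_ge0|].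
apply: chain_exp_sum_le1; [exact: block_kernel_ge0|exact: block_law_ge0|exact: block_law_sum|move=> x].
under eq_bigr do rewrite expRD mulrA.
rewrite -mulr_suml expRN ler_pdivrMr ?expR_gt0// mul1r.
pose D y := (sigma x == k)%:R * ((sigma y == m)%:R - p k m).
have D1 y : `|D y| <= 1.
  have := p0 k m; have := p_le1 k m.
  rewrite /D; case: (sigma x == k); last by rewrite mul0r normr0.
  by rewrite mul1r; case: (sigma y == m) => /=; rewrite ler_norml; lra.
apply: (@le_trans _ _ (\sum_y (block_kernel x y + th * (block_kernel x y * D y) + 2 * th ^+ 2 * block_kernel x y))).
  apply: ler_sum => y _.
  have -> : block_kernel x y + th * (block_kernel x y * D y) + 2 * th ^+ 2 * block_kernel x y =
     block_kernel x y * (1 + th * D y + 2 * th ^+ 2) by ring.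
  rewrite ler_wpM2l ?block_kernel_ge0//.
  have hu : th * D y <= 2^-1.
    by apply: le_trans (ler_norm _) _; rewrite normrM (le_trans _ th2)// ler_piMr.
  apply: le_trans (expR_le_quad hu) _.
  rewrite lerD2l ler_wpM2l// exprMn ler_piMr ?sqr_ge0//.
  by rewrite -(real_normK (num_real (D y))) expr_le1.
rewrite !big_split /= -!mulr_sumr block_kernel_sum mulr1.
have -> : \sum_y block_kernel x y * D y = 0.
  rewrite (block_kernel_mix x (fun k' => (sigma x == k)%:R * ((k' == m)%:R - p k m))).
  case: eqP => [->|_]; last by rewrite big1// => i _; rewrite mul0r mulr0.
  under eq_bigr do rewrite mul1r mulrBr.
  rewrite sumrB -mulr_suml p1 mul1r (bigD1 m) //= eqxx mulr1 big1 ?addr0 ?subrr//.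
  by move=> i /negPf ->; rewrite mulr0.
by rewrite mulr0 addr0; exact: expR_ge1Dx.
Qed.

End BlockConcentration.

(** * The good event *)

Section PathSum.
Variables (R : realType) (S : finType).
Implicit Types (F G : S -> S -> R) (s : nat -> S).

Lemma path_sumD F G l s :
  path_sum (fun x y => F x y + G x y) l s = path_sum F l s + path_sum G l s.
Proof. exact: big_split. Qed.

Lemma path_sumZ a F l s : path_sum (fun x y => a * F x y) l s = a * path_sum F l s.
Proof. by rewrite /path_sum mulr_sumr. Qed.

Lemma path_sum_const (a : R) l s : path_sum (fun _ _ => a) l s = l%:R * a.
Proof. by rewrite /path_sum sumr_const card_ord mulr_natl. Qed.

Lemma path_sum_affine a b F l s :
  path_sum (fun x y => a * F x y - b) l s = a * path_sum F l s - l%:R * b.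
Proof.
by rewrite -mulrN -(path_sum_const _ _ s) -path_sumZ -path_sumD.
Qed.

Lemma path_sum_pairs F l s :
  path_sum F l s = \sum_u \sum_v F u v * path_sum (fun x y => ((x == u) && (y == v))%:R) l s.
Proof.
rewrite /path_sum.
under [RHS]eq_bigr do under eq_bigr do rewrite mulr_sumr.
under [RHS]eq_bigr do rewrite exchange_big /=.
rewrite exchange_big /=; apply: eq_bigr => t _.
rewrite (bigD1 (s t)) //= (bigD1 (s t.+1)) //= !eqxx mulr1.
rewrite [X in _ + X + _]big1 => [|v /negPf vn]; last by rewrite (eq_sym _ v) vn mulr0.
rewrite big1 ?addr0 // => u /negPf un; rewrite big1 // => v _.
by rewrite (eq_sym _ u) un mulr0.
Qed.

End PathSum.

Section GoodPaths.
Variables (R : realType) (S K : finType) (sigma : S -> K).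
Variables (p : K -> K -> R) (pi0 : K -> R).
Hypothesis p0 : forall k l, 0 <= p k l.
Hypothesis p1 : forall k, \sum_l p k l = 1.
Hypothesis pi0_ge0 : forall k, 0 <= pi0 k.
Hypothesis pi0_sum : \sum_k pi0 k = 1.
Variable c : R.
Hypothesis c0 : 0 < c.
Hypothesis S0 : (0 < #|S|)%N.
Hypothesis block_size_ge : forall k, c * #|S|%:R <= block_size R sigma k.

Let n : R := #|S|%:R.
Variables (l : nat) (M : R) (J D : nat).
Definition density : R := l%:R / n.
Let d := density.
Let rd := Num.sqrt d.
Hypothesis d4 : 4 <= d.
Hypothesis M1 : 1 <= M.

Implicit Types (s : nat -> S) (a b : S -> bool * nat) (A C : S -> bool).

Definition code_prod a b x y : R := sgnat R (a x) * sgnat R (b y).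

Definition is_light a b x y : bool := ((a x).2%:R * (b y).2%:R <= Num.sqrt density).

Definition light_part a b x y : R := code_prod a b x y * (is_light a b x y)%:R.

Definition centered (f : S -> S -> R) x y : R := f x y - block_avg sigma f (sigma x) (sigma y).

Definition code_sqn a : R := \sum_u (a u).2%:R ^+ 2.

(** 148 = 4 * 37, where 37 = 18 + 18 + 1 bounds the costs of two codes plus M, in units of M n. The
    factor 4 undoes the 1/2 of the parity split and the 2 in the scaling by 2 sqrt d; the latter
    also turns the variance term 128 / c^2 into 256 / c^2. *)
Definition light_const : R := 148 + 256 / c ^+ 2.

Definition good_light s := forall a b, code_sqn a <= 16 * n -> code_sqn b <= 16 * n ->
  path_sum (centered (light_part a b)) l s <= light_const * M * n * rd.

Definition edges A C s : R := path_sum (fun x y => (A x && C y)%:R) l s.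

Definition setn A : R := \sum_x (A x)%:R.

(** The fixed price n 8^-(i+1) has to be summable against 4^i, the weight of level i in a squared
    norm; by [sum_expRN_set] this rate dictates 3 (i+1) per element. *)
Definition level_cost (i : nat) A : R :=
  (3 * i.+1)%:R * setn A + n * 2^-1 ^+ (3 * i.+1) + M * i.+1%:R.

(** All sets are included, as the vectors whose level sets are taken are chosen after the path.
    Where i + j + 2 <= D the truncated subtraction gives 0 and the left side vanishes. *)
Definition good_disc s := forall (i j : nat) A C, (i < J)%N -> (j < J)%N ->
  (i + j + 2 - D)%:R / 2 * edges A C s <=
    2 ^+ (i + j + 2 - D) * setn A * setn C * d / (c ^+ 2 * n)
    + 2 * (level_cost i A + level_cost j C).

Definition visits v s : R := path_sum (fun x y => (y == v)%:R) l s.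

(** 4 / c is the compensator of [chain_visits]; the extra 2 leaves each state with failure
    probability exp (-2 d), and Markov's inequality for the number of exceptions, against the
    trimming size n exp (-d), leaves exp (-d). *)
Definition deg_const : R := 4 / c + 2.

Definition good_degrees s :=
  \sum_v (deg_const * d <= visits v s)%R%:R <= n * expR (- d).

Definition good_transitions s := forall k m : K,
  `|path_sum (fun x y => (sigma x == k)%:R * ((sigma y == m)%:R - p k m)) l s|
    <= 3 * M * n * rd.

Let n0 : 0 < n. Proof. by rewrite ltr0n. Qed.
Let n1 : 1 <= n. Proof. by rewrite ler1n. Qed.
Let ld : l%:R = d * n.
Proof. by rewrite /d /density divfK // gt_eqF. Qed.
Let d0 : 0 < d. Proof. by rewrite (lt_le_trans _ d4). Qed.
Let rd2 : rd ^+ 2 = d. Proof. by rewrite sqr_sqrtr // ltW. Qed.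
Let rd_ge2 : 2 <= rd.
Proof.
have -> : 2 = Num.sqrt 4 :> R by rewrite -[4]/(2 * 2)%:R natrM -expr2 sqrtr_sqr ger0_norm.
by rewrite ler_sqrt // ltW.
Qed.
Let rd0 : 0 < rd. Proof. by rewrite (lt_le_trans _ rd_ge2). Qed.

Let mu := block_law sigma pi0.
Let Q := block_kernel sigma p.
Let PR := chainP mu Q l.

Let le_PR (B B' : (nat -> S) -> Prop) : (forall s, B s -> B' s) -> PR B <= PR B'.
Proof. by apply: le_chainP => [x y|x]; [exact: block_kernel_ge0|exact: block_law_ge0]. Qed.

Let PR_exists (I : finType) (B : I -> (nat -> S) -> Prop) :
  PR (fun s => exists i, B i s) <= \sum_i PR (B i).
Proof. by apply: chainP_exists => [x y|x]; [exact: block_kernel_ge0|exact: block_law_ge0]. Qed.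

Let PR_or (B B' : (nat -> S) -> Prop) : PR (fun s => B s \/ B' s) <= PR B + PR B'.
Proof. by apply: chainP_or => [x y|x]; [exact: block_kernel_ge0|exact: block_law_ge0]. Qed.

Let PR_exists2 (I I' : finType) (B : I -> I' -> (nat -> S) -> Prop) :
  PR (fun s => exists i j, B i j s) <= \sum_i \sum_j PR (B i j).
Proof.
by apply: le_trans (PR_exists _) _; apply: ler_sum => i _; exact: PR_exists.
Qed.

Lemma block_avgZ (al : R) (f : S -> S -> R) k m :
  block_avg sigma (fun x y => al * f x y) k m = al * block_avg sigma f k m.
Proof.
rewrite /block_avg mulrA; congr (_ / _); rewrite mulr_sumr; apply: eq_bigr => x _.
by rewrite mulr_sumr.
Qed.

Lemma light_part_le a b x y : `|light_part a b x y| <= rd.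
Proof.
rewrite /light_part /code_prod; have [h|_] := boolP (is_light a b x y).
  by rewrite mulr1 normrM !normr_sgnat.
by rewrite mulr0 normr0 ltW.
Qed.

Lemma sum_light_part_sqr a b : code_sqn a <= 16 * n -> code_sqn b <= 16 * n ->
  \sum_x \sum_y light_part a b x y ^+ 2 <= (16 * n) ^+ 2.
Proof.
move=> ha hb; apply: (@le_trans _ _ (code_sqn a * code_sqn b)).
  rewrite mulr_suml; apply: ler_sum => x _; rewrite mulr_sumr; apply: ler_sum => y _.
  rewrite /light_part /code_prod exprMn -[leRHS]mulr1 ler_pM ?sqr_ge0//.
    by rewrite -(real_normK (num_real (_ * _))) normrM !normr_sgnat exprMn.
  by case: (is_light _ _ _ _); rewrite ?expr1n ?expr0n.
have sq0 e : 0 <= code_sqn e by apply: sumr_ge0 => u _; exact: sqr_ge0.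
by rewrite expr2 ler_pM.
Qed.

Definition code_cost a : R := \sum_u ((a u).2%:R + 2).

Lemma code_cost_le a : code_sqn a <= 16 * n -> code_cost a <= 18 * n.
Proof.
move=> ha; apply: (@le_trans _ _ (code_sqn a + 2 * n)); last by lra.
rewrite /code_cost /code_sqn big_split /= lerD //; last by rewrite sumr_const mulr_natr.
apply: ler_sum => u _; rewrite -natrX ler_nat.
by case: (a u).2 => // k; rewrite expnS leq_pmulr // expn_gt0.
Qed.

Lemma light_bad_le a b : code_sqn a <= 16 * n -> code_sqn b <= 16 * n ->
  PR (fun s => light_const * M * n * rd < path_sum (centered (light_part a b)) l s)
  <= expR (- (code_cost a + code_cost b + M)).
Proof.
move=> ha hb; pose g x y := (2 * rd)^-1 * light_part a b x y.
have hg x y : g x y <= 2^-1.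
  rewrite /g invfM -mulrA ler_piMr ?invr_ge0// mulrC ler_pdivrMr // mul1r.
  exact: le_trans (ler_norm _) (light_part_le _ _ _ _).
have hg2 : \sum_x \sum_y g x y ^+ 2 <= (2 * rd)^-1 ^+ 2 * (16 * n) ^+ 2.
  under eq_bigr do under eq_bigr do rewrite exprMn.
  under eq_bigr do rewrite -mulr_sumr.
  by rewrite -mulr_sumr ler_wpM2l ?sqr_ge0// sum_light_part_sqr.
apply: le_trans (chain_bernstein p0 p1 pi0_ge0 pi0_sum c0 S0 block_size_ge l _ hg hg2).
apply: le_PR => s lt.
rewrite (_ : (fun x y => g x y - _ - _) = (fun x y => (2 * rd)^-1 * centered (light_part a b) x y
   - 2 * ((2 * rd)^-1 ^+ 2 * (16 * n) ^+ 2 / (c * n) ^+ 2))); last first.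
  by apply/funext => x; apply/funext => y; rewrite /g block_avgZ /centered mulrBr.
rewrite path_sum_affine ld.
have -> : d * n * (2 * ((2 * rd)^-1 ^+ 2 * (16 * n) ^+ 2 / (c * n) ^+ 2)) =
    128 / c ^+ 2 * n.
  by rewrite -rd2; field; rewrite !gt_eqF.
have ca := code_cost_le ha; have cb := code_cost_le hb.
have nM : M <= n * M by rewrite ler_peMl // (le_trans _ M1).
have nM' : n <= n * M by rewrite ler_peMr // ltW.
set X := path_sum _ _ _ in lt *.
have h : light_const * (M * n) / 2 <= (2 * rd)^-1 * X.
  rewrite [leRHS]mulrC ler_pdivlMr ?mulr_gt0//; apply: ltW; apply: le_lt_trans lt.
  by rewrite le_eqVlt; apply/orP; left; apply/eqP; field.
have i0 : 0 <= (c ^+ 2)^-1 by rewrite invr_ge0 sqr_ge0.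
have nMi : (c ^+ 2)^-1 * n <= (c ^+ 2)^-1 * (n * M) by rewrite ler_wpM2l.
rewrite /light_const (mulrC M n) in h.
nra.
Qed.

Lemma prob_not_light : PR (fun s => ~ good_light s) <= expR (- M).
Proof.
(* Magnitudes of admissible codes are at most 16 n, because k <= k^2 for naturals; this makes the
   union finite. *)
pose m := (16 * #|S|)%N.+1.
pose dec (a : {ffun S -> bool * 'I_m}) u := ((a u).1, nat_of_ord (a u).2).
pose ok (a : {ffun S -> bool * 'I_m}) := code_sqn (dec a) <= 16 * n.
have step1 : PR (fun s => ~ good_light s) <= PR (fun s => exists a b : {ffun S -> bool * 'I_m}, [&& ok a, ok b &
    light_const * M * n * rd < path_sum (centered (light_part (dec a) (dec b))) l s]).
  apply: le_PR => s /existsNP[a /existsNP[b /not_implyP[ha /not_implyP[hb /negP]]]].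
  rewrite -ltNge => lt.
  have dec_surj e : code_sqn e <= 16 * n ->
      exists f : {ffun S -> bool * 'I_m}, dec f = e.
    move=> he; exists [ffun u => ((e u).1, inord (e u).2)]; apply/funext => u.
    rewrite /dec ffunE /= inordK -?surjective_pairing// ltnS.
    have : ((e u).2%:R : R) <= 16 * n.
      apply: le_trans he; rewrite /code_sqn (bigD1 u) //=.
      rewrite (@le_trans _ _ ((e u).2%:R ^+ 2))//; last first.
        by rewrite lerDl; apply: sumr_ge0 => v _; exact: sqr_ge0.
      by rewrite -natrX ler_nat; case: (e u).2 => // k; rewrite expnS leq_pmulr // expn_gt0.
    by rewrite /n -natrM ler_nat.
  have [a' ea] := dec_surj a ha; have [b' eb] := dec_surj b hb.
  by exists a', b'; rewrite /ok ea eb ha hb.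
apply: le_trans step1 _.
apply: le_trans (PR_exists2 _) _.
pose cost (a : {ffun S -> bool * 'I_m}) : R := \sum_u ((a u).2%:R + 2).
apply: (@le_trans _ _ (\sum_(a : {ffun S -> bool * 'I_m}) \sum_(b : {ffun S -> bool * 'I_m}) expR (- M) * (expR (- cost a) * expR (- cost b)))).
  apply: ler_sum => a _; apply: ler_sum => b _.
  have [/andP[ha hb]|h] := boolP (ok a && ok b); last first.
    apply: (@le_trans _ _ 0); last by rewrite !mulr_ge0 ?expR_ge0.
    rewrite -(@chainE0 _ _ mu Q l); apply: le_chainE => [x y|x|s].
    - exact: block_kernel_ge0.
    - exact: block_law_ge0.
    by rewrite andbA (negbTE h); case: asboolP.
  rewrite -!expRD (_ : - M + _ = - (code_cost (dec a) + code_cost (dec b) + M)).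
    apply: le_trans (light_bad_le ha hb); apply: le_PR => s /and3P[_ _]; exact.
  by rewrite /code_cost /cost /dec /=; lra.
under eq_bigr do rewrite -mulr_sumr -mulr_sumr.
rewrite -mulr_sumr ler_piMr ?expR_ge0// -mulr_suml.
apply: mulr_ile1; rewrite ?sum_expRN_code//; apply: sumr_ge0 => a _; exact: expR_ge0.
Qed.

Lemma prob_not_disc : PR (fun s => ~ good_disc s) <= 4 * expR (- M).
Proof.
pose E (i j : 'I_J) (A C : {ffun S -> bool}) s :=
  level_cost i A + level_cost j C <= 2^-1 * path_sum (fun x y =>
     (i + j + 2 - D)%:R / 2 * (A x && C y)%:R
     - 2 ^+ (i + j + 2 - D) * setn A * setn C / (c * n) ^+ 2) l s.
apply: (@le_trans _ _ (PR (fun s => exists i j, exists A C : {ffun S -> bool}, E i j A C s))).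
  apply: le_PR => s /existsNP[i /existsNP[j /existsNP[A /existsNP[C]]]].
  move=> /not_implyP[iJ /not_implyP[jJ /negP]]; rewrite -ltNge => lt.
  exists (Ordinal iJ), (Ordinal jJ), [ffun x => A x], [ffun x => C x].
  have eA (A' : S -> bool) : [ffun x => A' x] = A' :> (S -> bool).
    by apply/funext => x; rewrite ffunE.
  rewrite /E !eA path_sum_affine ld.
  have -> : d * n * (2 ^+ (i + j + 2 - D) * setn A * setn C / (c * n) ^+ 2) =
     2 ^+ (i + j + 2 - D) * setn A * setn C * d / (c ^+ 2 * n).
    by field; rewrite !gt_eqF.
  rewrite -/(edges A C s); apply: ltW; move: lt => /=; lra.
apply: le_trans (PR_exists2 _) _.
have cost1 (i : nat) : \sum_(A : {ffun S -> bool}) expR (- level_cost i A) <= expR (- M) * 2^-1 ^+ i.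
  rewrite (eq_bigr (fun A : {ffun S -> bool} => expR (- (M * i.+1%:R)) *
     expR (- ((3 * i.+1)%:R * setn A + n * 2^-1 ^+ (3 * i.+1))))); last first.
    by move=> A _; rewrite -expRD; congr expR; rewrite /level_cost; lra.
  rewrite -mulr_sumr; apply: (@le_trans _ _ (expR (- (M * i.+1%:R)))).
    by rewrite ler_piMr ?expR_ge0//; exact: sum_expRN_set.
  (* M (i+1) = M + i M: the first term is the failure probability, and i M >= i makes the levels
     summable. *)
  have -> : - (M * i.+1%:R) = - M + i%:R * - M by rewrite -natr1; ring.
  rewrite expRD ler_wpM2l ?expR_ge0// expRM_natl lerXn2r ?nnegrE ?expR_ge0//.
  by apply: le_trans (expRN1_le R); rewrite ler_expR lerN2.
apply: (@le_trans _ _ (\sum_(i < J) \sum_(j < J) expR (- M) * 2^-1 ^+ i * (expR (- M) * 2^-1 ^+ j))).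
  apply: ler_sum => i _; apply: ler_sum => j _.
  apply: le_trans (PR_exists2 _) _.
  apply: (@le_trans _ _ (\sum_(A : {ffun S -> bool}) \sum_(C : {ffun S -> bool})
     expR (- level_cost i A) * expR (- level_cost j C))).
    apply: ler_sum => A _; apply: ler_sum => C _; rewrite -expRD -opprD.
    exact: (chain_poisson p0 p1 pi0_ge0 pi0_sum c0 S0 block_size_ge A C _ l).
  under eq_bigr do rewrite -mulr_sumr.
  rewrite -mulr_suml ler_pM ?cost1//; apply: sumr_ge0 => A _; exact: expR_ge0.
under eq_bigr do rewrite -mulr_sumr.
rewrite -mulr_suml -mulr_sumr; set h := \sum_(i < J) _.
have h2 : h <= 2 := sum_half_pow R J.
have h0 : 0 <= h by apply: sumr_ge0 => i _; rewrite exprn_ge0.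
have e0 := expR_ge0 (- M); have e1 : expR (- M) <= 1.
  by rewrite -expR0 ler_expR oppr_le0 (le_trans _ M1).
have t0 : 0 <= expR (- M) * h by exact: mulr_ge0.
have t1 : expR (- M) * h <= 2 * expR (- M) by rewrite mulrC ler_wpM2r.
have t2 : expR (- M) * h <= 2 by lra.
apply: (@le_trans _ _ (2 * expR (- M) * 2)); last by lra.
by rewrite ler_pM.
Qed.

Lemma prob_not_degrees : PR (fun s => ~ good_degrees s) <= expR (- d).
Proof.
have nd : 0 < n * expR (- d) by rewrite mulr_gt0 ?expR_gt0.
apply: (@le_trans _ _ (chainE mu Q l (fun s => (n * expR (- d))^-1 *
    \sum_v (`[< deg_const * d <= visits v s >])%:R))).
  apply: le_chainE => [x y|x|s]; [exact: block_kernel_ge0|exact: block_law_ge0|].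
  case: asboolP => [/negP|_]; last by rewrite mulr_ge0 ?invr_ge0 ?sumr_ge0// ltW.
  rewrite -ltNge [leRHS]mulrC ler_pdivlMr // mul1r => /ltW h; apply: le_trans h _.
  by apply: ler_sum => v _; rewrite asboolb.
rewrite chainEZ chainE_sum mulrC ler_pdivrMr //.
apply: (@le_trans _ _ (\sum_(v : S) expR (- (2 * d)))); last first.
  rewrite sumr_const -[leLHS]mulr_natl [leRHS]mulrCA -expRD; have -> : - d + - d = - (2 * d) by lra.
  by [].
apply: ler_sum => v _; apply: le_trans (chain_visits p0 p1 pi0_ge0 pi0_sum c0 S0 block_size_ge v l _).
apply: le_PR => s h.
rewrite (_ : (fun x y => _ - _) = (fun x y => 1 * (y == v)%:R - 4 / (c * n))); last first.
  by apply/funext => x; apply/funext => y; rewrite mul1r.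
rewrite path_sum_affine mul1r ld -/(visits v s).
have -> : d * n * (4 / (c * n)) = 4 / c * d by field; rewrite !gt_eqF.
move: h; rewrite /deg_const; lra.
Qed.

Lemma prob_not_transitions :
  PR (fun s => ~ good_transitions s) <= 2 * #|K|%:R ^+ 2 * expR (- M).
Proof.
pose F k m x y : R := (sigma x == k)%:R * ((sigma y == m)%:R - p k m).
pose th (b : bool) : R := (-1) ^+ b / rd.
pose E (km : K * K) (b : bool) s := n * M <= path_sum (fun x y =>
   th b * F km.1 km.2 x y - 2 * th b ^+ 2) l s.
have th2 (b : bool) : th b ^+ 2 = d^-1 by rewrite /th exprMn sqrr_sign mul1r exprVn rd2.
apply: (@le_trans _ _ (PR (fun s => exists (km : K * K) (b : bool), E km b s))).
  apply: le_PR => s /existsNP[k /existsNP[m /negP]]; rewrite -ltNge -/(F k m).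
  set X := path_sum _ _ _ => lt; exists (k, m), (X < 0).
  rewrite /E path_sum_affine th2 ld /= -/X.
  have -> : th (X < 0) * X = `|X| / rd.
    rewrite /th mulrAC; congr (_ / _); case: (ltP X 0) => x0.
      by rewrite expr1 mulN1r ltr0_norm.
    by rewrite expr0 mul1r ger0_norm.
  (* With th = 1 / sqrt d up to sign, the compensator 2 th^2 adds up to 2 n along the path; of the 3
     M n allowed, at least M n is left. *)
  have -> : d * n * (2 / d) = 2 * n by field; rewrite gt_eqF.
  have h : 3 * M * n <= `|X| / rd by rewrite ler_pdivlMr // ltW.
  have nM' : n <= n * M by rewrite ler_peMr // ltW.
  nra.
apply: le_trans (PR_exists2 _) _.
apply: (@le_trans _ _ (\sum_(km : K * K) \sum_(b : bool) expR (- M))).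
  apply: ler_sum => -[k m] _; apply: ler_sum => b _.
  apply: (@le_trans _ _ (expR (- (n * M)))).
    apply: (chain_transitions p0 p1 pi0_ge0 pi0_sum c0 S0 block_size_ge).
    rewrite normrM normrX normrN1 expr1n mul1r ger0_norm ?invr_ge0 ?(ltW rd0)//.
    by rewrite lef_pV2 ?posrE.
  by rewrite ler_expR lerN2 ler_peMl // (le_trans _ M1).
rewrite !sumr_const card_prod card_bool -mulrnA -[leLHS]mulr_natl !natrM.
by rewrite expr2 mulrA.
Qed.

Definition good_path s := [/\ good_light s, good_disc s, good_degrees s & good_transitions s].

Lemma prob_not_good :
  PR (fun s => ~ good_path s) <= (5 + 2 * #|K|%:R ^+ 2) * expR (- M) + expR (- d).
Proof.
apply: (@le_trans _ _ (PR (fun s => (~ good_light s \/ ~ good_disc s) \/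
   (~ good_degrees s \/ ~ good_transitions s)))).
  apply: le_PR => s; apply: contra_notP => /not_orP[/not_orP[/contrapT ? /contrapT ?]].
  by move=> /not_orP[/contrapT ? /contrapT ?].
apply: le_trans (PR_or _ _) _.
have h1 := PR_or (fun s => ~ good_light s) (fun s => ~ good_disc s).
have h2 := PR_or (fun s => ~ good_degrees s) (fun s => ~ good_transitions s).
have := prob_not_light; have := prob_not_disc; have := prob_not_degrees.
have := prob_not_transitions; lra.
Qed.

End GoodPaths.

(** * Heavy pairs *)

Section GeometricSums.
Variable R : realType.

Lemma sum_arith_geom (m : nat) : \sum_(k < m) k.+1%:R * (2^-1 : R) ^+ k <= 4.
Proof.
suff : \sum_(k < m) k.+1%:R * (2^-1 : R) ^+ k = 4 - (2 * m%:R + 4) * 2^-1 ^+ m.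
  by move=> ->; rewrite lerBlDr lerDl mulr_ge0// ?exprn_ge0// addr_ge0// mulr_ge0.
elim: m => [|m IH]; first by rewrite big_ord0 expr0; lra.
by rewrite big_ord_recr /= IH exprS -2!natr1; set q := 2^-1 ^+ m; field.
Qed.

Lemma sum_arith_geom_rev (J L : nat) :
  \sum_(i < J | (i <= L)%N) (L - i).+1%:R * (2^-1 : R) ^+ (L - i) <= 4.
Proof.
apply: (@le_trans _ _ (\sum_(i < J + L.+1 | (i <= L)%N) (L - i).+1%:R * (2^-1 : R) ^+ (L - i))).
  rewrite (big_ord_widen_cond _ (fun i => i <= L)%N
    (fun i => (L - i).+1%:R * (2^-1 : R) ^+ (L - i)) (leq_addr L.+1 J)).
  rewrite [leRHS](bigID (fun i : 'I__ => (i < J)%N)) /= lerDl.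
  by apply: sumr_ge0 => i _; rewrite mulr_ge0// exprn_ge0.
have <- : \sum_(i < L.+1) (L - i).+1%:R * (2^-1 : R) ^+ (L - i) =
    \sum_(i < J + L.+1 | (i <= L)%N) (L - i).+1%:R * (2^-1 : R) ^+ (L - i).
  by rewrite (big_ord_widen _ (fun i => (L - i).+1%:R * (2^-1 : R) ^+ (L - i)) (leq_addl J L.+1)).
rewrite (reindex_inj rev_ord_inj) /=.
apply: le_trans (sum_arith_geom L.+1); apply: ler_sum => k _.
by rewrite subSS subKn // -ltnS.
Qed.

Lemma sum_pow4 (m : nat) : \sum_(j < m) (4 : R) ^+ j <= 4 ^+ m / 3.
Proof.
suff : \sum_(j < m) (4 : R) ^+ j = 4 ^+ m / 3 - 1 / 3 by move=> ->; lra.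
elim: m => [|m IH]; first by rewrite big_ord0 expr0; lra.
by rewrite big_ord_recr /= IH exprS; set q := 4 ^+ m; field.
Qed.

(** Because (k+1) (N-k) >= N. With N = 2 j + 3 it turns the weight 1/m into one of order 1/(j+1),
    which cancels the factor j+1 in [level_cost]; the loss k+1 is absorbed by the geometric decay in
    the distance k from the extreme level. *)
Lemma inv_subn_le (N k : nat) : (k < N)%N -> (N - k)%:R^-1 <= k.+1%:R / N%:R :> R.
Proof.
move=> kN; have N0 : (0 < N)%N by case: N kN.
rewrite ler_pdivlMr ?ltr0n// mulrC ler_pdivrMr ?ltr0n ?subn_gt0// -natrM ler_nat.
have : (N - k + k)%N = N by rewrite subnK // ltnW.
have : (0 < N - k)%N by rewrite subn_gt0.
by move: (N - k)%N => r r0 <-; clear -r0; nia.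
Qed.

(* Summing the level pairs (i, j) over i, the weights 2^(i+j) / m, with
   m = i + j + 2 - D, decrease geometrically away from the extreme index
   i = j + D + 1. *)
Lemma sum_level_weights (J D j : nat) :
  \sum_(i < J | (D < i + j + 2)%N && (i <= j + D + 1)%N)
     2 ^+ (i + j) / (i + j + 2 - D)%:R <= 4 * 2 ^+ D * 4 ^+ j / j.+1%:R :> R.
Proof.
pose L := (j + D + 1)%N; pose N := (2 * j + 3)%N.
apply: (@le_trans _ _ (\sum_(i < J | (i <= L)%N)
    2 * 2 ^+ D * 4 ^+ j / N%:R * ((L - i).+1%:R * (2^-1 : R) ^+ (L - i)))).
  rewrite [leRHS](bigID (fun i : 'I__ => (D < i + j + 2)%N)) /= [leLHS](eq_bigl
    (fun i : 'I_J => (i <= L)%N && (D < i + j + 2)%N)); last by move=> i; rewrite andbC.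
  rewrite -[leLHS]addr0 lerD //; last first.
    apply: sumr_ge0 => i _; apply: mulr_ge0; last by rewrite mulr_ge0// exprn_ge0.
    by rewrite !mulr_ge0 ?invr_ge0 ?exprn_ge0.
  apply: ler_sum => i /andP[iL iD].
  have -> : (i + j + 2 - D)%N = (N - (L - i))%N by rewrite /N /L; move: iL iD; rewrite /L; lia.
  have -> : 2 ^+ (i + j) = 2 * 2 ^+ D * 4 ^+ j * (2^-1 : R) ^+ (L - i).
    have -> : (4 : R) ^+ j = 2 ^+ (2 * j) by rewrite exprM expr2 -natrM.
    rewrite exprVn -exprS -exprD; apply: (@mulIf _ (2 ^+ (L - i))); first by rewrite expf_neq0.
    rewrite mulfVK ?expf_neq0// -exprD; congr (_ ^+ _).
    by move: iL; rewrite /L; lia.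
  have := @inv_subn_le N (L - i)%N; set k := (L - i)%N => /(_ _) h.
  have {}h : (N - k)%:R^-1 <= k.+1%:R / N%:R :> R.
    by apply: h; rewrite /k /N /L; move: iL iD; rewrite /L; lia.
  apply: le_trans (ler_wpM2l _ h) _.
    by rewrite !mulr_ge0 ?exprn_ge0.
  by rewrite le_eqVlt; apply/orP; left; apply/eqP; ring.
rewrite -mulr_sumr; apply: (@le_trans _ _ (2 * 2 ^+ D * 4 ^+ j / N%:R * 4)).
  rewrite ler_wpM2l ?sum_arith_geom_rev// divr_ge0// !mulr_ge0// exprn_ge0//.
have N2 : N%:R^-1 <= (2 * j.+1%:R)^-1 :> R.
  have N0 : (0 < N)%N by rewrite /N addn3.
  by rewrite lef_pV2 ?posrE ?mulr_gt0 ?ltr0n// -natrM ler_nat /N; lia.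
apply: (@le_trans _ _ (2 * 2 ^+ D * 4 ^+ j * (2 * j.+1%:R)^-1 * 4)).
  by rewrite ler_wpM2r// ler_wpM2l// !mulr_ge0// exprn_ge0.
rewrite invfM le_eqVlt; apply/orP; left; apply/eqP; field.
by rewrite ?nat1r ?natr1 pnatr_eq0.
Qed.

End GeometricSums.

Section PathSumOrder.
Variables (R : realType) (S : finType).
Implicit Types (F G : S -> S -> R) (s : nat -> S).

Lemma le_path_sum F G l s : (forall x y, F x y <= G x y) -> path_sum F l s <= path_sum G l s.
Proof. by move=> FG; apply: ler_sum. Qed.

Lemma path_sum_sum (I : finType) (P : pred I) (F : I -> S -> S -> R) l s :
  path_sum (fun x y => \sum_(i | P i) F i x y) l s = \sum_(i | P i) path_sum (F i) l s.
Proof. exact: exchange_big. Qed.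

Lemma path_sum_snd (f : S -> R) l s : path_sum (fun _ y => f y) l s = \sum_v f v * visits R l v s.
Proof.
rewrite /visits /path_sum; under [RHS]eq_bigr do rewrite mulr_sumr.
rewrite exchange_big; apply: eq_bigr => t _ /=.
rewrite (bigD1 (s t.+1)) //= eqxx mulr1 big1 ?addr0// => v /negPf vn.
by rewrite eq_sym vn mulr0.
Qed.

Lemma path_sum_fst_le (f : S -> R) l s : (forall x, 0 <= f x) ->
  path_sum (fun x _ => f x) l s <= f (s 0%N) + path_sum (fun _ y => f y) l s.
Proof.
move=> f0; rewrite /path_sum.
apply: (@le_trans _ _ (\sum_(t < l.+1) f (s t))).
  by rewrite big_ord_recr /= lerDl.
by rewrite big_ord_recl.
Qed.

End PathSumOrder.

Section Heavy.
Variables (R : realType) (S : finType) (c : R) (l : nat) (M : R) (J D : nat).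
Hypothesis c0 : 0 < c.
Hypothesis S0 : (0 < #|S|)%N.
Let n : R := #|S|%:R.
Let d := density R S l.
Let rd := Num.sqrt d.
Hypothesis d4 : 4 <= d.
Hypothesis M1 : 1 <= M.
Hypothesis D_le : 2 ^+ D <= rd.
Hypothesis D_gt : rd < 2 ^+ D.+1.
Hypothesis J_gt : forall k : nat, (k ^ 2 <= 16 * #|S|)%N -> (trunc_log 2 k < J)%N.
Hypothesis J_le : 4 ^+ J <= 64 * n.

Implicit Types (a b : S -> bool * nat).

(** Positivity is tested because [trunc_log 2 0] is 0: zero entries would otherwise fall into level
    0. *)
Definition level_set a i x : bool := (0 < (a x).2)%N && (trunc_log 2 (a x).2 == i).

Definition heavy a b x y : R :=
  (a x).2%:R * (b y).2%:R * (~~ is_light R l a b x y)%:R.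

(** The first condition expresses that the product exceeds sqrt d, the others that neither entry
    exceeds the other by the factor sqrt d; the offsets are the losses in rounding to powers of
    2. *)
Definition near_levels i j := [&& D < i + j + 2, i <= j + D + 1 & j <= i + D + 1]%N.

Let n0 : 0 < n. Proof. by rewrite ltr0n. Qed.
Let n1 : 1 <= n. Proof. by rewrite ler1n. Qed.
Let d0 : 0 < d. Proof. by rewrite (lt_le_trans _ d4). Qed.
Let rd2 : rd ^+ 2 = d. Proof. by rewrite sqr_sqrtr // ltW. Qed.
Let rd0 : 0 < rd. Proof. by rewrite sqrtr_gt0. Qed.
Let rd1 : 1 <= rd. Proof. by rewrite -sqrtr1 ler_sqrt // (le_trans _ d4)// ler1n. Qed.

Lemma code_sqn_lt a x : code_sqn R a <= 16 * n -> (trunc_log 2 (a x).2 < J)%N.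
Proof.
move=> ha; apply: J_gt; rewrite -(ler_nat R) natrX natrM.
apply: le_trans ha; rewrite /code_sqn (bigD1 x) //= lerDl.
by apply: sumr_ge0 => u _; exact: sqr_ge0.
Qed.

(** If one entry is at least sqrt d times the other, the product is at most its square over sqrt d,
    a function of one end point that degrees control. Otherwise the levels are near and 4 * 2^(i+j)
    dominates the product. *)
Lemma heavy_le a b x y : code_sqn R a <= 16 * n -> code_sqn R b <= 16 * n ->
  heavy a b x y <= (a x).2%:R ^+ 2 / rd + (b y).2%:R ^+ 2 / rd +
    \sum_(i < J) \sum_(j < J | near_levels i j) 4 * 2 ^+ (i + j) * (level_set a i x && level_set b j y)%:R.
Proof.
move=> ha hb; rewrite /heavy.
have sum0 : 0 <= \sum_(i < J) \sum_(j < J | near_levels i j)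
    4 * 2 ^+ (i + j) * (level_set a i x && level_set b j y)%:R :> R.
  apply: sumr_ge0 => i _; apply: sumr_ge0 => j _.
  by rewrite !mulr_ge0// exprn_ge0.
have q0 (k : nat) : 0 <= k%:R ^+ 2 / rd.
  by rewrite divr_ge0 ?sqr_ge0// ltW.
have [_|] := boolP (is_light R l a b x y).
  by rewrite mulr0 addr_ge0// addr_ge0// q0.
rewrite /is_light -/d -/rd -ltNge mulr1 => hv.
set k := (a x).2 in hv *; set m := (b y).2 in hv *.
have [far1|near1] := leP (m%:R * rd) k%:R.
  rewrite -addrA -[leLHS]addr0 lerD ?addr_ge0// ler_pdivlMr//.
  by rewrite -mulrA expr2 ler_wpM2l.
have [far2|near2] := leP (k%:R * rd) m%:R.
  rewrite [X in X + _]addrC -addrA -[leLHS]addr0 lerD ?addr_ge0// ler_pdivlMr//.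
  by rewrite mulrAC expr2 ler_wpM2r.
have k0 : (0 < k)%N.
  by rewrite lt0n; apply/eqP => k0; move: hv; rewrite k0 mul0r ltNge ltW.
have m0 : (0 < m)%N.
  by rewrite lt0n; apply/eqP => m0; move: hv; rewrite m0 mulr0 ltNge ltW.
pose i := trunc_log 2 k; pose j := trunc_log 2 m.
have iJ : (i < J)%N by exact: code_sqn_lt.
have jJ : (j < J)%N by exact: code_sqn_lt.
have ki : 2 ^+ i <= k%:R :> R by rewrite -natrX ler_nat trunc_logP.
have mj : 2 ^+ j <= m%:R :> R by rewrite -natrX ler_nat trunc_logP.
have ki' : k%:R < 2 ^+ i.+1 :> R by rewrite -natrX ltr_nat trunc_log_ltn.
have mj' : m%:R < 2 ^+ j.+1 :> R by rewrite -natrX ltr_nat trunc_log_ltn.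
have km : k%:R * m%:R < 4 * 2 ^+ (i + j) :> R.
  have -> : 4 * 2 ^+ (i + j) = 2 ^+ i.+1 * 2 ^+ j.+1 :> R by rewrite exprD !exprS; ring.
  by rewrite ltr_pM.
have two1 : 1 < 2 :> R by rewrite ltr1n.
have hmid : near_levels i j.
  apply/and3P; split.
  - rewrite -(ltr_eXn2l two1); apply: le_lt_trans D_le _; apply: lt_trans hv _.
    by apply: lt_le_trans km _; rewrite [in leRHS]exprD expr2 mulrC -natrM.
  - rewrite -ltnS -(ltr_eXn2l two1); apply: le_lt_trans ki _; apply: lt_trans near1 _.
    have -> : 2 ^+ (j + D + 1).+1 = 2 ^+ j.+1 * 2 ^+ D.+1 :> R.
      by rewrite -exprD addn1 addSn addnS.
    by rewrite ltr_pM // ltW.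
  - rewrite -ltnS -(ltr_eXn2l two1); apply: le_lt_trans mj _; apply: lt_trans near2 _.
    have -> : 2 ^+ (i + D + 1).+1 = 2 ^+ i.+1 * 2 ^+ D.+1 :> R.
      by rewrite -exprD addn1 addSn addnS.
    by rewrite ltr_pM // ltW.
rewrite -[leLHS]add0r lerD //; first by rewrite addr_ge0.
rewrite (bigD1 (Ordinal iJ)) //= (bigD1 (Ordinal jJ)) //=.
rewrite /level_set -/k -/m k0 m0 !eqxx mulr1 -addrA ler_wpDr//; last exact: ltW.
rewrite addr_ge0 //.
  by apply: sumr_ge0 => ? _; rewrite !mulr_ge0// exprn_ge0.
apply: sumr_ge0 => ? _; apply: sumr_ge0 => ? _.
by rewrite !mulr_ge0// exprn_ge0.
Qed.

Lemma sum_level_sets a : \sum_(i < J) 4 ^+ i * setn R (level_set a i) <= code_sqn R a.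
Proof.
rewrite /setn /code_sqn; under eq_bigr do rewrite mulr_sumr.
rewrite exchange_big; apply: ler_sum => x _; rewrite /level_set /=.
have [k0|k0] := posnP (a x).2.
  by rewrite big1 ?sqr_ge0// => i _; rewrite k0 mulr0.
have [iJ|iJ] := ltnP (trunc_log 2 (a x).2) J; last first.
  rewrite big1 ?sqr_ge0// => i _; case: eqP => [e|_]; last by rewrite mulr0.
  by move: (ltn_ord i); rewrite -e ltnNge iJ.
rewrite (bigD1 (Ordinal iJ)) //= eqxx mulr1 big1 ?addr0; last first.
  move=> i /negPf; rewrite -val_eqE /= => ne; rewrite eq_sym ne mulr0 //.
have -> : 4 = 2 ^+ 2 :> R by rewrite expr2 -natrM.
by rewrite exprAC lerXn2r ?nnegrE ?exprn_ge0// -natrX ler_nat trunc_logP.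
Qed.

(** 72 = 48 + 2 + 22: the elements give 3 * 16 n by [sum_level_sets], the fixed prices 2 n, and the
    M terms M 4^J / 3 <= 22 M n, which is where the levels must stop at 4^J <= 64 n. *)
Lemma sum_level_cost a : code_sqn R a <= 16 * n ->
  \sum_(j < J) 4 ^+ j / j.+1%:R * level_cost M j (level_set a j) <= 72 * (M * n).
Proof.
move=> ha.
have Mn : n <= M * n by rewrite ler_peMl // ltW.
apply: (@le_trans _ _ (3 * \sum_(j < J) 4 ^+ j * setn R (level_set a j) +
   n * \sum_(j < J) 2^-1 ^+ j + M * \sum_(j < J) 4 ^+ j)).
  rewrite !mulr_sumr -!big_split /=; apply: ler_sum => j _.
  rewrite /level_cost -/n !mulrDr !lerD //.
  - by rewrite natrM le_eqVlt; apply/orP; left; apply/eqP; field; rewrite ?nat1r ?natr1 pnatr_eq0.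
  - rewrite mulrCA ler_wpM2l ?(ltW n0)//.
    apply: (@le_trans _ _ (4 ^+ j * 2^-1 ^+ (3 * j))).
      apply: ler_pM; rewrite ?divr_ge0 ?exprn_ge0//.
        by rewrite ler_pdivrMr ?ltr0n// ler_peMr ?exprn_ge0// ler1n.
      by apply: ler_wiXn2l; rewrite ?invr_ge0// ?invf_le1 ?ler1n// leq_mul2l leqnSn orbT.
    rewrite exprM -exprMn; have -> : 4 * 2^-1 ^+ 3 = 2^-1 :> R by field.
    by [].
  by rewrite le_eqVlt; apply/orP; left; apply/eqP; field; rewrite ?nat1r ?natr1 pnatr_eq0.
have h1 := sum_level_sets a; have h2 := sum_half_pow R J; have h3 := sum_pow4 R J.
have h2' : n * \sum_(j < J) 2^-1 ^+ j <= n * 2 by rewrite ler_wpM2l // ltW.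
have h3' : M * \sum_(j < J) 4 ^+ j <= M * (22 * n).
  by rewrite ler_wpM2l ?(le_trans _ M1)//; move: J_le n0; lra.
have := J_le; lra.
Qed.

(** The two degree parts give 32 [deg_const] + 16, the 16 paying for the initial state, which is
    left at time 0 without having been entered. 16384 = 64 * 16 * 16 comes from the Poisson
    compensators, 9216 = 2 * 64 * 72 from the costs of the two level sets. *)
Definition heavy_const : R := 32 * deg_const c + 16 + 16384 / c ^+ 2 + 9216.

Lemma path_sum_heavy (s : nat -> S) a b :
  good_disc c l M J D s ->
  (forall u, (0 < (a u).2)%N -> visits R l u s <= deg_const c * d) ->
  (forall v, (0 < (b v).2)%N -> visits R l v s <= deg_const c * d) ->
  code_sqn R a <= 16 * n -> code_sqn R b <= 16 * n ->
  path_sum (heavy a b) l s <= heavy_const * M * n * rd.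
Proof.
move=> Hdisc dega degb ha hb.
have Mn : n <= M * n by rewrite ler_peMl // ltW.
have deg0 : 0 <= deg_const c.
  by rewrite /deg_const addr_ge0// divr_ge0// ltW.
have degree_part e : (forall u, (0 < (e u).2)%N -> visits R l u s <= deg_const c * d) ->
   code_sqn R e <= 16 * n ->
   path_sum (fun _ y => (e y).2%:R ^+ 2 / rd) l s <= 16 * deg_const c * n * rd.
  move=> dege he; rewrite path_sum_snd.
  apply: (@le_trans _ _ (\sum_v (e v).2%:R ^+ 2 * (deg_const c * rd))); last first.
    rewrite -mulr_suml; apply: (@le_trans _ _ (16 * n * (deg_const c * rd))).
      by rewrite ler_wpM2r// mulr_ge0// ltW.
    by rewrite le_eqVlt; apply/orP; left; apply/eqP; ring.
  apply: ler_sum => v _; have [->|v0] := posnP (e v).2.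
    by rewrite expr0n !mul0r.
  rewrite -mulrA ler_wpM2l ?sqr_ge0// mulrC ler_pdivrMr//.
  by rewrite -mulrA -expr2 rd2 dege.
have first_part : path_sum (fun x _ => (a x).2%:R ^+ 2 / rd) l s <=
    16 * n * rd + 16 * deg_const c * n * rd.
  apply: (le_trans (@path_sum_fst_le _ _ (fun x => (a x).2%:R ^+ 2 / rd) l s _)).
    by move=> x; rewrite divr_ge0 ?sqr_ge0// ltW.
  rewrite lerD ?degree_part//.
  apply: (@le_trans _ _ (16 * n)); last by rewrite ler_peMr// mulr_ge0// ltW.
  apply: (@le_trans _ _ ((a (s 0%N)).2%:R ^+ 2)).
    by rewrite ler_pdivrMr// ler_peMr ?sqr_ge0.
  apply: le_trans ha; rewrite /code_sqn (bigD1 (s 0%N)) //= lerDl.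
  by apply: sumr_ge0 => u _; exact: sqr_ge0.
have lc0 e i : 0 <= level_cost M i (level_set e i) :> R.
  rewrite /level_cost !addr_ge0// ?mulr_ge0 ?exprn_ge0 ?(le_trans _ M1)//.
  by apply: sumr_ge0 => x _.
have st0 e i : 0 <= setn R (level_set e i) by apply: sumr_ge0.
(* This is [good_disc] divided by m / 2 and weighted by 4 * 2^(i+j). In the compensator 2^m = 4 *
   2^(i+j) / 2^D and d / 2^D <= 2 sqrt d; there 1/m is simply bounded by 1, while in front of the
   costs it is kept. *)
have edge_part i j : (i < J)%N -> (j < J)%N -> near_levels i j ->
    4 * 2 ^+ (i + j) * edges R l (level_set a i) (level_set b j) s <=
    64 * rd / (c ^+ 2 * n) * (4 ^+ i * setn R (level_set a i)) * (4 ^+ j * setn R (level_set b j)) +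
    16 * (2 ^+ (i + j) / (i + j + 2 - D)%:R) * level_cost M i (level_set a i) +
    16 * (2 ^+ (i + j) / (i + j + 2 - D)%:R) * level_cost M j (level_set b j).
  move=> iJ jJ /and3P[Dij _ _]; have := Hdisc i j (level_set a i) (level_set b j) iJ jJ.
  rewrite -/d -/n.
  set e := edges _ _ _ _ _; set ca := level_cost _ _ _; set cb := level_cost _ _ _.
  set A := setn _ _; set B := setn _ _.
  have m1 : 1 <= (i + j + 2 - D)%:R :> R by rewrite ler1n subn_gt0.
  have mE : 2 ^+ (i + j + 2 - D) = 4 * 2 ^+ (i + j) / 2 ^+ D :> R.
    have -> : 4 = 2 ^+ 2 :> R by rewrite expr2 -natrM.
    by rewrite -exprD (addnC 2%N) expfB.
  move: m1; rewrite mE; set m := (i + j + 2 - D)%:R => m1.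
  have m0 : 0 < m by rewrite (lt_le_trans _ m1).
  have -> : (4 : R) ^+ i * A = (2 ^+ i) ^+ 2 * A by rewrite exprAC expr2 -natrM.
  have -> : (4 : R) ^+ j * B = (2 ^+ j) ^+ 2 * B by rewrite (exprAC _ j) expr2 -natrM.
  rewrite exprD; set pi := 2 ^+ i; set pj := 2 ^+ j => h.
  have pi0 : 0 < pi by rewrite exprn_gt0. 
  have pj0 : 0 < pj by rewrite exprn_gt0.
  have pD0 : 0 < (2 : R) ^+ D by rewrite exprn_gt0.
  have {}h : e <= (2 / m) * (4 * (pi * pj) / 2 ^+ D * A * B * d / (c ^+ 2 * n)) + (4 / m) * (ca + cb).
    rewrite -(ler_pM2l (_ : 0 < m / 2)) ?divr_gt0//.
    apply: le_trans h _; rewrite le_eqVlt; apply/orP; left; apply/eqP; field.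
    by rewrite !gt_eqF// exprn_gt0.
  apply: le_trans (ler_wpM2l _ h) _; first by rewrite !mulr_ge0 ?ltW.
  rewrite [leLHS]mulrDr -[leRHS]addrA lerD//; last first.
    by rewrite le_eqVlt; apply/orP; left; apply/eqP; field; rewrite gt_eqF.
  have AB0 : 0 <= A * B by apply: mulr_ge0; exact: st0.
  set Z := pi ^+ 2 * pj ^+ 2 * (A * B) / (c ^+ 2 * n).
  have Z0 : 0 <= Z.
    by apply: divr_ge0; [rewrite mulr_ge0 // mulr_ge0 ?sqr_ge0|rewrite mulr_ge0 ?sqr_ge0// ltW].
  have -> : 4 * (pi * pj) * (2 / m * (4 * (pi * pj) / 2 ^+ D * A * B * d / (c ^+ 2 * n))) =
     (d / 2 ^+ D) * (32 * Z * m^-1).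
    by rewrite /Z; field; rewrite !gt_eqF// exprn_gt0.
  have -> : 64 * rd / (c ^+ 2 * n) * (pi ^+ 2 * A) * (pj ^+ 2 * B) = (2 * rd) * (32 * Z).
    by rewrite /Z; field; rewrite !gt_eqF// exprn_gt0.
  have dD : d / 2 ^+ D <= 2 * rd.
    rewrite ler_pdivrMr// -rd2 expr2 mulrAC ler_wpM2r ?(ltW rd0)//.
    by rewrite -exprS ltW.
  apply: ler_pM => //.
  - by rewrite divr_ge0 ?ltW.
  - by apply: mulr_ge0; [exact: mulr_ge0|rewrite invr_ge0 ltW].
  by rewrite ler_piMr ?(mulr_ge0 _ Z0)// invf_le1.
have level_sum e : code_sqn R e <= 16 * n ->
   \sum_(j < J) (\sum_(i < J | near_levels i j) 16 * (2 ^+ (i + j) / (i + j + 2 - D)%:R)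
      * level_cost M j (level_set e j)) <= 4608 * M * n * rd.
  move=> he; apply: (@le_trans _ _ (\sum_(j < J) 64 * rd * (4 ^+ j / j.+1%:R * level_cost M j (level_set e j)))).
    apply: ler_sum => j _; rewrite -mulr_suml -mulr_sumr mulrA mulrA ler_wpM2r//.
    apply: (@le_trans _ _ (16 * (4 * 2 ^+ D * 4 ^+ j / j.+1%:R))).
      rewrite ler_wpM2l//; apply: le_trans (sum_level_weights R J D j).
      rewrite [leRHS](bigID (fun i : 'I_J => (j <= i + D + 1)%N)) /= -[leLHS]addr0 lerD//.
        by rewrite le_eqVlt; apply/orP; left; apply/eqP; apply: eq_bigl => i; rewrite /near_levels andbA.
      by apply: sumr_ge0 => i _; rewrite divr_ge0 ?exprn_ge0.
    have j0 : 0 <= (4 : R) ^+ j / j.+1%:R by rewrite divr_ge0 ?exprn_ge0.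
    have -> : 16 * (4 * 2 ^+ D * 4 ^+ j / j.+1%:R) = 2 ^+ D * (64 * (4 ^+ j / j.+1%:R)) :> R.
      by ring.
    have -> : 64 * rd * 4 ^+ j / j.+1%:R = rd * (64 * (4 ^+ j / j.+1%:R)) :> R by ring.
    by rewrite ler_wpM2r// mulr_ge0.
  rewrite -mulr_sumr; have := sum_level_cost he.
  move=> h; apply: le_trans (ler_wpM2l _ h) _; first by rewrite mulr_ge0// ltW.
  by rewrite le_eqVlt; apply/orP; left; apply/eqP; ring.
have mid_sym i j : near_levels i j = near_levels j i by rewrite /near_levels (addnC i j) [in LHS](andbC (i <= _)%N).
have main_part : \sum_(i < J) \sum_(j < J | near_levels i j)
   4 * 2 ^+ (i + j) * edges R l (level_set a i) (level_set b j) s <=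
   16384 / c ^+ 2 * n * rd + 4608 * M * n * rd + 4608 * M * n * rd.
  apply: (@le_trans _ _ (\sum_(i < J) \sum_(j < J | near_levels i j)
    (64 * rd / (c ^+ 2 * n) * (4 ^+ i * setn R (level_set a i)) * (4 ^+ j * setn R (level_set b j)) +
    16 * (2 ^+ (i + j) / (i + j + 2 - D)%:R) * level_cost M i (level_set a i) +
    16 * (2 ^+ (i + j) / (i + j + 2 - D)%:R) * level_cost M j (level_set b j)))).
    by apply: ler_sum => i _; apply: ler_sum => j ij; exact: edge_part.
  under eq_bigr do rewrite !big_split /=.
  rewrite !big_split /= !lerD //.
  - apply: (@le_trans _ _ (\sum_(i < J) \sum_(j < J)
       64 * rd / (c ^+ 2 * n) * (4 ^+ i * setn R (level_set a i)) * (4 ^+ j * setn R (level_set b j)))).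
      apply: ler_sum => i _; rewrite [leRHS](bigID (fun j : 'I_J => near_levels i j)) /= lerDl.
      apply: sumr_ge0 => j _; rewrite !mulr_ge0 ?exprn_ge0 ?invr_ge0 ?(ltW rd0)//.
      by rewrite mulr_ge0 ?sqr_ge0// ltW.
    under eq_bigr do rewrite -mulr_sumr.
    rewrite -mulr_suml -mulr_sumr -mulrA.
    apply: (@le_trans _ _ (64 * rd / (c ^+ 2 * n) * ((16 * n) * (16 * n)))).
      apply: ler_wpM2l.
        apply: divr_ge0; last exact: mulr_ge0 (sqr_ge0 c) (ltW n0).
        by rewrite mulr_ge0 // ltW.
      have s0 e : 0 <= \sum_(i < J) 4 ^+ i * setn R (level_set e i).
        by apply: sumr_ge0 => i _; rewrite mulr_ge0 ?exprn_ge0.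
      apply: ler_pM; [exact: s0|exact: s0| |].
        exact: le_trans (sum_level_sets a) ha.
      exact: le_trans (sum_level_sets b) hb.
    by rewrite le_eqVlt; apply/orP; left; apply/eqP; field; rewrite !gt_eqF.
  - apply: le_trans (level_sum _ ha); rewrite le_eqVlt; apply/orP; left; apply/eqP.
    apply: eq_bigr => i _; apply: eq_big => [j|j _]; first exact: mid_sym.
    by rewrite (addnC i j).
  apply: le_trans (level_sum _ hb); rewrite le_eqVlt; apply/orP; left; apply/eqP.
  by rewrite (exchange_big_dep predT).
apply: (@le_trans _ _ (path_sum (fun x y => (a x).2%:R ^+ 2 / rd + (b y).2%:R ^+ 2 / rd +
    \sum_(i < J) \sum_(j < J | near_levels i j) 4 * 2 ^+ (i + j) * (level_set a i x && level_set b j y)%:R) l s)).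
  by apply: le_path_sum => x y; exact: heavy_le.
rewrite !path_sumD path_sum_sum.
have h2 := degree_part _ degb hb.
have h3 : \sum_(i < J) path_sum (fun x y => \sum_(j < J | near_levels i j)
     4 * 2 ^+ (i + j) * (level_set a i x && level_set b j y)%:R) l s <=
   16384 / c ^+ 2 * n * rd + 4608 * M * n * rd + 4608 * M * n * rd.
  apply: le_trans main_part; rewrite le_eqVlt; apply/orP; left; apply/eqP.
  apply: eq_bigr => i _; rewrite path_sum_sum; apply: eq_bigr => j _.
  by rewrite path_sumZ.
apply: (@le_trans _ _ ((32 * deg_const c + 16 + 16384 / c ^+ 2) * (n * rd) + 9216 * (M * n * rd))).
  move: first_part h2 h3; lra.
have -> : heavy_const * M * n * rd = (32 * deg_const c + 16 + 16384 / c ^+ 2) * (M * n * rd)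
   + 9216 * (M * n * rd) by rewrite /heavy_const; ring.
have const0 : 0 <= 32 * deg_const c + 16 + 16384 / c ^+ 2.
  apply: addr_ge0; first by rewrite addr_ge0 // mulr_ge0.
  by apply: divr_ge0; [exact: ler0n|exact: sqr_ge0].
apply: lerD; last exact: lexx.
by apply: (ler_wpM2l const0); apply: (ler_wpM2r (ltW rd0)).
Qed.

End Heavy.

(** * The spectral norm of the trimmed noise *)

Lemma exists_top_level (R : realType) (N : nat) : (0 < N)%N ->
  exists J, (forall k : nat, (k ^ 2 <= 16 * N)%N -> (trunc_log 2 k < J)%N) /\
    4 ^+ J <= 64 * N%:R :> R.
Proof.
move=> N0; exists (trunc_log 4 (16 * N)).+1; split=> [k kN|].
  have [->|k0] := posnP k; first by rewrite trunc_log0.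
  rewrite ltnS; apply: trunc_log_max => //; apply: leq_trans kN.
  rewrite -[4%N]/(2 ^ 2)%N expnAC leq_exp2r //; exact: trunc_logP.
rewrite -natrX -natrM ler_nat expnS (_ : 64 = 4 * 16)%N // -mulnA leq_mul2l.
by rewrite trunc_logP // muln_gt0.
Qed.

Lemma exists_log2 (R : realType) (r : R) : 1 <= r ->
  exists D : nat, 2 ^+ D <= r /\ r < 2 ^+ D.+1.
Proof.
move=> r1; exists (trunc_log 2 (Num.truncn r)).
have /andP[h1 h2] := truncn_itv (le_trans ler01 r1).
have t0 : (0 < Num.truncn r)%N by rewrite truncn_gt0.
split; first by apply: le_trans h1; rewrite -natrX ler_nat trunc_logP.
by apply: lt_le_trans h2 _; rewrite -natrX ler_nat trunc_log_ltn.
Qed.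

Section Bilinear.
Variables (R : realType) (S K : finType) (sigma : S -> K) (p : K -> K -> R).
Variables (c : R) (l : nat) (M : R) (J D : nat).
Hypothesis c0 : 0 < c.
Hypothesis S0 : (0 < #|S|)%N.
Hypothesis block_size_ge : forall k, c * #|S|%:R <= block_size R sigma k.
Let n : R := #|S|%:R.
Let d := density R S l.
Let rd := Num.sqrt d.
Hypothesis d4 : 4 <= d.
Hypothesis M1 : 1 <= M.
Hypothesis D_le : 2 ^+ D <= rd.
Hypothesis D_gt : rd < 2 ^+ D.+1.
Hypothesis J_gt : forall k : nat, (k ^ 2 <= 16 * #|S|)%N -> (trunc_log 2 k < J)%N.
Hypothesis J_le : 4 ^+ J <= 64 * n.
Variable s : nat -> S.
Hypothesis Hs : good_path sigma p c l M J D s.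
Implicit Types (a b : S -> bool * nat) (f : S -> S -> R).

Definition counts u v : R := path_sum (fun x y => ((x == u) && (y == v))%:R) l s.
Definition block_counts k m : R :=
  path_sum (fun x y => ((sigma x == k) && (sigma y == m))%:R) l s.
Definition block_visits k : R := path_sum (fun x _ => (sigma x == k)%:R) l s.
Definition model u v : R :=
  block_visits (sigma u) * p (sigma u) (sigma v) /
    (block_size R sigma (sigma u) * block_size R sigma (sigma v)).

Let n0 : 0 < n. Proof. by rewrite ltr0n. Qed.
Let d0 : 0 < d. Proof. by rewrite (lt_le_trans _ d4). Qed.
Let rd2 : rd ^+ 2 = d. Proof. by rewrite sqr_sqrtr // ltW. Qed.
Let rd0 : 0 < rd. Proof. by rewrite sqrtr_gt0. Qed.
Let ld : l%:R = d * n. Proof. by rewrite /d /density divfK // gt_eqF. Qed.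

(** Averaging over pairs of blocks is self-adjoint, so it moves from f to the counts. *)
Lemma path_sum_block_avg f :
  path_sum (fun x y => block_avg sigma f (sigma x) (sigma y)) l s =
  \sum_u \sum_v f u v * (block_counts (sigma u) (sigma v) /
    (block_size R sigma (sigma u) * block_size R sigma (sigma v))).
Proof.
rewrite -[LHS]/(path_sum (block_avg sigma f) l (fun t => sigma (s t))) path_sum_pairs.
rewrite [RHS](partition_big sigma predT) //=; apply: eq_bigr => k _.
rewrite (eq_bigr (fun u => \sum_m \sum_(v | sigma v == m) f u v * (block_counts k m /
    (block_size R sigma k * block_size R sigma m)))); last first.
  move=> u /eqP uk; rewrite [LHS](partition_big sigma predT) //=; apply: eq_bigr => m _.
  by apply: eq_bigr => v /eqP vm; rewrite uk vm.
rewrite exchange_big /=; apply: eq_bigr => m _.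
under [RHS]eq_bigr do rewrite -mulr_suml.
by rewrite -mulr_suml /block_avg mulrAC mulrA.
Qed.

Lemma centered_counts f :
  path_sum (centered sigma f) l s = \sum_u \sum_v f u v * (counts u v -
    block_counts (sigma u) (sigma v) / (block_size R sigma (sigma u) * block_size R sigma (sigma v))).
Proof.
have -> : path_sum (centered sigma f) l s = path_sum f l s -
    path_sum (fun x y => block_avg sigma f (sigma x) (sigma y)) l s by exact: sumrB.
rewrite path_sum_block_avg path_sum_pairs -sumrB; apply: eq_bigr => u _.
by rewrite -sumrB; apply: eq_bigr => v _; rewrite mulrBr.
Qed.

(** Heavy pairs need no cancellation: counts and averages are bounded separately. A product t > sqrt
    d is at most t^2 / sqrt d, so the averages are of order 1 / sqrt d, and they are summed over ell
    = d n steps. *)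
Lemma centered_heavy_le a b :
  (forall u, (0 < (a u).2)%N -> visits R l u s <= deg_const c * d) ->
  (forall v, (0 < (b v).2)%N -> visits R l v s <= deg_const c * d) ->
  code_sqn R a <= 16 * n -> code_sqn R b <= 16 * n ->
  path_sum (centered sigma (fun x y => code_prod R a b x y * (~~ is_light R l a b x y)%:R)) l s
  <= heavy_const c * M * n * rd + 256 / c ^+ 2 * n * rd.
Proof.
move=> dega degb ha hb.
set f : S -> S -> R := fun x y => code_prod R a b x y * (~~ is_light R l a b x y)%:R.
have fh x y : `|f x y| <= heavy R l a b x y.
  have cp : `|code_prod R a b x y| = (a x).2%:R * (b y).2%:R.
    by rewrite /code_prod normrM !normr_sgnat.
  by rewrite /f /heavy normrM cp normr_nat.
have heavy_sum : \sum_x \sum_y heavy R l a b x y <= (16 * n) ^+ 2 / rd.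
  apply: (@le_trans _ _ (\sum_x \sum_y ((a x).2%:R ^+ 2 * (b y).2%:R ^+ 2 / rd))).
    apply: ler_sum => x _; apply: ler_sum => y _; rewrite /heavy.
    have [_|] := boolP (is_light R l a b x y).
      by rewrite mulr0 divr_ge0 ?mulr_ge0 ?sqr_ge0// ltW.
    rewrite /is_light -/d -/rd -ltNge mulr1 ler_pdivlMr// => hv.
    by rewrite -exprMn expr2 ler_wpM2l // ltW.
  have -> : \sum_x \sum_y ((a x).2%:R ^+ 2 * (b y).2%:R ^+ 2 / rd) =
     code_sqn R a * code_sqn R b / rd.
    rewrite -mulrA mulr_suml; apply: eq_bigr => x _.
    by rewrite mulr_suml mulr_sumr; apply: eq_bigr => y _; rewrite mulrA.
  have sq0 e : 0 <= code_sqn R e by apply: sumr_ge0 => u _; exact: sqr_ge0.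
  by rewrite ler_pM2r ?invr_gt0// expr2 ler_pM.
have avg_f k m : - block_avg sigma f k m <= 256 / (c ^+ 2 * rd).
  have b0 := block_size_gt0 c0 S0 block_size_ge.
  have bb := block_size2_ge c0 block_size_ge k m.
  rewrite /block_avg -mulNr ler_pdivrMr ?mulr_gt0//.
  apply: (@le_trans _ _ ((16 * n) ^+ 2 / rd)).
    apply: le_trans heavy_sum; rewrite -sumrN.
    apply: (@le_trans _ _ (\sum_(x | sigma x == k) \sum_(y | sigma y == m) heavy R l a b x y)).
      apply: ler_sum => x _; rewrite -sumrN; apply: ler_sum => y _.
      by rewrite (le_trans _ (fh x y))// -normrN ler_norm.
    by apply: sum_block_le => x y; rewrite (le_trans _ (fh x y)).
  have -> : (16 * n) ^+ 2 / rd = 256 / (c ^+ 2 * rd) * (c * n) ^+ 2.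
    by field; rewrite !gt_eqF.
  by apply: ler_wpM2l => //; apply: divr_ge0; rewrite ?ler0n// mulr_ge0 ?sqr_ge0// ltW.
have -> : path_sum (centered sigma f) l s = path_sum f l s +
    path_sum (fun x y => - block_avg sigma f (sigma x) (sigma y)) l s by rewrite -path_sumD.
apply: lerD.
  apply: (@le_trans _ _ (path_sum (heavy R l a b) l s)).
    by apply: le_path_sum => x y; rewrite (le_trans _ (fh x y))// ler_norm.
  have [_ hd _ _] := Hs.
  exact: (path_sum_heavy c0 S0 d4 M1 D_le D_gt J_gt J_le hd dega degb ha hb).
apply: (@le_trans _ _ (path_sum (fun _ _ => 256 / (c ^+ 2 * rd)) l s)).
  by apply: le_path_sum.
rewrite path_sum_const ld -rd2 le_eqVlt; apply/orP; left; apply/eqP; field.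
by rewrite !gt_eqF.
Qed.

Lemma sum_code_le a : code_sqn R a <= 16 * n -> \sum_u (a u).2%:R <= 16 * n.
Proof.
apply: le_trans; apply: ler_sum => u _; rewrite -natrX ler_nat.
by case: (a u).2 => // k; rewrite expnS leq_pmulr // expn_gt0.
Qed.

(** Centring used the observed transitions between blocks; [good_transitions] replaces them by
    visits times p, whose rank is controlled. 768 = 3 * 16^2, and with the 256 of the heavy averages
    it makes the 1024 in [noise_const]. *)
Lemma model_error_le a b : code_sqn R a <= 16 * n -> code_sqn R b <= 16 * n ->
  \sum_u \sum_v code_prod R a b u v * (block_counts (sigma u) (sigma v) /
    (block_size R sigma (sigma u) * block_size R sigma (sigma v)) - model u v)
  <= 768 / c ^+ 2 * M * n * rd.
Proof.
move=> ha hb; have [_ _ _ ht] := Hs.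
have b0 := block_size_gt0 c0 S0 block_size_ge.
have err u v : `|block_counts (sigma u) (sigma v) / (block_size R sigma (sigma u) * block_size R sigma (sigma v))
   - model u v| <= 3 * M * n * rd / (c * n) ^+ 2.
  rewrite /model -mulrBl normrM normfV (gtr0_norm (mulr_gt0 (b0 _) (b0 _))).
  apply: ler_pM => //; rewrite ?invr_ge0 ?mulr_ge0 ?(ltW (b0 _))//.
    have := ht (sigma u) (sigma v); apply: le_trans.
    rewrite le_eqVlt; apply/orP; left; apply/eqP; congr `|_|.
    rewrite /block_counts /block_visits (mulrC (path_sum _ _ _)) -path_sumZ -sumrB.
    by apply: eq_bigr => t _; rewrite -mulnb natrM; ring.
  rewrite lef_pV2 ?posrE ?mulr_gt0// ?exprn_gt0 ?mulr_gt0//.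
  exact: block_size2_ge.
apply: (@le_trans _ _ (\sum_u \sum_v (a u).2%:R * (b v).2%:R * (3 * M * n * rd / (c * n) ^+ 2))).
  apply: ler_sum => u _; apply: ler_sum => v _; apply: le_trans (ler_norm _) _.
  by rewrite normrM /code_prod normrM !normr_sgnat ler_wpM2l.
under eq_bigr do rewrite -mulr_suml -mulr_sumr.
rewrite -mulr_suml -mulr_suml.
apply: (@le_trans _ _ ((16 * n) * (16 * n) * (3 * M * n * rd / (c * n) ^+ 2))).
  apply: ler_wpM2r.
    by rewrite divr_ge0 ?sqr_ge0// !mulr_ge0 ?(le_trans _ M1)// ltW.
  by apply: ler_pM; rewrite ?sum_code_le// sumr_ge0.
rewrite le_eqVlt; apply/orP; left; apply/eqP; field.
by rewrite !gt_eqF.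
Qed.

Definition noise_const : R := light_const c + heavy_const c + 1024 / c ^+ 2.

Lemma bilinear_noise a b :
  (forall u, (0 < (a u).2)%N -> visits R l u s <= deg_const c * d) ->
  (forall v, (0 < (b v).2)%N -> visits R l v s <= deg_const c * d) ->
  code_sqn R a <= 16 * n -> code_sqn R b <= 16 * n ->
  \sum_u \sum_v code_prod R a b u v * (counts u v - model u v) <= noise_const * M * n * rd.
Proof.
move=> dega degb ha hb; have [hl _ _ _] := Hs.
have h1 := hl a b ha hb; have h2 := centered_heavy_le dega degb ha hb.
have h3 := model_error_le ha hb.
have -> : \sum_u \sum_v code_prod R a b u v * (counts u v - model u v) =
  path_sum (centered sigma (light_part R l a b)) l s +
  path_sum (centered sigma (fun x y => code_prod R a b x y * (~~ is_light R l a b x y)%:R)) l s +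
  \sum_u \sum_v code_prod R a b u v * (block_counts (sigma u) (sigma v) /
    (block_size R sigma (sigma u) * block_size R sigma (sigma v)) - model u v).
  rewrite !centered_counts -!big_split; apply: eq_bigr => u _ /=.
  rewrite -!big_split; apply: eq_bigr => v _ /=; rewrite /light_part.
  by case: (is_light _ _ _ _ _ _) => /=; ring.
have Mn : 256 / c ^+ 2 * n * rd <= 256 / c ^+ 2 * M * n * rd.
  have i0 : 0 <= 256 / c ^+ 2 by apply: divr_ge0; [exact: ler0n|exact: sqr_ge0].
  rewrite ler_wpM2r ?(ltW rd0)// ler_wpM2r ?(ltW n0)//.
  by rewrite ler_peMr.
have -> : noise_const * M * n * rd = light_const c * M * n * rd + heavy_const c * M * n * rd +
   256 / c ^+ 2 * M * n * rd + 768 / c ^+ 2 * M * n * rd by rewrite /noise_const; ring.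
apply: le_trans (lerD (lerD h1 h2) h3) _.
by rewrite addrA; apply: lerD; [apply: lerD; [exact: lexx|exact: Mn]|exact: lexx].
Qed.

End Bilinear.

(** * The low-rank part *)

Section LinearAlgebra.
Variable R : realType.

Lemma positive_lower_bound (I : finType) (f : I -> R) : (forall i, 0 < f i) ->
  exists2 c : R, 0 < c & forall i, c <= f i.
Proof.
move=> f0; have s0 : 0 <= \sum_i (f i)^-1 by apply: sumr_ge0 => i _; rewrite invr_ge0 ltW.
(* This witness, unlike a minimum, also exists for an empty index type. *)
exists (1 + \sum_i (f i)^-1)^-1 => [|i]; first by rewrite invr_gt0; lra.
rewrite -[leRHS]invrK lef_pV2 ?posrE ?invr_gt0//; last by lra.
rewrite (bigD1 i) //= addrCA lerDl addr_ge0//.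
by apply: sumr_ge0 => j _; rewrite invr_ge0 ltW.
Qed.

Lemma sqn_mul_bounded m n (A : 'M[R]_(m, n)) :
  exists2 kap : R, 0 < kap & forall x : 'cV_n, sqn (A *m x) <= kap * sqn x.
Proof.
have k0 : 0 <= \sum_i (\sum_j `|A i j|) ^+ 2 by apply: sumr_ge0 => i _; exact: sqr_ge0.
exists (1 + \sum_i (\sum_j `|A i j|) ^+ 2) => [|x]; first by lra.
rewrite mulrDl mul1r -[leLHS]add0r lerD ?sqn_ge0// mulr_suml; apply: ler_sum => i _.
have sx0 := sqn_ge0 x.
rewrite -[sqn x]sqr_sqrtr// -exprMn -(real_normK (num_real ((A *m x) i ord0))).
rewrite lerXn2r ?nnegrE ?mulr_ge0 ?sumr_ge0 ?sqrtr_ge0// mxE.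
apply: le_trans (ler_norm_sum _ _ _) _; rewrite mulr_suml; apply: ler_sum => j _.
rewrite normrM ler_wpM2l// -sqrtr_sqr ler_sqrt//.
by rewrite /sqn (bigD1 j) //= lerDl; apply: sumr_ge0 => k _; exact: sqr_ge0.
Qed.

Lemma sqnB_le n (x y : 'cV[R]_n) : sqn (x - y) <= 2 * sqn x + 2 * sqn y.
Proof.
rewrite /sqn !mulr_sumr -big_split; apply: ler_sum => i _; rewrite !mxE /=.
by have := sqr_ge0 (x i ord0 + y i ord0); rewrite sqrrD sqrrB; lra.
Qed.

(** A further factor p adds eta once and multiplies the accumulated error by at most the sum of the
    entries of p; hence C depends on p and t only. *)
Lemma approx_stationary_iter (K : nat) (p : 'M[R]_K) (t : nat) : (forall i j, 0 <= p i j) ->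
  exists2 C : R, 0 <= C & forall (b : 'I_K -> R) (eta : R), 0 <= eta ->
    (forall m, \sum_k b k * p k m <= b m + eta) ->
    forall m, \sum_k b k * (p ^+ t) k m <= b m + C * eta.
Proof.
move=> p0; elim: t => [|t [C C0 IH]].
  exists 0 => // b eta _ _ m; rewrite mul0r addr0 expr0 (bigD1 m) //= big1 => [|k km].
    by rewrite mxE eqxx mulr1 addr0.
  by rewrite mxE (negbTE km) mulr0.
have s0 m : \sum_j p j m <= \sum_i \sum_j p j i.
  by rewrite [leRHS](bigD1 m) //= lerDl; apply: sumr_ge0 => i _; exact: sumr_ge0.
exists (1 + C * \sum_i \sum_j p j i) => [|b eta e0 hb m].
  by rewrite addr_ge0// mulr_ge0//; apply: sumr_ge0 => i _; exact: sumr_ge0.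
have {}IH := IH b eta e0 hb.
have -> : \sum_k b k * (p ^+ t.+1) k m = \sum_j (\sum_k b k * (p ^+ t) k j) * p j m.
  rewrite (eq_bigr (fun k => \sum_j b k * (p ^+ t) k j * p j m)) => [|k _].
    by rewrite exchange_big; apply: eq_bigr => j _ /=; rewrite mulr_suml.
  by rewrite exprSr mxE mulr_sumr; apply: eq_bigr => j _; rewrite mulrA.
apply: (@le_trans _ _ (\sum_j (b j * p j m + C * eta * p j m))).
  by apply: ler_sum => j _; rewrite -mulrDl ler_wpM2r.
rewrite big_split /= -mulr_sumr; apply: le_trans (lerD (hb m) (lexx _)) _.
rewrite -addrA lerD2l mulrDl mul1r lerD2l mulrAC ler_wpM2r// ler_wpM2l//.
Qed.

(** Iterating b p <= b + eta until (p^t)_km > 0 gives (p^t)_km b_k <= b_m + C eta, so no coordinate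
    is small compared with the total. Applied to visit counts, this replaces an ergodic theorem. *)
Lemma approx_stationary_lower (K : nat) (p : 'M[R]_K) :
  (forall i j, 0 <= p i j) -> is_irreducible p ->
  exists c1 C : R, [/\ 0 < c1, 0 < C & forall (b : 'I_K -> R) (eta : R), 0 <= eta ->
    (forall k, 0 <= b k) ->
    (forall m, \sum_k b k * p k m <= b m + eta) ->
    forall m, c1 * \sum_k b k <= b m + C * eta].
Proof.
move=> p0 irr.
have pt0 u i j : 0 <= (p ^+ u) i j.
  elim: u i j => [|u IH] i j; first by rewrite expr0 mxE.
  by rewrite exprSr mxE; apply: sumr_ge0 => k _; rewrite mulr_ge0.
have [t ht] : exists t : 'I_K -> 'I_K -> nat, forall k m, 0 < (p ^+ t k m) k m.
  exists (fun k m => sval (cid (irr k m))) => k m; exact: svalP (cid (irr k m)).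
have hC k m := approx_stationary_iter (t k m) p0.
pose C k m := s2val (cid2 (hC k m)).
have C0 k m : 0 <= C k m := s2valP (cid2 (hC k m)).
have CP k m := s2valP' (cid2 (hC k m)).
have [c cpos cP] := positive_lower_bound (fun km : 'I_K * 'I_K => ht km.1 km.2).
pose Ct : R := 1 + \sum_k \sum_m C k m.
have Ct0 : 0 < Ct.
  by rewrite ltr_pwDl//; apply: sumr_ge0 => k _; exact: sumr_ge0.
have CCt k m : C k m <= Ct.
  apply: (@le_trans _ _ (\sum_k \sum_m C k m)); last by rewrite lerDr.
  rewrite (bigD1 k) //= (bigD1 m) //= -addrA lerDl addr_ge0//; first exact: sumr_ge0.
  by apply: sumr_ge0 => i _; exact: sumr_ge0.
pose Kn : R := K%:R + 1.
have Kn0 : 0 < Kn by rewrite ltr_pwDr.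
exists (c / Kn), Ct; split => // [|b eta e0 b0 hb m]; first exact: divr_gt0.
have bound k : c * b k <= b m + Ct * eta.
  apply: (@le_trans _ _ (b m + C k m * eta)); last by rewrite lerD2l ler_wpM2r.
  apply: le_trans (CP k m b eta e0 hb m).
  rewrite (bigD1 k) //= mulrC -[leLHS]addr0 lerD ?ler_wpM2l ?(cP (k, m))//.
  by apply: sumr_ge0 => j _; rewrite mulr_ge0.
rewrite mulrAC ler_pdivrMr// mulr_sumr.
apply: (@le_trans _ _ (\sum_(k < K) (b m + Ct * eta))); first by apply: ler_sum => k _.
rewrite sumr_const card_ord -mulr_natr ler_wpM2l//; last by rewrite lerDl.
by rewrite addr_ge0// mulr_ge0// ltW.
Qed.

End LinearAlgebra.

(** * Trimming and the two bounds on the estimator *)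

Section Trimmed.
Variables (R : realType) (N K : nat) (sigma : 'I_N -> 'I_K) (p : 'M[R]_K).
Variables (c : R) (l : nat) (M : R) (J D : nat).
Hypothesis c0 : 0 < c.
Hypothesis S0 : (0 < N)%N.
Hypothesis block_size_ge : forall k, c * N%:R <= block_size R sigma k.
Let n : R := N%:R.
Let d : R := l%:R / n.
Let rd := Num.sqrt d.
Hypothesis d4 : 4 <= d.
Hypothesis M1 : 1 <= M.
Hypothesis D_le : 2 ^+ D <= rd.
Hypothesis D_gt : rd < 2 ^+ D.+1.
Hypothesis J_gt : forall k : nat, (k ^ 2 <= 16 * N)%N -> (trunc_log 2 k < J)%N.
Hypothesis J_le : 4 ^+ J <= 64 * n.
Variable s : nat -> 'I_N.
Hypothesis Hs : good_path sigma (fun k m => p k m) c l M J D s.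
Variable G : {set 'I_N}.
Hypothesis HG : is_most_visited (trim_size R N l) (count_matrix R l s) G.

Let n0 : 0 < n. Proof. by rewrite ltr0n. Qed.
Let d0 : 0 < d. Proof. by rewrite (lt_le_trans _ d4). Qed.
Let rd0 : 0 < rd. Proof. by rewrite sqrtr_gt0. Qed.
Let card_N : #|'I_N| = N. Proof. exact: card_ord. Qed.
Let densE : density R 'I_N l = d. Proof. by rewrite /density card_ord. Qed.

Let A := trim G (count_matrix R l s).
Let mdl : 'M[R]_N := \matrix_(u, v) model sigma (fun k m => p k m) l s u v.
Let B := trim G mdl.

Lemma count_matrixE u v : count_matrix R l s u v = counts R l s u v.
Proof. by rewrite mxE natr_sum. Qed.

Lemma col_sum_count v : \sum_u count_matrix R l s u v = visits R l v s.
Proof.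
under eq_bigr do rewrite count_matrixE.
rewrite /counts -path_sum_sum; apply: eq_bigr => t _.
rewrite (bigD1 (s t)) //= eqxx big1 ?addr0// => u /negPf un.
by rewrite eq_sym un.
Qed.

(** States in G are visited at least as often as v. If v had high degree, v and G together would
    give |G| + 1 such states, more than n exp (-d): the 1 beats the rounding down in [trim_size]. *)
Lemma visits_untrimmed v : v \notin G -> visits R l v s <= deg_const c * d.
Proof.
have [cG hG] := HG; have [_ _ hdeg _] := Hs; move=> vG.
rewrite leNgt; apply/negP => lt.
move: hdeg; rewrite /good_degrees card_N densE; apply/negP; rewrite -ltNge.
have le_vis u : u \in v |: G -> deg_const c * d <= visits R l u s.
  rewrite !inE => /predU1P[->|uG]; first exact: ltW.
  by have := hG _ _ uG vG; rewrite !col_sum_count; apply: le_trans; exact: ltW.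
apply: (@lt_le_trans _ _ #|v |: G|%:R).
  rewrite cardsU1 vG cG add1n.
  have h : 0 <= n * expR (- d) by rewrite mulr_ge0 ?expR_ge0// ltW.
  by have /andP[_] := truncn_itv h.
rewrite -sum1_card natr_sum big_mkcond /=; apply: ler_sum => u _.
by case: ifP => // uG; rewrite le_vis.
Qed.

Lemma card_trimmed : #|G|%:R <= n * expR (- d).
Proof.
have [-> _] := HG.
have h : 0 <= n * expR (- d) by rewrite mulr_ge0 ?expR_ge0// ltW.
by have /andP[] := truncn_itv h.
Qed.

Lemma noise_bound (x : 'cV[R]_N) :
  sqn ((A - B) *m x) <= (noise_const c * M * rd / 8) ^+ 2 * sqn x.
Proof.
apply: grid_sqn_mul => // a b ha hb.
(* Trimming both matrices amounts to erasing the test vectors on G, after which their supports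
   satisfy the degree bound. *)
pose cut (e : 'I_N -> bool * nat) u := if u \in G then (false, 0%N) else e u.
have cut_sqn e : code_sqn R e <= 16 * n -> code_sqn R (cut e) <= 16 * n.
  apply: le_trans; apply: ler_sum => u _; rewrite /cut; case: ifP => // _.
  by rewrite expr0n sqr_ge0.
have cut_deg e u : (0 < (cut e u).2)%N -> visits R l u s <= deg_const c * density R 'I_N l.
  by rewrite densE /cut; case: ifP => [//|/negbT uG _]; exact: visits_untrimmed.
have sg0 : sgnat R (false, 0%N) = 0 by rewrite /sgnat mulr0.
have -> : \sum_u \sum_v sgnat R (a u) * sgnat R (b v) * (A - B) u v =
   \sum_u \sum_v code_prod R (cut a) (cut b) u v *
     (counts R l s u v - model sigma (fun k m => p k m) l s u v).
  apply: eq_bigr => u _; apply: eq_bigr => v _.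
  rewrite mxE [trim G _ u v]mxE [(- B) u v]mxE [B u v]mxE [mdl u v]mxE count_matrixE /code_prod /cut.
  case: (u \in G); rewrite ?sg0 ?mul0r ?mulr0n ?subr0 ?mulr0 ?mulr0//=.
  by case: (v \in G); rewrite ?sg0 ?mulr0 ?mul0r ?mulr0n ?subr0 ?mulr0 ?mulr1n.
have bsize_ge' k : c * #|'I_N|%:R <= block_size R sigma k by rewrite card_N.
have rdE : Num.sqrt (density R 'I_N l) = rd by rewrite densE.
have := @bilinear_noise R 'I_N 'I_K sigma (fun k m => p k m) c l M J D c0.
rewrite card_N rdE densE => /(_ S0 block_size_ge d4 M1 D_le D_gt J_gt J_le s Hs (cut a) (cut b)).
rewrite -densE => /(_ (cut_deg a) (cut_deg b) (cut_sqn _ ha) (cut_sqn _ hb)) h.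
by apply: le_trans h _; rewrite le_eqVlt; apply/orP; left; apply/eqP; ring.
Qed.

Let bv k := block_visits R sigma l s k.

(** Factoring through p bounds the rank from above, and in [K_spec_lower] reduces the lower bound to
    inverting p between fixed matrices. *)
Lemma trim_modelE : B =
  (\matrix_(u < N, k < K) (((sigma u == k) && (u \notin G))%:R * (bv k / block_size R sigma k))) *m p *m
  (\matrix_(k < K, v < N) (((sigma v == k) && (v \notin G))%:R / block_size R sigma k)).
Proof.
apply/matrixP => u v; rewrite [LHS]mxE [mdl u v]mxE /model [RHS]mxE.
rewrite (bigD1 (sigma v)) //= big1 => [|k /negPf kv]; last first.
  by rewrite [X in _ * X]mxE eq_sym kv !mul0r mulr0.
rewrite addr0 [(_ *m p) u (sigma v)]mxE (bigD1 (sigma u)) //= big1 => [|k /negPf ku]; last first.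
  by rewrite [X in X * _]mxE eq_sym ku !mul0r.
rewrite !mxE !eqxx addr0 -/(bv (sigma u)) invfM.
by case: (u \in G); case: (v \in G); rewrite /= ?mulr1n ?mulr0n; ring.
Qed.

Lemma rank_trim_model : (\rank B <= \rank p)%N.
Proof.
rewrite trim_modelE; apply: leq_trans (mxrankM_maxl _ _) _.
exact: mxrankM_maxr.
Qed.

Lemma K_spec_upper (g : R) : 0 < g -> `|noise_const c * M * rd / 8| < g ->
  (K_spec g A <= \rank p)%N.
Proof.
move=> g0 hg; apply: leq_trans rank_trim_model; apply: K_spec_le => // x Bx x0.
have -> : A *m x = (A - B) *m x by rewrite mulmxBl Bx subr0.
apply: le_lt_trans (noise_bound x) _.
rewrite ltr_pM2r; last by rewrite lt0r sqn_ge0 sqn_eq0 x0.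
by rewrite -(real_normK (num_real (_ / 8))) ltrXn2r ?nnegrE// ltW.
Qed.

Let bs k := block_size R sigma k.
Let kept k : R := \sum_(v | sigma v == k) (v \notin G)%:R.

Let bs0 k : 0 < bs k. Proof. by rewrite (lt_le_trans _ (block_size_ge k))// mulr_gt0. Qed.

(** Trimming removes at most n exp (-d) <= n / d <= c n / 2 states, half of a block at worst. *)
Lemma kept_ge k : 2 / c <= d -> bs k / 2 <= kept k.
Proof.
move=> cd; have gG : #|G|%:R <= bs k / 2.
  apply: le_trans card_trimmed _; apply: (@le_trans _ _ (n / d)).
    rewrite ler_wpM2l ?(ltW n0)// expRN lef_pV2 ?posrE ?expR_gt0//.
    by apply: le_trans (expR_ge1Dx d); rewrite lerDr.
  rewrite ler_pdivrMr//; apply: (@le_trans _ _ (c * n / 2 * (2 / c))).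
    by rewrite le_eqVlt; apply/orP; left; apply/eqP; field; rewrite gt_eqF.
  by apply: ler_pM; rewrite ?ler_wpM2r ?divr_ge0 ?mulr_ge0 ?(ltW c0) ?(ltW n0).
have : bs k <= kept k + #|G|%:R; last by lra.
have -> : bs k = \sum_(v | sigma v == k) ((v \notin G)%:R + (v \in G)%:R).
  rewrite /bs /block_size -sum1_card natr_sum; apply: eq_big => // v _.
  by case: (v \in G); rewrite ?addr0 ?add0r.
rewrite big_split /= lerD2l -sum1_card natr_sum [leRHS]big_mkcond /=.
rewrite [leRHS](bigID (fun v => sigma v == k)) /= -[leLHS]addr0 lerD//.
  by apply: ler_sum => v _; case: (v \in G).
by apply: sumr_ge0 => v _; case: (v \in G).
Qed.

(** Since V p U = 1, p shrinks U x by a bounded factor only, so B stretches the image of F by theta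
    d. The 8 is 2 * 4: the 2 from half-kept blocks in [lowL], the 4 from [uppF]. Noise below g <=
    theta d / 2 then leaves A a stretch of g. *)
Lemma K_spec_lower r (U : 'M[R]_(K, r)) (V : 'M[R]_(r, K)) (kU kV c1 theta g : R) :
  V *m p *m U = 1%:M ->
  (forall x : 'cV_r, sqn (U *m x) <= kU * sqn x) -> 0 < kU ->
  (forall x : 'cV_K, sqn (V *m x) <= kV * sqn x) -> 0 < kV ->
  0 < c1 -> (forall k, c1 * l%:R <= bv k) ->
  0 < theta -> 8 * theta ^+ 2 * kU * kV <= c * c1 ^+ 2 ->
  2 / c <= d -> 0 < g -> `|noise_const c * M * rd / 8| < g -> g <= theta * d / 2 ->
  (r <= K_spec g A)%N.
Proof.
move=> VU hU kU0 hV kV0 c10 hbv th0 hth cd g0 hg gth.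
have kept0 k : 0 < kept k by rewrite (lt_le_trans _ (kept_ge k cd))// divr_gt0.
pose L : 'M[R]_(N, K) :=
  \matrix_(u < N, k < K) (((sigma u == k) && (u \notin G))%:R * (bv k / bs k)).
(* U x is spread over the untrimmed states; the ratio of block size to kept size compensates the
   trimming, so that the right factor in [trim_modelE] returns U x exactly. *)
pose F : 'M[R]_(N, r) :=
  \matrix_(v, i) ((v \notin G)%:R * (bs (sigma v) / kept (sigma v)) * U (sigma v) i).
have BF x : B *m (F *m x) = L *m (p *m (U *m x)).
  rewrite trim_modelE -/bs -/L -!mulmxA; congr (_ *m (_ *m _)).
  rewrite mulmxA; congr (_ *m _); apply/matrixP => k i; rewrite mxE.
  rewrite (eq_bigr (fun v => (sigma v == k)%:R * ((v \notin G)%:R * ((kept k)^-1 * U k i)))); last first.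
    move=> v _; rewrite !mxE; case: eqP => [->|_]; last by rewrite !mul0r.
    case: (v \in G) => /=; rewrite ?mul0r ?mulr0 ?mul0r// !mul1r mulrA; congr (_ * _).
    by rewrite mulKf // gt_eqF.
  under eq_bigr do rewrite mulr_natl mulrb.
  by rewrite -big_mkcond /= -mulr_suml -/(kept k) mulrA mulfV ?mul1r// gt_eqF.
have entryF x v : (F *m x) v ord0 = (v \notin G)%:R * (bs (sigma v) / kept (sigma v)) * (U *m x) (sigma v) ord0.
  rewrite !mxE mulr_sumr; apply: eq_bigr => i _; rewrite mxE.
  by rewrite !mulrA.
have entryL y u : (L *m y) u ord0 = (u \notin G)%:R * (bv (sigma u) / bs (sigma u)) * y (sigma u) ord0.
  rewrite mxE (bigD1 (sigma u)) //= big1 => [|k /negPf ku]; last first.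
    by rewrite mxE eq_sym ku /= !mul0r.
  by rewrite mxE eqxx addr0.
have sumK (f : 'I_K -> R) : \sum_v (v \notin G)%:R * f (sigma v) = \sum_k kept k * f k.
  rewrite (partition_big sigma predT) //=; apply: eq_bigr => k _.
  by rewrite mulr_suml; apply: eq_bigr => v /eqP ->.
have sqb (b : bool) : (b%:R : R) ^+ 2 = b%:R by case: b; rewrite ?expr1n ?expr0n.
have ld : l%:R = d * n by rewrite /d divfK // gt_eqF.
have bsn k : bs k <= n.
  by rewrite /bs /block_size /n ler_nat -[X in (_ <= X)%N]card_ord max_card.
have lowL y : c * n / 2 * (c1 * d) ^+ 2 * sqn y <= sqn (L *m y).
  rewrite [leRHS](_ : _ = \sum_v (v \notin G)%:R *
      ((bv (sigma v) / bs (sigma v)) * y (sigma v) ord0) ^+ 2); last first.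
    by apply: eq_bigr => v _; rewrite entryL -mulrA exprMn sqb.
  rewrite (sumK (fun k => (bv k / bs k * y k ord0) ^+ 2)) mulr_sumr.
  apply: ler_sum => k _; rewrite [in leRHS]exprMn [leRHS]mulrA ler_wpM2r ?sqr_ge0//.
  apply: ler_pM.
  - by rewrite !mulr_ge0 ?invr_ge0 ?(ltW c0) ?(ltW n0).
  - exact: sqr_ge0.
  - by apply: le_trans (kept_ge k cd); rewrite ler_wpM2r ?invr_ge0.
  rewrite lerXn2r ?nnegrE ?mulr_ge0 ?invr_ge0 ?(ltW c10) ?(ltW d0) ?(ltW (bs0 _))//.
    by apply: le_trans (hbv k); rewrite mulr_ge0// ltW.
  rewrite ler_pdivlMr//; apply: le_trans (hbv k); rewrite ld mulrA ler_wpM2l//.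
  by rewrite mulr_ge0// ltW.
have uppF x : sqn (F *m x) <= 4 * n * sqn (U *m x).
  rewrite [leLHS](_ : _ = \sum_v (v \notin G)%:R *
      ((bs (sigma v) / kept (sigma v)) * (U *m x) (sigma v) ord0) ^+ 2); last first.
    by apply: eq_bigr => v _; rewrite entryF -mulrA exprMn sqb.
  rewrite (sumK (fun k => (bs k / kept k * (U *m x) k ord0) ^+ 2)) mulr_sumr.
  apply: ler_sum => k _; rewrite [in leLHS]exprMn [leLHS]mulrA ler_wpM2r ?sqr_ge0//.
  have k2 : bs k / kept k <= 2.
    by rewrite ler_pdivrMr//; have := kept_ge k cd; lra.
  have -> : kept k * (bs k / kept k) ^+ 2 = bs k * (bs k / kept k).
    by field; rewrite gt_eqF.
  have := bsn k; have := bs0 k => b0 bn.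
  apply: (@le_trans _ _ (n * 2)); last by move: n0; lra.
  by apply: (ler_pM _ _ bn k2); [exact: ltW|apply: divr_ge0; exact: ltW].
have sqn_x x : theta ^+ 2 * d ^+ 2 * sqn (F *m x) <= sqn (B *m (F *m x)).
  rewrite BF; set y := p *m (U *m x).
  have xy : x = V *m y by rewrite /y !mulmxA VU mul1mx.
  apply: le_trans (lowL y).
  apply: (@le_trans _ _ (theta ^+ 2 * d ^+ 2 * (4 * n * (kU * (kV * sqn y))))).
    apply: ler_wpM2l; first by rewrite mulr_ge0 ?sqr_ge0.
    apply: le_trans (uppF x) _; apply: ler_wpM2l; first by rewrite mulr_ge0// ltW.
    apply: le_trans (hU x) _; apply: ler_wpM2l; first exact: ltW.
    by rewrite {1}xy; exact: hV.
  have -> : theta ^+ 2 * d ^+ 2 * (4 * n * (kU * (kV * sqn y))) =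
    (8 * theta ^+ 2 * kU * kV) * (n / 2 * d ^+ 2 * sqn y) by field.
  have -> : c * n / 2 * (c1 * d) ^+ 2 * sqn y = (c * c1 ^+ 2) * (n / 2 * d ^+ 2 * sqn y) by field.
  apply: ler_wpM2r => //; apply: mulr_ge0; last exact: sqn_ge0.
  by apply: mulr_ge0; [rewrite divr_ge0 // ltW|exact: sqr_ge0].
apply: (@K_spec_ge R N r A F) => // [x x0|x].
  apply: contra x0 => /eqP Fx; have := BF _ x; rewrite Fx mulmx0 => Ly.
  have := lowL (p *m (U *m x)); rewrite -Ly sqn0 pmulr_rle0; last first.
    by rewrite mulr_gt0 ?exprn_gt0 ?divr_gt0 ?(mulr_gt0 c0 n0) ?(mulr_gt0 c10 d0).
  move=> s0; have /eqP : sqn (p *m (U *m x)) == 0 by rewrite eq_le s0 sqn_ge0.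
  move/eqP; rewrite sqn_eq0 => /eqP y0.
  by rewrite -[x]mul1mx -VU -!mulmxA y0 mulmx0.
(* |B y|^2 <= 2 |A y|^2 + 2 |(A - B) y|^2 with y = F x: the left side is at least 4 g^2 |y|^2 and
   the noise takes at most 2 g^2 |y|^2 of it. *)
have h1 := sqn_x x; have h2 := noise_bound (F *m x).
have h3 := sqnB_le (A *m (F *m x)) ((A - B) *m (F *m x)).
have e3 : A *m (F *m x) - (A - B) *m (F *m x) = B *m (F *m x).
  by rewrite -mulmxBl opprB addrC subrK.
rewrite e3 in h3; have sx := sqn_ge0 (F *m x).
have g2 : (noise_const c * M * rd / 8) ^+ 2 <= g ^+ 2.
  by rewrite -(real_normK (num_real (_ / 8))) lerXn2r ?nnegrE ?(ltW hg)// ltW.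
have g4 : 4 * g ^+ 2 <= theta ^+ 2 * d ^+ 2.
  have : g ^+ 2 <= (theta * d / 2) ^+ 2 by rewrite lerXn2r ?nnegrE ?(ltW g0)// (le_trans (ltW g0)).
  by rewrite !exprMn exprVn; lra.
have h4 : (noise_const c * M * rd / 8) ^+ 2 * sqn (F *m x) <= g ^+ 2 * sqn (F *m x).
  by rewrite ler_wpM2r.
have h5 : 4 * g ^+ 2 * sqn (F *m x) <= theta ^+ 2 * d ^+ 2 * sqn (F *m x).
  by rewrite ler_wpM2r.
move: h1 h2 h3 h4 h5; lra.
Qed.

End Trimmed.

Local Open Scope classical_set_scope.
Local Open Scope ring_scope.

(** * From the path sums to the probability space *)

Lemma measure_partition_ord (R : realType) (d : measure_display)
    (T : measurableType d) (P : probability T R) (n : nat) (f : T -> 'I_n) (A : set T) :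
  (forall y, measurable (A `&` [set w | f w = y])) ->
  measurable A /\ P A = (\sum_(y < n) P (A `&` [set w | f w = y]))%E.
Proof.
move=> mA; have AE : A = \big[setU/set0]_(y < n) (A `&` [set w | f w = y]).
  rewrite -bigcup_seq; apply/seteqP; split => [w Aw|w [y _ []//]].
  by exists (f w) => //=; exact: mem_index_enum.
split; first by rewrite AE; apply: bigsetU_measurable.
rewrite [in LHS]AE measure_bigsetU_ord //.
apply/trivIsetP => i j _ _ ij; apply/seteqP; split => // w [[_ /= fi] [_ /= fj]].
by rewrite -fi -fj eqxx in ij.
Qed.

Section Link.
Variables (R : realType) (d : measure_display) (T : measurableType d).
Variables (P : probability T R) (n : nat) (mu : 'rV[R]_n) (Q : 'M[R]_n).
Variable (X : nat -> T -> 'I_n).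
Hypothesis HX : is_markov_chain P mu Q X.

Let glue j (h s : nat -> 'I_n) t := if (t < j)%N then h t else s (t - j)%N.

Lemma measurable_history j (h : nat -> 'I_n) :
  measurable [set w | forall s, (s <= j)%N -> X s w = h s].
Proof.
have [mX _ _] := HX; elim: j => [|j IH].
  rewrite (_ : mkset _ = [set w | X 0 w = h 0%N]) //.
  by apply/seteqP; split => w /= => [H|H [|s]//]; exact: H.
rewrite (_ : mkset _ = [set w | forall s, (s <= j)%N -> X s w = h s] `&`
    [set w | X j.+1 w = h j.+1]); first exact: measurableI.
apply/seteqP; split => w /= => [H|[H1 H2] s]; first by split => [s sj|]; apply: H => //; exact: leqW.
by rewrite leq_eqVlt => /predU1P[->//|]; exact: H1.
Qed.

(** Induction on the number l of free steps: the event is split by the value at time j+1, and each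
    part is the same claim for a longer history. Products in place of conditional probabilities keep
    histories of probability zero harmless. *)
Lemma markov_history l j (h : nat -> 'I_n) (B : (nat -> 'I_n) -> Prop) :
  (forall x y, (forall t, (t <= j + l)%N -> x t = y t) -> B x -> B y) ->
  let A := [set w | (forall s, (s <= j)%N -> X s w = h s) /\ B (X^~ w)] in
  measurable A /\
  P A = (P [set w | forall s, (s <= j)%N -> X s w = h s]
    * (pathE (fun x y => Q x y) l (h j) (fun s => (`[< B (glue j h s) >])%:R))%:E)%E.
Proof.
have [mX _ MX] := HX.
elim: l j h => [|l IH] j h Bl A /=.
  have [Bh|Bh] := asboolP (B (glue j h (fun=> h j))).
    have AE : A = [set w | forall s, (s <= j)%N -> X s w = h s].
      apply/seteqP; split => w /= => [[]//|H]; split => //.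
      apply: Bl Bh => t; rewrite addn0 leq_eqVlt /glue => /predU1P[->|tj].
        by rewrite ltnn H.
      by rewrite tj H // ltnW.
    by split; rewrite AE ?mule1//; exact: measurable_history.
  have AE : A = set0.
    apply/seteqP; split => // w /= [H Bw]; apply: Bh.
    apply: Bl Bw => t; rewrite addn0 leq_eqVlt /glue => /predU1P[->|tj].
      by rewrite ltnn H.
    by rewrite tj H // ltnW.
  by split; rewrite AE ?measure0 ?mule0.
pose hy y t := if (t <= j)%N then h t else y.
have hyj y : hy y j.+1 = y by rewrite /hy ltnn.
have {}Bl x y : (forall t, (t <= j.+1 + l)%N -> x t = y t) -> B x -> B y.
  by move=> xy; apply: Bl => t; rewrite addnS -addSn; exact: xy.
have AyE y : A `&` [set w | X j.+1 w = y] =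
    [set w | (forall s, (s <= j.+1)%N -> X s w = hy y s) /\ B (X^~ w)].
  apply/seteqP; split => w /= => [[[H Bw] Xy]|[H Bw]].
    split => // s; rewrite leq_eqVlt => /predU1P[->|]; first by rewrite hyj.
    by rewrite ltnS => sj; rewrite H // /hy sj.
  split; last by rewrite H ?hyj.
  by split => // s sj; rewrite H ?(leqW sj)// /hy sj.
have mPA y : measurable (A `&` [set w | X j.+1 w = y]) /\
    P (A `&` [set w | X j.+1 w = y]) =
    (P [set w | forall s, (s <= j)%N -> X s w = h s] * (Q (h j) y *
     pathE (fun x y => Q x y) l y
      (fun s => (`[< B (glue j h (scons (h j) s)) >])%:R))%:E)%E.
  rewrite AyE; have [mA PA] := IH j.+1 (hy y) Bl; split => //; rewrite PA MX.
  rewrite hyj EFinM muleA; congr (_ * (Q _ _)%:E * _)%E.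
  - congr (P _); apply/seteqP; split => w /= H s sj.
      by rewrite H // /hy sj.
    by rewrite H // /hy sj.
  - by rewrite /hy leqnn.
  congr (_%:E); congr pathE; apply/funext => s; congr ((`[< B _ >])%:R); apply/funext => t.
  rewrite /glue /hy ltnS; case: (ltngtP t j) => [tj|jt|->] //.
    by rewrite -(subnSK jt).
  by rewrite subnn.
have [mA PA] := measure_partition_ord P (fun y => (mPA y).1).
split => //; rewrite PA; have mH := measurable_history j h.
rewrite -(fineK (fin_num_measure P _ mH)) -EFinM mulr_sumr -sumEFin.
apply: eq_bigr => y _; rewrite (mPA y).2 [RHS]EFinM fineK //.
exact: fin_num_measure.
Qed.

Lemma markov_chainP l (B : (nat -> 'I_n) -> Prop) :
  (forall x y, (forall t, (t <= l)%N -> x t = y t) -> B x -> B y) ->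
  measurable [set w | B (X^~ w)] /\
  P [set w | B (X^~ w)] = (chainP (fun x => mu ord0 x) (fun x y => Q x y) l B)%:E.
Proof.
have [mX mu0 _] := HX; move=> Bl; set A := mkset _.
have AE y : A `&` [set w | X 0 w = y] =
    [set w | (forall s, (s <= 0)%N -> X s w = y) /\ B (X^~ w)].
  apply/seteqP; split => w /=; first by move=> [Bw Xy]; split => // -[|].
  by move=> [/(_ 0%N (leqnn _)) ? ?].
have H y := @markov_history l 0%N (fun=> y) B Bl.
have mA y : measurable (A `&` [set w | X 0 w = y]).
  by rewrite AE; have [] := H y.
have [? PA] := measure_partition_ord P mA; split => //.
rewrite PA /chainP /chainE -sumEFin; apply: eq_bigr => y _.
rewrite AE; have [_ ->] := H y; rewrite EFinM; congr (_ * _)%E.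
  rewrite -mu0; congr (P _); apply/seteqP; split => w /= => [|Xy [|]//]; exact.
congr (_%:E); congr pathE; apply/funext => s; congr ((`[< B _ >])%:R); apply/funext => t.
by rewrite /glue subn0.
Qed.

End Link.

Section PathDependence.
Variables (R : realType) (S : finType).

Lemma eq_path_sum (F : S -> S -> R) l (x y : nat -> S) :
  (forall t, (t <= l)%N -> x t = y t) -> path_sum F l x = path_sum F l y.
Proof.
by move=> xy; apply: eq_bigr => t _; rewrite !xy// ltnW.
Qed.

Lemma eq_good_path (K : finType) (sigma : S -> K) p (c : R) l M J D (x y : nat -> S) :
  (forall t, (t <= l)%N -> x t = y t) ->
  good_path sigma p c l M J D x -> good_path sigma p c l M J D y.
Proof.
move=> xy [h1 h2 h3 h4]; split.
- by move=> a b ha hb; rewrite -(eq_path_sum _ xy); exact: h1.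
- by move=> i j A C iJ jJ; rewrite /edges -(eq_path_sum _ xy); exact: h2.
- move: h3; rewrite /good_degrees; congr (_ <= _); apply: eq_bigr => v _.
  by rewrite /visits (eq_path_sum _ xy).
- by move=> k m; rewrite -(eq_path_sum _ xy); exact: h4.
Qed.

(** Block m is left as often as it is entered, except that the last state may be entered and not
    left: this is the 1. The rest is the error of [good_transitions], once for each block of
    origin. *)
Lemma block_visits_flow (K : finType) (sigma : S -> K) (p : K -> K -> R) c l M J D s :
  good_path sigma p c l M J D s -> forall m,
  \sum_k block_visits R sigma l s k * p k m <= block_visits R sigma l s m +
    (1 + #|K|%:R * (3 * M * #|S|%:R * Num.sqrt (density R S l))).
Proof.
move=> [_ _ _ ht] m; set e := 3 * M * _ * _.
have hk k : block_visits R sigma l s k * p k m <= block_counts R sigma l s k m + e.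
  have := ht k m; rewrite ler_norml => /andP[h _]; move: h.
  have -> : path_sum (fun x y => (sigma x == k)%:R * ((sigma y == m)%:R - p k m)) l s =
      block_counts R sigma l s k m - block_visits R sigma l s k * p k m.
    rewrite /block_counts /block_visits (mulrC (path_sum _ _ _)) -path_sumZ -sumrB.
    by apply: eq_bigr => t _; rewrite -mulnb natrM; ring.
  by rewrite -/e; lra.
apply: (@le_trans _ _ (\sum_k (block_counts R sigma l s k m + e))).
  by apply: ler_sum => k _; exact: hk.
rewrite big_split /= sumr_const -[e *+ _]mulr_natl addrA lerD2r.
have -> : \sum_k block_counts R sigma l s k m = path_sum (fun _ y => (sigma y == m)%:R) l s.
  rewrite /block_counts -path_sum_sum; apply: eq_bigr => t _.
  rewrite (bigD1 (sigma (s t))) //= eqxx big1 ?addr0// => k /negPf kn.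
  by rewrite eq_sym kn.
rewrite /block_visits /path_sum.
apply: (@le_trans _ _ (\sum_(t < l.+1) (sigma (s t) == m)%:R)).
  by rewrite [leRHS]big_ord_recl /= lerDr.
by rewrite big_ord_recr /= lerD2l; case: (_ == m).
Qed.

Lemma sum_block_visits (K : finType) (sigma : S -> K) l s :
  \sum_k block_visits R sigma l s k = l%:R.
Proof.
rewrite /block_visits -path_sum_sum.
transitivity (path_sum (fun _ _ => 1 : R) l s); last by rewrite path_sum_const mulr1.
apply: eq_bigr => t _; rewrite (bigD1 (sigma (s t))) //= eqxx big1 ?addr0// => k /negPf kn.
by rewrite eq_sym kn.
Qed.

End PathDependence.

(** * The estimator on a good path *)

Section Deterministic.
Variables (R : realType) (K : nat) (p : 'M[R]_K) (c : R).
Hypothesis c0 : 0 < c.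
Hypothesis p_stochastic : is_stochastic p.
Hypothesis p_irreducible : is_irreducible p.

(** The order of quantifiers matters: theta depends on p and c alone, and M only raises the
    threshold d0. In the limit M can thus be chosen from the tolerance with theta already fixed. *)
Lemma K_spec_rank : exists2 theta : R, 0 < theta & forall M : R, 1 <= M ->
  exists d0 : R, forall (N l : nat) (sigma : 'I_N -> 'I_K) (J D : nat) (s : nat -> 'I_N)
    (G : {set 'I_N}) (g : R), (0 < N)%N ->
  (forall k, c * N%:R <= block_size R sigma k) ->
  let d := l%:R / N%:R : R in let rd := Num.sqrt d in
  d0 <= d -> 2 ^+ D <= rd -> rd < 2 ^+ D.+1 ->
  (forall k : nat, (k ^ 2 <= 16 * N)%N -> (trunc_log 2 k < J)%N) ->
  4 ^+ J <= 64 * N%:R :> R ->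
  good_path sigma (fun k m => p k m) c l M J D s ->
  is_most_visited (trim_size R N l) (count_matrix R l s) G ->
  0 < g -> `|noise_const c * M * rd / 8| < g -> g <= theta * d / 2 ->
  K_spec g (trim G (count_matrix R l s)) = \rank p.
Proof.
have [p0 p1] := p_stochastic.
have [c1 [C [c10 C0 flow]]] := approx_stationary_lower p0 p_irreducible.
(* From the rank factorisation of p into [col_base] and [row_base]: V is a left inverse of the
   first, U a right inverse of the second, so V p U = 1. *)
have [U RU] := row_freeP (row_base_free p).
have [V VC] := row_fullP (col_base_full p).
have VpU : V *m p *m U = 1%:M.
  have -> : V *m p = row_base p by rewrite -[RHS]mul1mx -VC -mulmxA mulmx_base.
  exact: RU.
have [kU kU0 hU] := sqn_mul_bounded U.
have [kV kV0 hV] := sqn_mul_bounded V.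
pose th2 := c * (c1 / 2) ^+ 2 / (8 * kU * kV).
have th20 : 0 < th2.
  by rewrite /th2 divr_gt0 ?mulr_gt0// exprn_gt0// divr_gt0.
exists (Num.sqrt th2) => [|M M1]; first by rewrite sqrtr_gt0.
pose q := 2 * C * (1 + 3 * K%:R * M) / c1.
have q0 : 0 <= q.
  by rewrite /q divr_ge0 ?(ltW c10)// !mulr_ge0 ?(ltW C0)// addr_ge0// !mulr_ge0// (le_trans _ M1).
(* 4 serves the concentration bounds, 2 / c serves [kept_ge], and q <= sqrt d makes the flow error
   at most half of c1 ell, whence the c1 / 2 below. *)
exists (4 + 2 / c + q ^+ 2) => N l sigma J D s G g N0 bs d rd hd D1 D2 J1 J2 good HG g0 hg gth.
have c2 : 0 < 2 / c by rewrite divr_gt0.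
have qq := sqr_ge0 q.
have d4 : 4 <= d by lra.
have cd : 2 / c <= d by lra.
have qd : q ^+ 2 <= d by lra.
have n0 : 0 < N%:R :> R by rewrite ltr0n.
have d0 : 0 < d by lra.
have rd2 : rd ^+ 2 = d by rewrite sqr_sqrtr// ltW.
have rd0 : 0 < rd by rewrite sqrtr_gt0.
have rd1 : 1 <= rd by rewrite -sqrtr1 ler_sqrt //; lra.
have qrd : q <= rd by rewrite -(ger0_norm q0) -sqrtr_sqr ler_sqrt // ltW.
have ld : l%:R = d * N%:R by rewrite /d divfK // gt_eqF.
apply/eqP; rewrite eqn_leq; apply/andP; split.
  exact: (K_spec_upper c0 N0 bs d4 M1 D1 D2 J1 J2 good HG g0 hg).
apply: (@K_spec_lower R N K sigma p c l M J D c0 N0 bs d4 M1 D1 D2 J1 J2 s good G HG _ U V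
   kU kV (c1 / 2) (Num.sqrt th2) g VpU hU kU0 hV kV0 _ _ _ _ cd g0 hg gth).
- by rewrite divr_gt0.
- move=> k; have dE : density R 'I_N l = d by rewrite /density card_ord.
  pose eta : R := 1 + #|'I_K|%:R * (3 * M * #|'I_N|%:R * Num.sqrt (density R 'I_N l)).
  have eta0 : 0 <= eta.
    by rewrite addr_ge0// mulr_ge0// mulr_ge0 ?sqrtr_ge0// !mulr_ge0// (le_trans _ M1).
  have := flow (block_visits R sigma l s) eta eta0 _ (block_visits_flow good) k.
  rewrite sum_block_visits => /(_ _) h.
  have {}h : c1 * l%:R <= block_visits R sigma l s k + C * eta.
    by apply: h => j; apply: sumr_ge0 => t _.
  suff : C * eta <= c1 / 2 * l%:R by lra.
  rewrite /eta !card_ord dE -/rd ld -rd2.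
  apply: (@le_trans _ _ (C * (1 + 3 * K%:R * M) * (N%:R * rd))).
    rewrite -[leRHS]mulrA ler_wpM2l ?(ltW C0)// [leRHS]mulrDl mul1r lerD//.
      by rewrite mulr_ege1 // ler1n.
    by rewrite le_eqVlt; apply/orP; left; apply/eqP; ring.
  have -> : C * (1 + 3 * K%:R * M) = q * c1 / 2 by rewrite /q; field; rewrite gt_eqF.
  have -> : c1 / 2 * (rd ^+ 2 * N%:R) = rd * c1 / 2 * (N%:R * rd) by field.
  have nr : 0 <= N%:R * rd by rewrite mulr_ge0// ltW.
  by rewrite ler_wpM2r// ler_wpM2r// ler_wpM2r// ltW.
- by rewrite sqrtr_gt0.
rewrite sqr_sqrtr ?(ltW th20)// /th2 le_eqVlt; apply/orP; left; apply/eqP; field.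
by rewrite !gt_eqF.
Qed.

End Deterministic.

(** * Failure probability and passage to the limit *)

Lemma bmc_not_good_le (R : realType) (K N : nat) (p : 'M[R]_K) (pi : 'rV[R]_K)
    (sigma : 'I_N -> 'I_K) (c : R) (l : nat) (M : R) (J D : nat)
    (d : measure_display) (T : measurableType d) (P : probability T R)
    (X : nat -> T -> 'I_N) :
  is_stochastic p -> is_stationary p pi -> 0 < c -> (0 < N)%N ->
  (forall k, c * N%:R <= block_size R sigma k) -> 4 <= l%:R / N%:R :> R -> 1 <= M ->
  is_markov_chain P (bmc_stationary pi sigma) (bmc_matrix p sigma) X ->
  let bad := [set w | ~ good_path sigma (fun k m => p k m) c l M J D (X^~ w)] in
  measurable bad /\
  (P bad <= ((5 + 2 * K%:R ^+ 2) * expR (- M) + expR (- (l%:R / N%:R)))%:E)%E.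
Proof.
move=> [p0 p1] [pi0 pi1 _] c0 N0 bs d4 M1 HX bad.
have [mbad Pbad] := @markov_chainP R d T P N _ _ X HX l
  (fun s => ~ good_path sigma (fun k m => p k m) c l M J D s)
  (fun x y xy hx hy => hx (eq_good_path (fun t tl => esym (xy t tl)) hy)).
split; first exact: mbad.
rewrite [X in (X <= _)%E]Pbad lee_fin.
have cN : #|'I_N| = N := card_ord N.
have := @prob_not_good R 'I_N 'I_K sigma (fun k m => p k m) (fun k => pi ord0 k) p0 p1 pi0 pi1 c c0.
rewrite /density cN card_ord => /(_ N0 bs l M J D d4 M1); apply: le_trans.
rewrite le_eqVlt; apply/orP; left; apply/eqP.
have bE k : #|block sigma k|%:R = block_size R sigma k by rewrite /block_size /block cardsE.
congr chainP; first by apply/funext => x; rewrite mxE /block_law bE.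
by apply/funext => x; apply/funext => y; rewrite mxE /block_kernel bE.
Qed.

(** Ties may be broken by any measurable rule, so the event is split by the finitely many values of
    [Gamma]; on each part it depends on finitely many coordinates of the path. *)
Lemma measurable_chain_estimator (R : realType) (N l : nat)
    (d : measure_display) (T : measurableType d) (P : probability T R)
    (mu : 'rV[R]_N) (Q : 'M[R]_N) (X : nat -> T -> 'I_N) (Gamma : T -> {set 'I_N})
    (f : {set 'I_N} -> 'M[R]_N -> Prop) :
  is_markov_chain P mu Q X -> (forall G, measurable [set w | Gamma w = G]) ->
  measurable [set w | f (Gamma w) (count_matrix R l (fun t => X t w))].
Proof.
move=> HX mG; set A := mkset _.
have -> : A = \big[setU/set0]_(G : {set 'I_N}) ([set w | Gamma w = G] `&`
    [set w | f G (count_matrix R l (fun t => X t w))]).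
  rewrite -bigcup_seq; apply/seteqP; split => [w Aw|w [G _ [/= <-]//]].
  by exists (Gamma w) => //=; exact: mem_index_enum.
apply: bigsetU_measurable => G _; apply: measurableI; first exact: mG.
have [] := @markov_chainP R d T P N mu Q X HX l (fun s => f G (count_matrix R l s)) => //.
move=> x y xy; rewrite (_ : count_matrix R l y = count_matrix R l x) //.
apply/matrixP => i j; rewrite !mxE; congr (_%:R); apply: eq_bigr => t _.
by rewrite !xy // ltnW.
Qed.

(* The index n of every sequence stands for the model with n.+1 states, so that
   the state space 'I_n.+1 is never empty. *)
Theorem proposition3p1 (R : realType)
  (K : nat) (hK : (1 <= K)%N)
  (p : 'M[R]_K) (alpha : 'I_K -> R) (pi : 'rV[R]_K)
  (p_stochastic : is_stochastic p)
  (p_irreducible : is_irreducible p)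
  (pi_stationary : is_stationary p pi)
  (alpha_sum : \sum_k alpha k = 1)
  (alpha_pos : forall k, 0 < alpha k)
  (sigma : forall n : nat, 'I_n.+1 -> 'I_K)
  (sigma_surj : \forall n \near \oo, forall k, exists x, sigma n x = k)
  (sigma_alpha : forall k,
     #|block (sigma n) k|%:R / n.+1%:R @[n --> \oo] --> alpha k)
  (ell : nat -> nat) (ell_pos : forall n, (0 < ell n)%N)
  (gamma : nat -> R) (gamma_pos : forall n, 0 < gamma n)
  (ell_large : @little_omega R (fun n => (ell n)%:R) (fun n => n.+1%:R))
  (gamma_large :
     little_omega gamma (fun n => Num.sqrt ((ell n)%:R / n.+1%:R)))
  (gamma_small : little_o gamma (fun n => (ell n)%:R / n.+1%:R))
  (d : nat -> measure_display) (T : forall n : nat, measurableType (d n))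
  (P : forall n : nat, probability (T n) R)
  (X : forall n : nat, nat -> T n -> 'I_n.+1)
  (X_bmc : \forall n \near \oo,
     is_markov_chain (P n) (bmc_stationary pi (sigma n))
       (bmc_matrix p (sigma n)) (X n))
  (Gamma : forall n : nat, T n -> {set 'I_n.+1})
  (Gamma_measurable : forall n (G : {set 'I_n.+1}),
     measurable [set w | Gamma n w = G])
  (Gamma_most_visited : forall n (w : T n),
     is_most_visited (trim_size R n.+1 (ell n))
       (count_matrix R (ell n) (fun t => X n t w)) (Gamma n w)) :
  P n [set w | K_spec (gamma n)
                 (trim (Gamma n w)
                    (count_matrix R (ell n) (fun t => X n t w)))
               = \rank p] @[n --> \oo] --> 1%E.
Proof.
pose A n := [set w | K_spec (gamma n) (trim (Gamma n w)
  (count_matrix R (ell n) (fun t => X n t w))) = \rank p].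
change (P n (A n) @[n --> \oo] --> 1%E).
have [ca ca0 hca] := positive_lower_bound alpha_pos.
pose c := ca / 2; have c0 : 0 < c by rewrite divr_gt0.
have blocks : \forall n \near \oo, forall k, c * n.+1%:R <= block_size R (sigma n) k.
  apply: filter_forall => k; near=> n.
  have : c <= #|block (sigma n) k|%:R / n.+1%:R.
    near: n; apply: (cvgr_ge (alpha k) (sigma_alpha k)).
    by apply: lt_le_trans (hca k); rewrite /c; lra.
  rewrite ler_pdivlMr ?ltr0n// => /le_trans; apply.
  by rewrite /block_size /block cardsE.
have [theta theta0 det] := K_spec_rank c0 p_stochastic p_irreducible.
have mA : \forall n \near \oo, measurable (A n).
  near=> n.
  have HX : is_markov_chain (P n) (bmc_stationary pi (sigma n)) (bmc_matrix p (sigma n)) (X n).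
    by near: n; exact: X_bmc.
  exact: (measurable_chain_estimator (ell n)
    (fun G N => K_spec (gamma n) (trim G N) = \rank p) HX (Gamma_measurable n)).
apply/fine_cvgP; split.
  by near=> n; apply: fin_num_measure; near: n; exact: mA.
apply/cvgrPdist_le => eps eps0.
pose CK : R := 5 + 2 * K%:R ^+ 2.
have CK0 : 0 < CK by rewrite /CK; have := sqr_ge0 (K%:R : R); lra.
(* As exp (-x) <= 1/x, this M, which is independent of n, brings the first part of the failure
   probability below eps / 2; large d does the same for exp (-d). *)
pose M : R := 1 + CK * 2 / eps.
have q0 : 0 < CK * 2 / eps by rewrite divr_gt0// mulr_gt0.
have M1 : 1 <= M by rewrite /M; lra.
have [d0 hd0] := det M M1.
have ell_ge z : \forall n \near \oo, z <= (ell n)%:R / n.+1%:R :> R.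
  by move: z; apply/cvgryPge; exact: ell_large.
have ratio_gt z : \forall n \near \oo, z < gamma n / Num.sqrt ((ell n)%:R / n.+1%:R).
  by move: z; apply/cvgryPgt; exact: gamma_large.
near=> n.
have dn_eps : 2 / eps <= (ell n)%:R / n.+1%:R by near: n; exact: ell_ge.
have dn4 : 4 <= (ell n)%:R / n.+1%:R :> R by near: n; exact: ell_ge.
have dnd0 : d0 <= (ell n)%:R / n.+1%:R by near: n; exact: ell_ge.
have g_ratio : `|noise_const c * M / 8| < gamma n / Num.sqrt ((ell n)%:R / n.+1%:R).
  by near: n; exact: ratio_gt.
have g_small0 : `|gamma n / ((ell n)%:R / n.+1%:R)| <= theta / 2.
  by near: n; apply: (cvgr0_norm_le _ gamma_small); rewrite divr_gt0.
have mAn : measurable (A n) by near: n; exact: mA.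
have HX : is_markov_chain (P n) (bmc_stationary pi (sigma n)) (bmc_matrix p (sigma n)) (X n).
  by near: n; exact: X_bmc.
have bs : forall k, c * n.+1%:R <= block_size R (sigma n) k by near: n; exact: blocks.
set dn : R := (ell n)%:R / n.+1%:R in dn_eps dn4 dnd0 g_ratio g_small0.
have dn0 : 0 < dn by lra.
have rd0 : 0 < Num.sqrt dn by rewrite sqrtr_gt0.
have rd1 : 1 <= Num.sqrt dn by rewrite -sqrtr1 ler_sqrt; lra.
have g_large : `|noise_const c * M * Num.sqrt dn / 8| < gamma n.
  move: g_ratio.
  rewrite ltr_pdivlMr// -[X in _ * X](gtr0_norm rd0) -normrM.
  by rewrite mulrAC.
have g_small : gamma n <= theta * dn / 2.
  move: g_small0.
  rewrite ger0_norm ?divr_ge0 ?(ltW dn0) ?(ltW (gamma_pos n))//.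
  by rewrite ler_pdivrMr// mulrAC.
have [D [D1 D2]] := exists_log2 rd1.
have [J [J1 J2]] := exists_top_level R (ltn0Sn n).
have [mbad Pbad] := bmc_not_good_le J D p_stochastic pi_stationary c0 (ltn0Sn n) bs dn4 M1 HX.
have sub : ~` A n `<=` [set w | ~ good_path (sigma n) (fun k m => p k m) c (ell n) M J D ((X n)^~ w)].
  move=> w /= Aw good; apply: Aw.
  exact: (hd0 n.+1 (ell n) (sigma n) J D _ _ _ (ltn0Sn n) bs dnd0 D1 D2 J1 J2 good
    (Gamma_most_visited n w) (gamma_pos n) g_large g_small).
have PA := probability_setC (P n) mAn.
have hbad : (1 - P n (A n) <= (CK * expR (- M) + expR (- dn))%:E)%E.
  rewrite -PA; apply: le_trans Pbad; apply: le_measure => //; rewrite inE//.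
  exact: measurableC.
have fA : P n (A n) = (fine (P n (A n)))%:E by rewrite fineK// fin_num_measure.
have leA : fine (P n (A n)) <= 1 by rewrite -lee_fin -fA; exact: probability_le1.
rewrite fA -EFinB lee_fin in hbad.
rewrite ger0_norm ?subr_ge0//; apply: le_trans hbad _.
have expV (x : R) : 0 < x -> expR (- x) <= x^-1.
  move=> x0; rewrite expRN lef_pV2 ?posrE ?expR_gt0//.
  by apply: le_trans (expR_ge1Dx x); lra.
have h1 : CK * expR (- M) <= eps / 2.
  apply: (@le_trans _ _ (CK * (CK * 2 / eps)^-1)).
    rewrite ler_wpM2l ?(ltW CK0)//; apply: le_trans (expV _ q0).
    by rewrite ler_expR lerN2 /M; lra.
  by rewrite le_eqVlt; apply/orP; left; apply/eqP; field; rewrite !gt_eqF.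
have h2 : expR (- dn) <= eps / 2.
  apply: le_trans (expV _ dn0) _.
  rewrite -(ler_pM2r dn0) mulVf ?gt_eqF//.
  by move: dn_eps; rewrite ler_pdivrMr//; lra.
lra.
Unshelve. all: by end_near.
Qed.
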